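(* Let $M$ be a simple bounded $\mathcal{A}$-module of central charge $c$. If $c=0$, then $I_k$ acts by $0$ on $M$ for all $k\ge0$ and $M$ is a simple bounded $W_1$-module isomorphic to one of the following: $T(\nu,\lambda)$ with $\lambda-\nu\notin\mathbb{Z}$; $L(\eta,+)$ with $\eta\neq0$; $L(\eta,-)$ with $\eta\ne0$; the trivial module $L(0)=\mathbb{C}$ ($\nu,\lambda,\eta\in\mathbb{C}$). If $c\neq0$, then $M$ is isomorphic to one of the following: $T(\nu,\lambda,c)$ with $\nu,\lambda\in\mathbb{C}$, $\lambda-\nu\notin\mathbb{Z}$; $L(\lambda,c,+)$ with $\lambda\in\mathbb{C}$; $L(\lambda,c,-)$ with $\lambda\in\mathbb{C}$. The only isomorphisms among the listed $\mathcal{A}$-modules for $c\neq0$ are $T(\nu,\lambda,c)\simeq T(\nu+n,\lambda,c)$, $n\in\mathbb{Z}$, for $\lambda-\nu\notin\mathbb{Z}$.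
   Context: Everything is over $\mathbb{C}$. $\mathcal{A}=\mathrm{Der}\,\mathbb{C}[x]\ltimes\mathbb{C}[x]$ has basis $D_i$ ($i\ge-1$), $I_j$ ($j\ge0$), where $D_i=x^{i+1}\partial$, $I_j=x^j$, with $[D_i,D_j]=(j-i)D_{i+j}$, $[D_i,I_j]=jI_{i+j}$, $[I_i,I_j]=0$. $W_1=\mathrm{Der}\,\mathbb{C}[x]=\mathrm{span}\{D_i\}$. An $\mathcal{A}$-module has central charge $c$ if $I_0$ acts by the scalar $c$. $\mathfrak{h}_{\mathcal{A}}=\mathrm{span}\{D_0,I_0\}$. A weight $\mathcal{A}$-module is one that is the direct sum of its simultaneous eigenspaces $M^\lambda$ ($\lambda\in\mathfrak{h}_{\mathcal{A}}^*$) for $\mathfrak{h}_{\mathcal{A}}$; it is bounded if there is $N>0$ with $\dim M^\lambda<N$ for all $\lambda$. Similarly for $W_1$ with Cartan subalgebra $\mathbb{C}D_0$. For $\nu,\lambda,c\in\mathbb{C}$: $T(\nu,\lambda,c)=\mathrm{span}\{x^{\nu+\ell}\otimes v_\lambda:\ell\in\mathbb{Z}\}$ with $D_i(x^{\nu+\ell}\otimes v_\lambda)=(\nu+\ell+i\lambda)x^{\nu+\ell+i}\otimes v_\lambda$ and $I_j(x^{\nu+\ell}\otimes v_\lambda)=c\,x^{\nu+\ell+j}\otimes v_\lambda$. $T(\lambda,\lambda,c,+)$ is the submodule $\mathrm{span}\{x^{\lambda+n}\otimes v_\lambda:n\ge0\}$ of $T(\lambda,\lambda,c)$, and $T(\lambda,\lambda,c,-)=T(\lambda,\lambda,c)/T(\lambda,\lambda,c,+)$.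 $T(\nu,\lambda)$, $T(\lambda,\lambda,\pm)$ denote the corresponding $W_1$-modules (restrictions to $W_1$). For $\lambda\neq0$: $L(\lambda,+)=T(\lambda,\lambda,+)$, $L(\lambda,-)=T(\lambda+1,\lambda+1,-)$. For $c\ne0$ and all $\lambda$: $L(\lambda,c,+)=T(\lambda,\lambda,c,+)$, $L(\lambda,c,-)=T(\lambda+1,\lambda+1,c,-)$. *)

(* Defs.v *)
From HB Require Import structures.
From mathcomp Require Import all_boot all_order all_algebra.
From mathcomp Require Import boolp classical_sets reals.
From mathcomp Require Import complex ring.
From mathcomp.multinomials Require Import freeg.

Set Implicit Arguments.
Unset Strict Implicit.
Unset Printing Implicit Defensive.

Import GRing.Theory.
Local Open Scope ring_scope.

HB.mixin Record Lmodule_isLie (F : fieldType) L of GRing.Lmodule F L := {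
  lieb : L -> L -> L;
  lieb_linearl : forall y, linear (lieb^~ y);
  lieb_linearr : forall x, linear (lieb x);
  liebxx : forall x, lieb x x = 0;
  lieb_jacobi : forall x y z,
    lieb x (lieb y z) + lieb y (lieb z x) + lieb z (lieb x y) = 0
}.

#[short(type="lieAlgType")]
HB.structure Definition LieAlg (F : fieldType) :=
  {L of Lmodule_isLie F L & GRing.Lmodule F L}.

Record lieModule (F : fieldType) (L : lieAlgType F) := LieModule {
  lm_car :> lmodType F;
  lact : L -> lm_car -> lm_car;
  lact_linearl : forall m, linear (lact^~ m);
  lact_linearr : forall a, linear (lact a);
  lact_bracket : forall a b m,
    lact (lieb a b) m = lact a (lact b m) - lact b (lact a m)
}.

Section ModuleNotions.
Variables (F : fieldType) (L : lieAlgType F).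
Implicit Types M N : lieModule L.

Definition lieIso M N : Prop :=
  exists f : {linear M -> N},
    bijective f /\ forall a m, f (lact a m) = lact a (f m).

Definition is_submodule M (S : set M) : Prop :=
  [/\ S 0,
      forall (k : F) (u v : M), S u -> S v -> S (k *: u + v) &
      forall a u, S u -> S (lact a u)].

Record submodule M := Submodule {
  smset :> set M;
  smP : is_submodule smset
}.

Definition simple_module M : Prop :=
  (exists m : M, m <> 0) /\
  forall S : set M, is_submodule S -> S = [set 0]%classic \/ S = [set: M]%classic.

Definition linspan (V : lmodType F) (I : Type) (v : I -> V) : set V :=
  [set m | exists s : seq (F * I), m = \sum_(x <- s) x.1 *: v x.2]%classic.

Definition has_dim (V : lmodType F) (S : set V) (n : nat) : Prop :=
  exists v : 'I_n -> V,
    (forall k : 'I_n -> F, \sum_i k i *: v i = 0 -> forall i, k i = 0) /\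
    S = linspan v.

Definition is_direct_sum (V : lmodType F) (I : eqType) (W : I -> set V) : Prop :=
  (forall m : V, exists (s : seq I) (u : I -> V),
     (forall i, W i (u i)) /\ m = \sum_(i <- s) u i) /\
  (forall (s : seq I) (u : I -> V), uniq s -> (forall i, W i (u i)) ->
     \sum_(i <- s) u i = 0 -> forall i, i \in s -> u i = 0).

(* The Cartan subalgebra is given by a basis [h] of it, and a linear form on it
   by the tuple of its values on [h]. *)
Definition weight_space r (h : r.-tuple L) M (lam : r.-tuple F) : set M :=
  [set m | forall i, lact (tnth h i) m = tnth lam i *: m]%classic.

Definition weight_module r (h : r.-tuple L) M : Prop :=
  is_direct_sum (@weight_space r h M).

Definition bounded_module r (h : r.-tuple L) M : Prop :=
  weight_module h M /\
  exists N : nat, (0 < N)%N /\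
    forall lam, exists2 n, (n < N)%N & has_dim (@weight_space r h M lam) n.

End ModuleNotions.

Section SubQuotient.
Variables (F : fieldType) (L : lieAlgType F) (M : lieModule L).
Variable S : submodule M.

Definition smpred : {pred M} := fun m => `[< smset S m >].

Lemma smpred_submod : submod_closed smpred.
Proof.
case: (smP S) => S0 SZD _; split; first exact/asboolP.
by move=> k u v /asboolP Su /asboolP Sv; apply/asboolP/SZD.
Qed.

HB.instance Definition _ := GRing.isSubmodClosed.Build F M smpred
  (GRing.submod_closed_semi smpred_submod).
HB.instance Definition _ := GRing.isZmodClosed.Build M smpred
  (GRing.submod_closedB smpred_submod).

Lemma smpred_act a m : m \in smpred -> lact a m \in smpred.
Proof. by case: (smP S) => _ _ SA /asboolP Sm; apply/asboolP/SA. Qed.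

Definition sub_car := {m : M | m \in smpred}.
HB.instance Definition _ := SubType.on sub_car.
HB.instance Definition _ := Choice.on sub_car.
HB.instance Definition _ := [SubChoice_isSubLmodule of sub_car by <:].

Definition sub_act (a : L) (m : sub_car) : sub_car :=
  exist _ (lact a (val m)) (smpred_act a (valP m)).

Lemma sub_act_linearl m : linear (sub_act^~ m).
Proof.
by move=> k a b; apply: val_inj; rewrite [RHS]linearP /= lact_linearl.
Qed.

Lemma sub_act_linearr a : linear (sub_act a).
Proof.
by move=> k u v; apply: val_inj; rewrite [RHS]linearP /= lact_linearr.
Qed.

Lemma sub_act_bracket a b m :
  sub_act (lieb a b) m = sub_act a (sub_act b m) - sub_act b (sub_act a m).
Proof. by apply: val_inj; rewrite raddfB /= lact_bracket. Qed.

Definition sub_module : lieModule L :=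
  @LieModule F L sub_car sub_act
    sub_act_linearl sub_act_linearr sub_act_bracket.

Definition quot_car := Quotient.quot smpred.
HB.instance Definition _ := GRing.Zmodule.on quot_car.

Local Open Scope quotient_scope.

Definition to_quot (m : M) : quot_car := \pi_(quot_car) m.

Lemma to_quotB : {morph to_quot : x y / x - y}.
Proof. by move=> x y; rewrite /to_quot raddfB. Qed.

Lemma to_quotD : {morph to_quot : x y / x + y}.
Proof. by move=> x y; rewrite /to_quot raddfD. Qed.

Lemma to_quotP x y : to_quot x = to_quot y <-> smset S (x - y).
Proof.
have := Quotient.idealrBE smpred x y; rewrite unfold_in => E.
split=> [xy|Sxy]; first by apply/asboolP; rewrite E; apply/eqP.
by apply/eqP; rewrite -E; apply/asboolP.
Qed.

Lemma to_quot_repr q : to_quot (repr q) = q.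
Proof. exact: reprK. Qed.

Lemma repr_to_quot m : smset S (repr (to_quot m) - m).
Proof. by apply/to_quotP; rewrite to_quot_repr. Qed.

Definition quot_scale (k : F) (q : quot_car) := to_quot (k *: repr q).
Definition quot_act (a : L) (q : quot_car) := to_quot (lact a (repr q)).

Lemma quot_scaleE k m : quot_scale k (to_quot m) = to_quot (k *: m).
Proof.
apply/to_quotP; rewrite -scalerBr.
by case: (smP S) => S0 SZD _; rewrite -[_ *: _]addr0; apply: SZD => //;
  exact: repr_to_quot.
Qed.

Lemma lactB (a : L) (u v : M) : lact a (u - v) = lact a u - lact a v.
Proof. by rewrite addrC -scaleN1r lact_linearr scaleN1r addrC. Qed.

Lemma quot_actE a m : quot_act a (to_quot m) = to_quot (lact a m).
Proof.
apply/to_quotP; rewrite -lactB.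
by case: (smP S) => _ _; apply; exact: repr_to_quot.
Qed.

Lemma quot_scaleA k l q : quot_scale k (quot_scale l q) = quot_scale (k * l) q.
Proof. by rewrite -[q]to_quot_repr !quot_scaleE scalerA. Qed.
Lemma quot_scale1 : left_id 1 quot_scale.
Proof. by move=> q; rewrite -[q]to_quot_repr quot_scaleE scale1r. Qed.
Lemma quot_scaleDr : right_distributive quot_scale +%R.
Proof.
move=> k q r; rewrite -[q]to_quot_repr -[r]to_quot_repr.
by rewrite -to_quotD !quot_scaleE scalerDr to_quotD.
Qed.
Lemma quot_scaleDl q : {morph quot_scale^~ q : k l / k + l}.
Proof.
by move=> k l; rewrite -[q]to_quot_repr !quot_scaleE scalerDl to_quotD.
Qed.

HB.instance Definition _ := GRing.Zmodule_isLmodule.Build F quot_car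
  quot_scaleA quot_scale1 quot_scaleDr quot_scaleDl.

Lemma to_quot_linear : linear to_quot.
Proof. by move=> k u v; rewrite to_quotD -quot_scaleE. Qed.

Lemma quot_act_linearl q : linear (quot_act^~ q).
Proof.
move=> k a b; rewrite -[q]to_quot_repr !quot_actE.
by rewrite lact_linearl to_quot_linear.
Qed.

Lemma quot_act_linearr a : linear (quot_act a).
Proof.
move=> k q r; rewrite -[q]to_quot_repr -[r]to_quot_repr.
by rewrite -to_quot_linear !quot_actE lact_linearr to_quot_linear.
Qed.

Lemma quot_act_bracket a b q :
  quot_act (lieb a b) q = quot_act a (quot_act b q) - quot_act b (quot_act a q).
Proof.
by rewrite -[q]to_quot_repr !quot_actE lact_bracket to_quotB.
Qed.

Definition quot_module : lieModule L :=
  @LieModule F L quot_car quot_act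
    quot_act_linearl quot_act_linearr quot_act_bracket.

End SubQuotient.

Section Restriction.
Variables (F : fieldType) (L L' : lieAlgType F) (phi : {linear L' -> L}).
Hypothesis phi_lieb : forall a b, phi (lieb a b) = lieb (phi a) (phi b).
Variable M : lieModule L.

Definition res_act (a : L') (m : M) := lact (phi a) m.

Lemma res_act_linearl m : linear (res_act^~ m).
Proof. by move=> k a b; rewrite /res_act linearP lact_linearl. Qed.

Lemma res_act_linearr a : linear (res_act a).
Proof. exact: lact_linearr. Qed.

Lemma res_act_bracket a b m :
  res_act (lieb a b) m = res_act a (res_act b m) - res_act b (res_act a m).
Proof. by rewrite /res_act phi_lieb lact_bracket. Qed.

Definition res_module : lieModule L' :=
  @LieModule F L' M res_act res_act_linearl res_act_linearr res_act_bracket.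

End Restriction.

Section Trivial.
Variables (F : fieldType) (L : lieAlgType F).

Definition triv_act (a : L) (m : F^o) : F^o := 0.

Lemma triv_act_linearl m : linear (triv_act^~ m).
Proof. by move=> k a b; rewrite /triv_act scaler0 addr0. Qed.
Lemma triv_act_linearr a : linear (triv_act a).
Proof. by move=> k u v; rewrite /triv_act scaler0 addr0. Qed.
Lemma triv_act_bracket a b m :
  triv_act (lieb a b) m = triv_act a (triv_act b m) - triv_act b (triv_act a m).
Proof. by rewrite /triv_act subrr. Qed.

Definition triv_module : lieModule L :=
  @LieModule F L F^o triv_act
    triv_act_linearl triv_act_linearr triv_act_bracket.

End Trivial.

(* The polynomial [f] stands for the derivation f d/dx. *)
Definition W1 (F : fieldType) := {poly F}.
(* The pair [(f, u)] stands for f d/dx + u. *)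
Definition Alie (F : fieldType) := (W1 F * {poly F})%type.

Section WittAlgebras.
Variable F : fieldType.

HB.instance Definition _ := GRing.Lmodule.on (W1 F).

Definition W1_bracket (f g : W1 F) : W1 F :=
  (f : {poly F}) * deriv g - (g : {poly F}) * deriv f.

(* [W1_bracket] is the commutator of derivations of F[x]. *)
Lemma W1_bracket_commutator (f g : W1 F) (p : {poly F}) :
  (W1_bracket f g : {poly F}) * p^`() =
  (f : {poly F}) * ((g : {poly F}) * p^`())^`() -
  (g : {poly F}) * ((f : {poly F}) * p^`())^`().
Proof. rewrite /W1_bracket !derivM; ring. Qed.

Lemma W1_bracket_linearl g : linear (W1_bracket^~ g).
Proof.
move=> k a b; rewrite /W1_bracket derivD derivZ -!mul_polyC; ring.
Qed.
Lemma W1_bracket_linearr f : linear (W1_bracket f).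
Proof.
move=> k a b; rewrite /W1_bracket derivD derivZ -!mul_polyC; ring.
Qed.
Lemma W1_bracketxx f : W1_bracket f f = 0.
Proof. exact: subrr. Qed.
Lemma W1_jacobi f g h :
  W1_bracket f (W1_bracket g h) + W1_bracket g (W1_bracket h f) +
  W1_bracket h (W1_bracket f g) = 0.
Proof. rewrite /W1_bracket !derivB !derivM; ring. Qed.

HB.instance Definition _ := Lmodule_isLie.Build F (W1 F)
  W1_bracket_linearl W1_bracket_linearr W1_bracketxx W1_jacobi.

HB.instance Definition _ := GRing.Lmodule.on (Alie F).

Definition Alie_bracket (a b : Alie F) : Alie F :=
  (lieb a.1 b.1, (a.1 : {poly F}) * b.2^`() - (b.1 : {poly F}) * a.2^`()).

Lemma Alie_bracket_linearl b : linear (Alie_bracket^~ b).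
Proof.
move=> k a a'; rewrite /Alie_bracket lieb_linearl; congr pair => /=.
rewrite derivD derivZ -!mul_polyC; ring.
Qed.
Lemma Alie_bracket_linearr a : linear (Alie_bracket a).
Proof.
move=> k b b'; rewrite /Alie_bracket lieb_linearr; congr pair => /=.
rewrite derivD derivZ -!mul_polyC; ring.
Qed.
Lemma Alie_bracketxx a : Alie_bracket a a = 0.
Proof. by rewrite /Alie_bracket liebxx subrr. Qed.
Lemma Alie_jacobi a b d :
  Alie_bracket a (Alie_bracket b d) + Alie_bracket b (Alie_bracket d a) +
  Alie_bracket d (Alie_bracket a b) = 0.
Proof.
congr pair => /=; first exact: lieb_jacobi.
rewrite /lieb /= /W1_bracket !derivB !derivM; ring.
Qed.

HB.instance Definition _ := Lmodule_isLie.Build F (Alie F)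
  Alie_bracket_linearl Alie_bracket_linearr Alie_bracketxx Alie_jacobi.

Lemma lieb0r (L : lieAlgType F) (x : L) : lieb x 0 = 0.
Proof.
by have := lieb_linearr x (-1) 0 0; rewrite scaler0 addr0 scaleN1r addNr.
Qed.

Lemma lieb_anti (L : lieAlgType F) (x y : L) : lieb x y = - lieb y x.
Proof.
have lD (u v w : L) : lieb (u + v) w = lieb u w + lieb v w.
  by have := lieb_linearl w 1 u v; rewrite !scale1r.
have rD (u v w : L) : lieb u (v + w) = lieb u v + lieb u w.
  by have := lieb_linearr u 1 v w; rewrite !scale1r.
apply/eqP; rewrite -addr_eq0; apply/eqP.
have := liebxx (x + y).
by rewrite lD !rD !liebxx addr0 add0r.
Qed.

(* Indices are shifted by one so as to be natural numbers:
   [WD n] is D_{n-1} = x^n d/dx, in particular D_0 = [WD 1]. *)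
Definition WD (n : nat) : W1 F := 'X^n.
Definition AD (n : nat) : Alie F := (WD n, 0).
Definition AI (j : nat) : Alie F := (0, 'X^j).

Lemma lieb_AD m n : lieb (AD m) (AD n) = (n%:R - m%:R) *: AD (m + n).-1.
Proof.
congr pair => /=; last by rewrite !deriv0 !mulr0 subrr scaler0.
rewrite /lieb /= /W1_bracket /WD !derivXn.
rewrite !mulrnAr -!exprD -!scaler_nat scalerBl.
case: m n => [|m] [|n]; rewrite ?scale0r //= ?addnS ?addn0 //.
by rewrite (addnC n.+1) addnS -addSn.
Qed.

Lemma lieb_AD_AI n j : lieb (AD n) (AI j) = j%:R *: AI (n + j).-1.
Proof.
congr pair => /=; first by rewrite lieb0r scaler0.
rewrite deriv0 mulr0 subr0 derivXn mulrnAr -exprD scaler_nat.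
by case: j => [|j]; rewrite ?mulr0n // addnS.
Qed.

Lemma lieb_AI i j : lieb (AI i) (AI j) = 0.
Proof. by congr pair; rewrite /= ?lieb0r // !mul0r subrr. Qed.

Definition W1_cartan : 1.-tuple (W1 F) := [tuple WD 1].
Definition Alie_cartan : 2.-tuple (Alie F) := [tuple AD 1; AI 0].

Definition W1_incl (f : W1 F) : Alie F := (f, 0).
Lemma W1_incl_linear : linear W1_incl.
Proof. by move=> k f g; congr pair; rewrite /= scaler0 addr0. Qed.
HB.instance Definition _ := GRing.isLinear.Build F (W1 F) (Alie F) *:%R
  W1_incl W1_incl_linear.
Lemma W1_incl_lieb f g : W1_incl (lieb f g) = lieb (W1_incl f) (W1_incl g).
Proof. by congr pair; rewrite /= !deriv0 !mulr0 subrr. Qed.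

End WittAlgebras.

Section LinearExtension.
Variables (F : fieldType) (K : choiceType) (V : lmodType F).

Lemma linear_sumZ (U : lmodType F) (f : U -> V) (I : Type) (s : seq I)
    (k : I -> F) (u : I -> U) :
  linear f -> f (\sum_(i <- s) k i *: u i) = \sum_(i <- s) k i *: f (u i).
Proof.
move=> lf; pose g : {linear U -> V} := HB.pack f (GRing.isLinear.Build _ _ _ _ f lf).
rewrite -[f]/(g : U -> V) linear_sum; apply: eq_bigr => i _; exact: linearZ.
Qed.

Lemma freegZU (k : F) (x : K) : k *: (<< x >> : {freeg K / F}) = << k *g x >>.
Proof. by apply/eqP/freeg_eqP => y; rewrite coeffZ !coeffU mul1r. Qed.

Lemma freeg_sumZ (D : {freeg K / F}) : D = \sum_(z <- dom D) coeff z D *: << z >>.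
Proof.
by rewrite -[LHS]freeg_sumE; apply: eq_bigr => z _; rewrite freegZU.
Qed.

Lemma freeg_linext (f g : {freeg K / F} -> V) :
  linear f -> linear g -> (forall z, f << z >> = g << z >>) -> f =1 g.
Proof.
move=> lf lg fg D; rewrite (freeg_sumZ D) !linear_sumZ //.
by apply: eq_bigr => z _; rewrite fg.
Qed.

Lemma fgliftE (h : K -> V) D : fglift h D = \sum_(z <- dom D) coeff z D *: h z.
Proof. by rewrite -{1}[D]Freeg_dom fglift_Freeg /prelift big_map. Qed.

Lemma fglift1 (h : K -> V) z : fglift h << z >> = h z.
Proof. by rewrite liftU scale1r. Qed.

Lemma fglift_linear (h : K -> V) : linear (fglift h).
Proof.
pose g : {additive {freeg K / F} -> V} :=
  HB.pack (fglift h) (GRing.isZmodMorphism.Build _ _ (fglift h) (lift_is_additive h)).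
move=> k u v; rewrite -[fglift h]/(g : {freeg K / F} -> V) raddfD; congr (_ + _).
rewrite /g /= [in RHS](fgliftE h u) scaler_sumr -[fglift h]/(g : {freeg K / F} -> V).
rewrite {1}(freeg_sumZ u) scaler_sumr raddf_sum; apply: eq_bigr => z _.
by rewrite scalerA freegZU /g /= liftU scalerA.
Qed.

(* The linear map F[x] -> V with x^k |-> E k. *)
Definition polylift (E : nat -> V) (p : {poly F}) : V :=
  \sum_(k < size p) p`_k *: E k.

Lemma polylift_widen (E : nat -> V) (p : {poly F}) n : (size p <= n)%N ->
  polylift E p = \sum_(k < n) p`_k *: E k.
Proof.
move=> pn; rewrite /polylift (big_ord_widen n (fun k => p`_k *: E k)) //.
rewrite big_mkcond /=; apply: eq_bigr => k _; case: ltnP => // kp.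
by rewrite nth_default // scale0r.
Qed.

Lemma polylift_linear (E : nat -> V) : linear (polylift E).
Proof.
move=> k p q; pose n := maxn (size (k *: p + q)) (maxn (size p) (size q)).
rewrite !(@polylift_widen E _ n) ?leq_max ?leqnn ?orbT //.
rewrite scaler_sumr -big_split; apply: eq_bigr => i _ /=.
by rewrite coefD coefZ scalerDl scalerA.
Qed.

Lemma polyliftXn (E : nat -> V) n : polylift E 'X^n = E n.
Proof.
rewrite /polylift size_polyXn (bigD1 ord_max) //= coefXn eqxx scale1r.
rewrite big1 ?addr0 // => i; rewrite -val_eqE /= coefXn => /negPf->.
by rewrite scale0r.
Qed.

Lemma poly_linext (f g : {poly F} -> V) :
  linear f -> linear g -> (forall n, f 'X^n = g 'X^n) -> f =1 g.
Proof.
move=> lf lg fg p; rewrite -[p]coefK poly_def !linear_sumZ //.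
by apply: eq_bigr => i _; rewrite fg.
Qed.

Lemma Alie_linext (f g : Alie F -> V) :
  linear f -> linear g -> (forall n, f (AD F n) = g (AD F n)) ->
  (forall j, f (AI F j) = g (AI F j)) -> f =1 g.
Proof.
move=> lf lg fgD fgI [p q].
have E : (p, q) = 1 *: ((p, 0) : Alie F) + (0, q).
  by rewrite scale1r; congr pair; rewrite /= ?addr0 ?add0r.
rewrite E lf lg; congr (_ *: _ + _).
- apply: (poly_linext (f := fun p => f (p, 0)) (g := fun p => g (p, 0))) => //.
  + move=> k x y; rewrite -lf; congr (f (_, _)).
    by rewrite /= scaler0 addr0.
  + move=> k x y; rewrite -lg; congr (g (_, _)).
    by rewrite /= scaler0 addr0.
- apply: (poly_linext (f := fun p => f (0, p)) (g := fun p => g (0, p))) => //.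
  + move=> k x y; rewrite -lf; congr (f (_, _)).
    by rewrite /= scaler0 addr0.
  + move=> k x y; rewrite -lg; congr (g (_, _)).
    by rewrite /= scaler0 addr0.
Qed.

End LinearExtension.

Section TensorModules.
Variable F : fieldType.
Variables nu lambda c : F.

(* The basis vector << l >> stands for x^(nu + l) (x) v_lambda. *)
Local Notation TT := {freeg int / F}.

Definition T_basis_act (a : Alie F) (l : int) : TT :=
  polylift (fun n : nat =>
    (nu + l%:~R + (n%:R - 1) * lambda) *: (<< l + n%:Z - 1 >> : TT)) a.1 +
  polylift (fun j : nat => c *: (<< l + j%:Z >> : TT)) a.2.

Definition T_act (a : Alie F) : TT -> TT := fglift (T_basis_act a).

Lemma T_act_linearr a : linear (T_act a).
Proof. exact: fglift_linear. Qed.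

Lemma T_act_linearl m : linear (T_act^~ m).
Proof.
move=> k a b; rewrite /T_act !fgliftE scaler_sumr -big_split /=.
apply: eq_bigr => z _; rewrite /T_basis_act /= !polylift_linear.
by rewrite scalerA mulrC -scalerA -scalerDr addrACA -scalerDr.
Qed.

Lemma T_act_D n l :
  T_act (AD F n) << l >> =
  (nu + l%:~R + (n%:R - 1) * lambda) *: (<< l + n%:Z - 1 >> : TT).
Proof.
by rewrite /T_act fglift1 /T_basis_act polyliftXn /polylift size_poly0 big_ord0 addr0.
Qed.

Lemma T_act_I j l : T_act (AI F j) << l >> = c *: (<< l + j%:Z >> : TT).
Proof.
by rewrite /T_act fglift1 /T_basis_act polyliftXn /polylift size_poly0 big_ord0 add0r.
Qed.

Lemma T_act_W1 (f : W1 F) m :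
  T_act (W1_incl f) m = fglift (fun l : int => polylift (fun n : nat =>
    (nu + l%:~R + (n%:R - 1) * lambda) *: (<< l + n%:Z - 1 >> : TT)) f) m.
Proof.
rewrite /T_act !fgliftE; apply: eq_bigr => l _; rewrite /T_basis_act /=.
by rewrite {2}/polylift size_poly0 big_ord0 addr0.
Qed.

Lemma T_actZ a k m : T_act a (k *: m) = k *: T_act a m.
Proof.
have T0 : T_act a 0 = 0.
  by have := T_act_linearr a (-1) 0 0; rewrite scaler0 addr0 scaleN1r addNr.
by have := T_act_linearr a k m 0; rewrite T0 !addr0.
Qed.

Lemma T_actZl a k m : T_act (k *: a) m = k *: T_act a m.
Proof.
have T0 : T_act 0 m = 0.
  by have := T_act_linearl m (-1) 0 0; rewrite scaler0 addr0 scaleN1r addNr.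
by have := T_act_linearl m k a 0; rewrite T0 !addr0.
Qed.

Lemma basisZ_congr (k k' : F) (l l' : int) : k = k' -> l = l' ->
  k *: (<< l >> : TT) = k' *: (<< l' >> : TT).
Proof. by move=> -> ->. Qed.

Lemma intr_shift (l : int) (n : nat) : (l + n%:Z)%:~R = l%:~R + n%:R :> F.
Proof. by rewrite rmorphD. Qed.

Lemma intr_shift1 (l : int) (n : nat) :
  (l + n%:Z - 1)%:~R = l%:~R + n%:R - 1 :> F.
Proof. by rewrite rmorphB rmorphD. Qed.

Lemma T_act_bracket_DD m n l :
  T_act (lieb (AD F m) (AD F n)) << l >> =
  T_act (AD F m) (T_act (AD F n) << l >>) -
  T_act (AD F n) (T_act (AD F m) << l >>).
Proof.
rewrite lieb_AD T_actZl !(T_act_D, T_actZ) !scalerA.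
have -> : l + n%:Z - 1 + m%:Z - 1 = l + m%:Z - 1 + n%:Z - 1 by ring.
rewrite -scalerBl !intr_shift1.
have [mn0|] := posnP (m + n).
  move/eqP: mn0; rewrite addn_eq0 => /andP[/eqP-> /eqP->].
  by rewrite !subrr mul0r !scale0r.
case mn : (m + n)%N => [|p] // _ /=.
have mnF : p%:R = m%:R + n%:R - 1 :> F by rewrite -natrD mn -natr1 addrK.
have mnZ : p%:Z = m%:Z + n%:Z - 1 by rewrite -PoszD mn -addn1 PoszD addrK.
by apply: basisZ_congr; rewrite ?mnF ?mnZ; ring.
Qed.

Lemma T_act_bracket_DI n j l :
  T_act (lieb (AD F n) (AI F j)) << l >> =
  T_act (AD F n) (T_act (AI F j) << l >>) -
  T_act (AI F j) (T_act (AD F n) << l >>).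
Proof.
rewrite lieb_AD_AI T_actZl !(T_act_D, T_act_I, T_actZ) !scalerA.
have -> : l + n%:Z - 1 + j%:Z = l + j%:Z + n%:Z - 1 by ring.
rewrite -scalerBl !intr_shift.
case: j => [|j].
  have -> : c * (nu + (l%:~R + 0%:R) + (n%:R - 1) * lambda) -
            (nu + l%:~R + (n%:R - 1) * lambda) * c = 0 by ring.
  by rewrite mul0r !scale0r.
rewrite addnS /=; apply: basisZ_congr; rewrite ?PoszD -1?[j.+1]addn1 ?PoszD; ring.
Qed.

Lemma T_act_bracket_II i j l :
  T_act (lieb (AI F i) (AI F j)) << l >> =
  T_act (AI F i) (T_act (AI F j) << l >>) -
  T_act (AI F j) (T_act (AI F i) << l >>).
Proof.
rewrite lieb_AI !(T_act_I, T_actZ) addrAC subrr.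
by rewrite -(scale0r (0 : Alie F)) T_actZl scale0r.
Qed.

Lemma T_act_bracket a b m :
  T_act (lieb a b) m = T_act a (T_act b m) - T_act b (T_act a m).
Proof.
have combD (V : lmodType F) (k : F) (u v u' v' : V) :
    k *: u + v - (k *: u' + v') = k *: (u - u') + (v - v').
  by rewrite scalerBr opprD addrACA.
move: m; apply: freeg_linext; first exact: T_act_linearr.
  by move=> k u v; rewrite !T_act_linearr combD.
move=> l; move: a.
have linL (d : Alie F) : linear (fun a => T_act (lieb a d) << l >>).
  by move=> k a a'; rewrite lieb_linearl T_act_linearl.
have linR (d : Alie F) : linear (fun b => T_act (lieb d b) << l >>).
  by move=> k a a'; rewrite lieb_linearr T_act_linearl.
have linL' (d : Alie F) : linear (fun a =>
    T_act a (T_act d << l >>) - T_act d (T_act a << l >>)).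
  by move=> k a a'; rewrite !T_act_linearl T_act_linearr combD.
have linR' (d : Alie F) : linear (fun b =>
    T_act d (T_act b << l >>) - T_act b (T_act d << l >>)).
  by move=> k a a'; rewrite !T_act_linearl T_act_linearr combD.
apply: (@Alie_linext F _ (fun a => T_act (lieb a b) << l >>)
  (fun a => T_act a (T_act b << l >>) - T_act b (T_act a << l >>))) => //.
- move=> m; move: b.
  apply: (@Alie_linext F _ (fun b => T_act (lieb (AD F m) b) << l >>)
    (fun b => T_act (AD F m) (T_act b << l >>) -
              T_act b (T_act (AD F m) << l >>))) => //.
  + by move=> n; apply: T_act_bracket_DD.
  + by move=> n; apply: T_act_bracket_DI.
- move=> i; move: b.
  apply: (@Alie_linext F _ (fun b => T_act (lieb (AI F i) b) << l >>)
    (fun b => T_act (AI F i) (T_act b << l >>) -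
              T_act b (T_act (AI F i) << l >>))) => //.
  + move=> n.
    by rewrite lieb_anti -scaleN1r T_actZl T_act_bracket_DI scaleN1r opprB.
  + by move=> n; apply: T_act_bracket_II.
Qed.

Definition T_module : lieModule (Alie F) :=
  @LieModule F (Alie F) TT T_act T_act_linearl T_act_linearr T_act_bracket.

End TensorModules.

Section SimpleModules.
Variable F : fieldType.

(* T(lambda,lambda,c,+), spanned by the x^(lambda + n) (x) v_lambda, n >= 0. *)
Definition T_plus_set (lambda c : F) : set (T_module lambda lambda c) :=
  linspan (fun n : nat => << n%:Z >> : {freeg int / F}).

Lemma T_plus_submodule lambda c : is_submodule (@T_plus_set lambda c).
Proof.
have span0 : @T_plus_set lambda c 0 by exists [::]; rewrite big_nil.
have spanP k u v : @T_plus_set lambda c u -> @T_plus_set lambda c v ->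
    @T_plus_set lambda c (k *: u + v).
  move=> [s ->] [t ->]; exists ([seq (k * x.1, x.2) | x <- s] ++ t).
  rewrite big_cat big_map scaler_sumr /=; congr (_ + _).
  by apply: eq_bigr => x _; rewrite scalerA.
have span_sum (I : Type) (r : seq I) (k : I -> F) (u : I -> {freeg int / F}) :
    (forall i, @T_plus_set lambda c (u i)) ->
    @T_plus_set lambda c (\sum_(i <- r) k i *: u i).
  move=> Su; elim: r => [|i r IHr]; first by rewrite big_nil.
  by rewrite big_cons; apply: (spanP _).
have spanZ k (n : nat) : @T_plus_set lambda c (k *: (<< n%:Z >> : {freeg int / F})).
  by exists [:: (k, n)]; rewrite big_seq1.
split=> // a _ [s ->].
have -> : @lact _ _ (T_module lambda lambda c) a
            (\sum_(x <- s) x.1 *: (<< x.2%:Z >> : {freeg int / F})) =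
          \sum_(x <- s) x.1 *: T_basis_act lambda lambda c a x.2%:Z.
  rewrite /= (linear_sumZ _ _ _ (@T_act_linearr _ lambda lambda c a)).
  by apply: eq_bigr => x _; rewrite /T_act fglift1.
apply: (span_sum _) => -[_ n] /=; rewrite /T_basis_act -[X in X + _]scale1r.
apply: (spanP _); apply: (span_sum _) => k; last exact: spanZ.
case: (posnP (n + k)) => [/eqP|].
  rewrite addn_eq0 => /andP[/eqP-> /eqP->].
  have -> : lambda + 0%:~R + (0%:R - 1) * lambda = 0 by ring.
  by rewrite scale0r.
case nk : (n + k)%N => [|p] // _.
by rewrite -PoszD nk -addn1 PoszD addrK; apply: spanZ.
Qed.

Definition T_plus_sub lambda c : submodule (T_module lambda lambda c) :=
  Submodule (@T_plus_submodule lambda c).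

Definition T_plus (lambda c : F) : lieModule (Alie F) :=
  sub_module (T_plus_sub lambda c).
Definition T_minus (lambda c : F) : lieModule (Alie F) :=
  quot_module (T_plus_sub lambda c).

Definition L_plus (lambda c : F) := T_plus lambda c.
Definition L_minus (lambda c : F) := T_minus (lambda + 1) c.

Definition res_W1 (M : lieModule (Alie F)) : lieModule (W1 F) :=
  res_module (@W1_incl_lieb F) M.

(* The value c = 0 below is immaterial, by [T_act_W1]. *)
Definition W1_T (nu lambda : F) := res_W1 (T_module nu lambda 0).
Definition W1_L_plus (eta : F) := res_W1 (L_plus eta 0).
Definition W1_L_minus (eta : F) := res_W1 (L_minus eta 0).

Definition central_charge (M : lieModule (Alie F)) (c : F) : Prop :=
  forall m : M, lact (AI F 0) m = c *: m.

Definition is_integer (z : F) : Prop := exists n : int, z = n%:~R.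

End SimpleModules.

(* Main.v *)
(* Write d = D_{-1}.  If d kills a nonzero vector, it kills one of some weight
   lam; d is injective on the weights lam + k, k > 0, and this forces M to be
   L(lam, c, +), or trivial when lam = c = 0.

   Otherwise let s0 be a weight of maximal multiplicity.  Then d identifies all
   the weight spaces of weight s0 - l, and D_i, I_j become matrices depending
   polynomially on l.  The series E(t) = sum t^e/e! D_{e-1} and
   J(t) = sum t^e/e! I_e satisfy [E(t), E(u)] = (u - t) E(t + u),
   [E(t), J(u)] = u J(t + u) and [J(t), J(u)] = 0.  Exchanging letters, and
   rotating words under the trace, one finds that the degree k part of
   a product of such series, with parameters of sum 0, has trace 0 as soon as k
   exceeds the number of factors E.  As M is simple the operators preserving the
   weight space s0 - 1 act irreducibly on it, and these parts vanish.  The first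
   vanishing parts say that D_1 d, D_2 d^2 and I_1 d commute on every weight
   space; they are then scalars determined by the weight and one parameter lam,
   whence M is T(nu, lam, c) or L(lam - 1, c, -).

   The isomorphisms are separated by I_0, by the identity
   I_1 d = c (D_0 - lam) valid on T(nu, lam, c), by the set of weights, and by the
   kernels of d and I_1. *)
From HB Require Import structures.
Require Import Defs.
From mathcomp Require Import all_boot all_order all_algebra.
From mathcomp Require Import boolp classical_sets reals complex.
From mathcomp Require Import ring zify.
From mathcomp.multinomials Require Import freeg.

Set Implicit Arguments.
Unset Strict Implicit.
Unset Printing Implicit Defensive.
Import Order.TTheory GRing.Theory Num.Theory.
Local Open Scope ring_scope.

(** * Generalized binomial coefficients *)

(** The excess of the degree k over the number of factors E is the weight of the product, so the
    parts that vanish are the weight raising ones, brought back by a power of d. The correction to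
    an exchange of letters has both numbers lower by one, hence the same excess. The exponential
    series are chosen because [d, E(t)] = t E(t) and [d, J(t)] = t J(t): a part with parameters of
    sum 0 commutes with d and is the same matrix on all the weight spaces. Single letters lack this
    property, so rotating a word under the trace moves its factors to other weight spaces; the price
    is a sum over lower degrees, whose binomial coefficients vanish in the right range.

    Trace 0 is not yet vanishing. It must hold against a whole algebra acting irreducibly, and for
    this one takes the algebra of the parts of weight at least 0: those of weight 0 already give D_1
    d, D_2 d^2 and I_1 d up to lower terms. A product of several parts is reduced to a single word
    by scaling the parameters of one factor independently of the others, which separates its
    degrees. *)

Lemma big_triangle (V : nmodType) k (G : nat -> nat -> V) :
  \sum_(i < k.+1) \sum_(j < (k - i).+1) G i j =
  \sum_(n < k.+1) \sum_(i < n.+1) G i (n - i)%N.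
Proof.
elim: k => [|k IH]; first by rewrite !big_ord1.
rewrite [RHS]big_ord_recr -IH [LHS]big_ord_recr /= subnn big_ord1.
rewrite [X in _ = _ + X]big_ord_recr /= subnn addrA -big_split; congr (_ + _).
by apply: eq_bigr => i _ /=; rewrite subSn -1?ltnS // big_ord_recr.
Qed.

Section GeneralizedBinomial.
Variable F : numFieldType.

(** The upper argument is an integer because it will be a position of a weight space, and positions
    of both signs occur. *)
Definition binz (x : int) (j : nat) : F :=
  (\prod_(i < j) (x - i%:Z)%:~R) / j`!%:R.

Lemma binz0 x : binz x 0 = 1.
Proof. by rewrite /binz big_ord0 fact0 divr1. Qed.

Lemma factr_neq0 n : n`!%:R != 0 :> F.
Proof. by rewrite pnatr_eq0 -lt0n fact_gt0. Qed.

Lemma binzS x j : binz (x + 1) j.+1 = binz x j.+1 + binz x j.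
Proof.
rewrite /binz big_ord_recl [in RHS]big_ord_recr /=.
have E (i : 'I_j) : true -> (x + 1 - (bump 0 i)%:Z)%:~R = (x - i%:Z)%:~R :> F.
  by move=> _; congr (_%:~R); rewrite /bump /=; lia.
rewrite (eq_bigr _ E).
have j0 := factr_neq0 j; have j1 : j%:R + 1 != 0 :> F.
  by rewrite natr1 pnatr_eq0.
rewrite factS natrM subr0 rmorphB rmorphD /= -natr1.
by field; rewrite j0 j1.
Qed.

Lemma binz_small (n j : nat) : (n < j)%N -> binz n%:Z j = 0.
Proof.
move=> nj; rewrite /binz (bigD1 (Ordinal nj)) //=.
by rewrite subrr mul0r mul0r.
Qed.

Lemma binz1 x : binz x 1 = x%:~R.
Proof. by rewrite /binz big_ord1 subr0 divr1. Qed.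

(** The step is an equivalence so that one recurrence in the position serves upwards and
    downwards. *)
Lemma int_shift_ind (T : int -> Prop) (x0 : int) : T x0 ->
  (forall x, T x <-> T (x + 1)) -> forall x, T x.
Proof.
move=> T0 TS; have Tn (n : nat) : T (x0 + n%:Z).
  elim: n => [|n IHn]; first by rewrite addr0.
  by rewrite -addn1 PoszD addrA -TS.
have Tm (n : nat) : T (x0 - n%:Z).
  elim: n => [|n IHn]; first by rewrite subr0.
  by rewrite TS -addn1 PoszD opprD addrA subrK.
move=> x; have [-> | ->] : x = x0 + `|x - x0|%N%:Z \/ x = x0 - `|x - x0|%N%:Z by lia.
- exact: Tn.
- exact: Tm.
Qed.

(** A form of the Chu-Vandermonde identity. By Pascal's rule in [y] both sides satisfy the same
    recurrence, which lowers [L]; at y = 0 only the term j = 0 survives. *)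
Lemma binz_alt_convolution (x y : int) L :
  \sum_(j < L.+1) (-1) ^+ j * binz y j * binz (x - j%:Z) (L - j) =
  binz (x - y) L.
Proof.
pose S x y L := \sum_(j < L.+1) (-1) ^+ j * binz y j * binz (x - j%:Z) (L - j).
suff SE : forall L x y, S x y L = binz (x - y) L by exact: SE.
have SS u v M : S u (v + 1) M.+1 = S u v M.+1 - S (u - 1) v M.
  rewrite /S big_ord_recl [in RHS]big_ord_recl !binz0 /= -addrA; congr (_ + _).
  rewrite -sumrB; apply: eq_bigr => i _; rewrite /bump /= add1n subSS.
  rewrite binzS exprS.
  by rewrite (_ : u - i.+1%:Z = u - 1 - i%:Z); [ring|lia].
elim=> [|M IH] u v; first by rewrite /S big_ord1 !binz0 expr0 !mul1r.
move: v; apply: (@int_shift_ind _ 0) => [|v].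
  rewrite /S big_ord_recl binz0 big1 ?addr0 => [|i _].
    by rewrite /= expr0 !mul1r subn0.
  by rewrite (@binz_small 0) // mulr0 mul0r.
rewrite SS IH.
have -> : u - 1 - v = u - (v + 1) by lia.
have {1}-> : u - v = u - (v + 1) + 1 by lia.
rewrite binzS; split=> [->|H]; first by rewrite addrK.
by rewrite -[LHS](subrK (binz (u - (v + 1)) M)) H.
Qed.

End GeneralizedBinomial.

(** * Words in the generating series and their traces *)

Definition wt (kap : bool) (e : nat) : int := e%:Z - (~~ kap : nat)%:Z.

(* [op false e s] stands for D_{e-1} and [op true e s] for I_e, acting between
   weight spaces identified through D_{-1}; the target is at position [s] and
   [wt] is the weight of the operator.  [op_shift] expresses the bracket with
   D_{-1} and [op_rel] the other brackets. *)
Record opsys (F : numFieldType) (d : nat) (c w : F) := OpSys {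
  op :> bool -> nat -> int -> 'M[F]_d.+1;
  op_shift : forall kap e s,
    op kap e (s + 1) = op kap e s + e%:R *: op kap e.-1 s;
  op_rel : forall kap e kap' f s,
    op kap e s * op kap' f (s - wt kap e) -
    op kap' f s * op kap e (s - wt kap' f) =
    ((~~ kap)%:R * f%:R - (~~ kap')%:R * e%:R) *: op (kap || kap') (e + f).-1 s;
  op_D0 : forall s, op false 0 s = 1;
  op_D1 : forall s, op false 1 s = (w + s%:~R)%:M;
  op_I0 : forall s, op true 0 s = c%:M
}.

Lemma big_triangle_sym (V : nmodType) k (G : nat -> nat -> V) :
  \sum_(i < k.+1) \sum_(j < (k - i).+1) G i j =
  \sum_(j < k.+1) \sum_(i < (k - j).+1) G i j.
Proof.
rewrite big_triangle (big_triangle k (fun j i => G i j)).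
apply: eq_bigr => n _; rewrite (reindex_inj rev_ord_inj); apply: eq_bigr => i _ /=.
by rewrite subSS subKn // -ltnS.
Qed.

Section Words.
Variables (F : numFieldType) (d : nat) (c w : F) (P : opsys d c w).
Local Notation letter := (bool * F)%type.
Implicit Types (x y : letter) (l : seq letter).

Definition lop x e s : 'M[F]_d.+1 := (x.2 ^+ e / e`!%:R) *: P x.1 e s.

(* The degree [k] part of the product, over the letters (kap, t), of the series
   sum_e t^e/e! (op kap e). *)
Fixpoint word l (k : nat) (s : int) : 'M[F]_d.+1 :=
  if l is x :: l' then
    \sum_(e < k.+1) lop x e s * word l' (k - e) (s - wt x.1 e)
  else (k == 0)%:R.

Definition tot l : F := \sum_(x <- l) x.2.
Definition nD l : nat := \sum_(x <- l) ~~ x.1.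

Lemma tot_cons x l : tot (x :: l) = x.2 + tot l.
Proof. exact: big_cons. Qed.
Lemma nD_cons x l : nD (x :: l) = (~~ x.1 + nD l)%N.
Proof. exact: big_cons. Qed.
Lemma tot_cat l l' : tot (l ++ l') = tot l + tot l'.
Proof. exact: big_cat. Qed.
Lemma nD_cat l l' : nD (l ++ l') = (nD l + nD l')%N.
Proof. exact: big_cat. Qed.

Lemma lop0 x s : lop x 0 (s + 1) = lop x 0 s.
Proof. by rewrite /lop op_shift scale0r addr0. Qed.

Lemma lopS x e s : lop x e.+1 (s + 1) = lop x e.+1 s + x.2 *: lop x e s.
Proof.
rewrite /lop op_shift /= scalerDr; congr (_ + _).
rewrite !scalerA factS natrM exprS; congr (_ *: _).
have := @factr_neq0 F e; have : e.+1%:R != 0 :> F by rewrite pnatr_eq0.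
by move=> e1 e0; field; rewrite e0 nat1r e1.
Qed.

Definition word_pred l k s := if k is k'.+1 then word l k' s else 0.

(** For either kind of letter [D_{-1}, X(t)] = t X(t), and by the Leibniz rule the parameters of a
    product add up. *)
Lemma word_shift1 l k s :
  word l k (s + 1) = word l k s + tot l *: word_pred l k s.
Proof.
elim: l k s => [|x l IH] k s.
  by rewrite /tot big_nil scale0r addr0.
case: k => [|k]; first by rewrite /= !big_ord1 addrAC IH /= !scaler0 !addr0 lop0.
have wtS e : s + 1 - wt x.1 e = s - wt x.1 e + 1 by rewrite addrAC.
pose A e := lop x e s * word l (k.+1 - e) (s - wt x.1 e).
pose B e := lop x e s * word l (k - e) (s - wt x.1 e).
pose C e := tot l *: (lop x e s * word_pred l (k.+1 - e) (s - wt x.1 e)).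
have step (e : nat) : lop x e (s + 1) * word l (k.+1 - e) (s + 1 - wt x.1 e) =
    A e + C e + (if e is e'.+1 then x.2 *: B e' else 0).
  case: e => [|e].
    by rewrite lop0 wtS IH mulrDr /A /C -scalerAr addr0.
  rewrite lopS mulrDl; congr (_ + _).
    by rewrite wtS IH mulrDr /A /C -scalerAr.
  rewrite -scalerAl /B subSS; congr (_ *: (_ * word _ _ _)).
  by rewrite /wt -addn1 PoszD; lia.
rewrite [LHS]/= (eq_bigr _ (fun (i : 'I_k.+2) _ => step i)) !big_split /= -addrA.
congr (_ + _); rewrite tot_cons scalerDl [RHS]addrC; congr (_ + _).
  rewrite /C big_ord_recr /= subnn mulr0 scaler0 addr0 -scaler_sumr.
  congr (_ *: _); apply: eq_bigr => i _; rewrite subSn //.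
  by rewrite -ltnS.
by rewrite big_ord_recl add0r scaler_sumr; apply: eq_bigr.
Qed.

(** The binomial expansion of the r-th power of the operator of [word_shift1], for negative [r] as
    well. *)
Lemma word_shift l k s r :
  word l k (s + r) =
  \sum_(j < k.+1) (binz F r j * tot l ^+ j) *: word l (k - j) s.
Proof.
pose T r k := \sum_(j < k.+1) (binz F r j * tot l ^+ j) *: word l (k - j) s.
pose Tp r k := if k is k'.+1 then T r k' else 0.
have TS u q : T (u + 1) q = T u q + tot l *: Tp u q.
  case: q => [|q]; first by rewrite /T !big_ord1 !binz0 scaler0 addr0.
  rewrite /T big_ord_recl [in RHS]big_ord_recl !binz0 -addrA; congr (_ + _).
  rewrite scaler_sumr -big_split; apply: eq_bigr => i _.
  rewrite /bump /= ?add1n subSS binzS exprS scalerA -scalerDl; congr (_ *: _).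
  by ring.
have E : forall q u, word l q (s + u) = T u q.
  elim=> [|q IHq]; apply: (@int_shift_ind _ 0) => [|u].
  - by rewrite /T big_ord1 binz0 mul1r scale1r addr0 subn0.
  - by rewrite TS addrA word_shift1 /= !scaler0 !addr0.
  - rewrite addr0 /T big_ord_recl binz0 mul1r scale1r subn0 big1 ?addr0 // => i _.
    by rewrite (@binz_small _ 0) // mul0r scale0r.
  - rewrite TS addrA word_shift1 /= IHq; split=> [->//|H].
    exact: (addIr _ H).
exact: E.
Qed.

Lemma word_loop l k s s' : tot l = 0 -> word l k s = word l k s'.
Proof.
move=> l0; rewrite -[s](subrK s') addrC word_shift big_ord_recl binz0 l0.
rewrite mul1r scale1r subn0 big1 ?addr0 // => i _.
by rewrite exprS mul0r mulr0 scale0r.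
Qed.

Lemma word_cat l1 l2 k s :
  word (l1 ++ l2) k s =
  \sum_(a < k.+1) word l1 a s * word l2 (k - a) (s - (a%:Z - (nD l1)%:Z)).
Proof.
elim: l1 k s => [|x l1 IH] k s.
  rewrite big_ord_recl mul1r big1 => [|i _]; last by rewrite mul0r.
  by rewrite addr0 subn0 /nD big_nil; congr (word _ _ _); rewrite /=; lia.
pose G e a := lop x e s * (word l1 a (s - wt x.1 e) *
   word l2 (k - e - a) (s - wt x.1 e - (a%:Z - (nD l1)%:Z))).
transitivity (\sum_(e < k.+1) \sum_(a < (k - e).+1) G e a).
  by rewrite /=; apply: eq_bigr => e _; rewrite IH mulr_sumr.
rewrite big_triangle; apply: eq_bigr => n _ /=.
rewrite mulr_suml; apply: eq_bigr => e _; rewrite /G mulrA; congr (_ * word _ _ _).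
  have := ltn_ord n; have := ltn_ord e; lia.
have := ltn_ord e; rewrite nD_cons /wt; lia.
Qed.

Lemma word1 x k s : word [:: x] k s = lop x k s.
Proof.
rewrite /= big_ord_recr /= subnn mulr1 big1 ?add0r // => i _.
by rewrite subn_eq0 leqNgt ltn_ord mulr0.
Qed.

Definition lop2 x y n s := \sum_(e < n.+1) lop x e s * lop y (n - e) (s - wt x.1 e).

Definition lcoef x y : F := (~~ x.1)%:R * y.2 - (~~ y.1)%:R * x.2.
Definition lmerge x y : letter := (x.1 || y.1, x.2 + y.2).

Lemma word_cons2 x y l k s :
  word (x :: y :: l) k s =
  \sum_(n < k.+1) lop2 x y n s *
     word l (k - n) (s - (n%:Z - (~~ x.1 + ~~ y.1)%N%:Z)).
Proof.
rewrite -[_ :: _]/([:: x; y] ++ l) word_cat; apply: eq_bigr => n _.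
rewrite !nD_cons /nD big_nil addn0; congr (_ * _).
by apply: eq_bigr => e _; rewrite -[lop y _ _]word1.
Qed.

Lemma exp_conv (a b : F) n :
  \sum_(e < n.+1) (a ^+ e / e`!%:R) * (b ^+ (n - e) / (n - e)`!%:R) =
  (a + b) ^+ n / n`!%:R.
Proof.
rewrite addrC exprDn mulr_suml; apply: eq_bigr => i _.
have le_in : (i <= n)%N by rewrite -ltnS.
have := bin_fact le_in => /(congr1 (fun m => m%:R : F)); rewrite !natrM => <-.
have := @factr_neq0 F i; have := @factr_neq0 F (n - i) => ni0 i0.
have : 'C(n, i)%:R != 0 :> F by rewrite pnatr_eq0 -lt0n bin_gt0.
by move=> C0; rewrite -mulr_natr; field; rewrite i0 ni0 C0.
Qed.

Lemma exp_conv_r (a b : F) n :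
  \sum_(e < n.+2) (a ^+ e / e`!%:R) * (b ^+ (n.+1 - e) / (n.+1 - e)`!%:R) *
     (n.+1 - e)%:R = b * ((a + b) ^+ n / n`!%:R).
Proof.
rewrite big_ord_recr /= subnn mulr0 addr0 -exp_conv mulr_sumr; apply: eq_bigr => e _.
rewrite subSn -1?ltnS // factS natrM exprS.
have := @factr_neq0 F (n - e); have := @factr_neq0 F e.
have : (n - e).+1%:R != 0 :> F by rewrite pnatr_eq0.
by move=> h1 h2 h3; field; rewrite h2 h3 nat1r h1.
Qed.

Lemma exp_conv_l (a b : F) n :
  \sum_(e < n.+2) (a ^+ e / e`!%:R) * (b ^+ (n.+1 - e) / (n.+1 - e)`!%:R) * e%:R =
  a * ((a + b) ^+ n / n`!%:R).
Proof.
rewrite addrC -exp_conv_r (reindex_inj rev_ord_inj); apply: eq_bigr => i _ /=.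
by rewrite subSS subKn -1?ltnS //; ring.
Qed.

(* This is [E(t), E(u)] = (u - t) E(t + u), [E(t), J(u)] = u J(t + u) and
   [J(t), J(u)] = 0 in degree [n]. *)
Lemma lop2_swap x y n s :
  lop2 x y n s - lop2 y x n s =
  if n is n'.+1 then lcoef x y *: lop (lmerge x y) n' s else 0.
Proof.
pose m e := (x.2 ^+ e / e`!%:R) * (y.2 ^+ (n - e) / (n - e)`!%:R).
have -> : lop2 x y n s - lop2 y x n s = \sum_(e < n.+1) (m e *
   ((~~ x.1)%:R * (n - e)%:R - (~~ y.1)%:R * e%:R)) *: P (x.1 || y.1) n.-1 s.
  rewrite {2}/lop2 (reindex_inj rev_ord_inj) -sumrB; apply: eq_bigr => e _ /=.
  have en : (e <= n)%N by rewrite -ltnS.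
  rewrite subSS (subKn en) /lop -!scalerAl -!scalerAr !scalerA.
  rewrite [X in _ - X *: _]mulrC -scalerBr op_rel scalerA; congr (_ *: P _ _ _).
  by rewrite subnKC.
rewrite -scaler_suml; case: n @m => [|n] m.
  by rewrite big_ord1 subn0 !mulr0 subr0 mulr0 scale0r.
rewrite /lop scalerA; congr (_ *: _).
transitivity ((~~ x.1)%:R * (\sum_(e < n.+2) m e * (n.+1 - e)%:R) -
              (~~ y.1)%:R * (\sum_(e < n.+2) m e * e%:R)).
  rewrite !mulr_sumr -sumrB; apply: eq_bigr => e _; ring.
by rewrite exp_conv_l exp_conv_r /lcoef /=; ring.
Qed.

Lemma lcoef_JJ x y : x.1 -> y.1 -> lcoef x y = 0.
Proof. by rewrite /lcoef => -> ->; rewrite !mul0r subrr. Qed.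

Lemma word_swap_head x y l k s :
  word (x :: y :: l) k s - word (y :: x :: l) k s =
  lcoef x y *: word_pred (lmerge x y :: l) k s.
Proof.
rewrite !word_cons2 addnC -sumrB; under eq_bigr => n _ do rewrite -mulrBl lop2_swap.
rewrite big_ord_recl mul0r add0r; case: k => [|k]; first by rewrite big_ord0 scaler0.
rewrite /= scaler_sumr; apply: eq_bigr => e _; rewrite /bump /= ?add1n subSS -scalerAl.
(* Two letters I must be set apart: the merged letter would then have the wrong weight, but its
   coefficient is 0. *)
have [/andP[x1 y1]|] := boolP (x.1 && y.1); first by rewrite lcoef_JJ // !scale0r.
rewrite negb_and => xy; congr (_ *: (_ * word _ _ _)).
by move: xy; rewrite /wt; case: x.1; case: y.1 => //= _; lia.
Qed.

Lemma word_swap l1 x y l2 k s :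
  word (l1 ++ x :: y :: l2) k s - word (l1 ++ y :: x :: l2) k s =
  lcoef x y *: word_pred (l1 ++ lmerge x y :: l2) k s.
Proof.
rewrite !word_cat -sumrB; under eq_bigr => a _ do rewrite -mulrBr word_swap_head.
case: k => [|k]; first by rewrite big_ord1 /= !scaler0 mulr0.
rewrite big_ord_recr /= subnn !scaler0 mulr0 addr0 word_cat scaler_sumr.
by apply: eq_bigr => a _; rewrite -scalerAr subSn // -ltnS.
Qed.

(** In both words the inner factor stands at a position depending on the degree of the outer one.
    Once [word_shift] has brought it to position 0, the ordinary cyclicity of the trace applies, and
    both sides are combinations of the same traces [W a m]. Their coefficients agree by
    [binz_alt_convolution]. *)
Lemma trace_rotation l1 l2 k : tot l1 + tot l2 = 0 ->
  \tr (word (l1 ++ l2) k 0) =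
  \sum_(L < k.+1) binz F ((nD l1 + nD l2)%N%:Z - k%:Z + L%:Z) L * tot l2 ^+ L *
     \tr (word (l2 ++ l1) (k - L) 0).
Proof.
set t := tot l2; move=> /eqP; rewrite addr_eq0 => /eqP t1.
pose W a m := \tr (word l1 a 0 * word l2 m 0).
set n1 := nD l1; set n2 := nD l2.
have f_k q : \tr (word (l1 ++ l2) q 0) =
    \sum_(N < q.+1) t ^+ N * \sum_(a < (q - N).+1) binz F (n1%:Z - a%:Z) N * W a (q - N - a)%N.
  rewrite word_cat raddf_sum /=.
  transitivity (\sum_(a < q.+1) \sum_(N < (q - a).+1)
      binz F (n1%:Z - a%:Z) N * t ^+ N * W a (q - a - N)%N).
    apply: eq_bigr => a _; rewrite word_shift mulr_sumr raddf_sum /=.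
    apply: eq_bigr => N _; rewrite -scalerAr mxtraceZ; congr (binz _ _ _ * _ * _).
    by rewrite /n1; lia.
  rewrite (big_triangle_sym q (fun a N => binz F (n1%:Z - a%:Z) N * t ^+ N * W a (q - a - N)%N)).
  apply: eq_bigr => N _; rewrite mulr_sumr; apply: eq_bigr => a _.
  by rewrite subnAC; ring.
have g_k q : \tr (word (l2 ++ l1) q 0) =
    \sum_(N < q.+1) (- t) ^+ N * \sum_(a < (q - N).+1)
       binz F (n2%:Z - (q - N - a)%N%:Z) N * W a (q - N - a)%N.
  rewrite word_cat raddf_sum /=.
  transitivity (\sum_(m < q.+1) \sum_(N < (q - m).+1)
      binz F (n2%:Z - m%:Z) N * (- t) ^+ N * W (q - m - N)%N m).
    apply: eq_bigr => a _; rewrite word_shift mulr_sumr raddf_sum /=.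
    apply: eq_bigr => N _; rewrite -scalerAr mxtraceZ t1 /W mxtrace_mulC.
    by congr (binz _ _ _ * _ * _); rewrite /n2; lia.
  rewrite (big_triangle_sym q (fun a N => binz F (n2%:Z - a%:Z) N * (- t) ^+ N * W (q - a - N)%N a)).
  apply: eq_bigr => N _; rewrite mulr_sumr (reindex_inj rev_ord_inj).
  apply: eq_bigr => a _ /=; rewrite subSS.
  have -> : (q - (q - N - a) - N = a)%N by have := ltn_ord a; have := ltn_ord N; lia.
  by ring.
under [RHS]eq_bigr => L _ do rewrite g_k mulr_sumr.
rewrite f_k (big_triangle k (fun L N => binz F ((n1 + n2)%N%:Z - k%:Z + L%:Z) L * t ^+ L *
  ((- t) ^+ N * \sum_(a < (k - L - N).+1) binz F (n2%:Z - (k - L - N - a)%N%:Z) N *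
   W a (k - L - N - a)%N))).
apply: eq_bigr => n _.
under [RHS]eq_bigr => L _ do rewrite -subnDA subnKC -1?ltnS // !mulr_sumr.
rewrite exchange_big /= mulr_sumr; apply: eq_bigr => a _.
have := ltn_ord a; have := ltn_ord n => nk an.
(* The position of the inner factor before rotation is written as x - y, with y the position of the
   inner factor after rotation. *)
have {1}-> : n1%:Z - a%:Z =
    n1%:Z + n2%:Z - k%:Z + n%:Z - (n2%:Z - (k - n - a)%N%:Z) by lia.
rewrite -binz_alt_convolution mulr_suml mulr_sumr (reindex_inj rev_ord_inj).
apply: eq_bigr => L _ /=; have Ln : (L <= n)%N by rewrite -ltnS.
rewrite subSS (subKn Ln) (exprNn t).
have -> : n1%:Z + n2%:Z - k%:Z + n%:Z - (n - L)%N%:Z = (n1 + n2)%N%:Z - k%:Z + L%:Z.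
  by lia.
rewrite -{1}(subnKC Ln) exprD.
set sg := (-1) ^+ (n - L); ring.
Qed.

(* By induction on the length, letters commute under the trace in degrees above
   [nD l].  So moving the first letter, of parameter t, to the last place by
   rotation gives the same trace, and [trace_rotation] becomes, by induction on
   [k], (nD l - k + 1) t tr(word l (k - 1)) = 0 up to terms that vanish. *)
Lemma trace_loop l k s : tot l = 0 -> (nD l < k)%N -> \tr (word l k s) = 0.
Proof.
move=> tl; rewrite (word_loop _ _ 0 tl) {s}.
have [N] := ubnP (size l); elim: N => // N IHN in l tl k *; rewrite ltnS => lN.
have move_last : forall x l2 l1 j, tot (l1 ++ x :: l2) = 0 ->
    (size (l1 ++ x :: l2) <= N)%N -> (nD (l1 ++ x :: l2) < j)%N ->
    \tr (word (l1 ++ x :: l2) j 0) = \tr (word (l1 ++ rcons l2 x) j 0).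
  move=> x; elim=> [|y l2 IHl] l1 j // t0 sN dj.
  transitivity (\tr (word (l1 ++ y :: x :: l2) j 0)); last first.
    rewrite -(cat_rcons y l1 (x :: l2)) IHl ?cat_rcons //.
    - by rewrite -[RHS]t0 !tot_cat !tot_cons; ring.
    - by move: sN; rewrite !size_cat.
    - by move: dj; rewrite !nD_cat !nD_cons; lia.
  (* Unless both letters are I, the merged word has one letter less, one D-letter less and degree
     one less, so the outer induction applies. *)
  apply/eqP; rewrite -subr_eq0 -linearB /= word_swap mxtraceZ.
  have [/andP[x1 y1]|] := boolP (x.1 && y.1); first by rewrite lcoef_JJ // mul0r.
  rewrite negb_and => xy; case: j dj => [//|j] dj /=.
  rewrite IHN ?mulr0 //.
  - by rewrite -[RHS]t0 !tot_cat !tot_cons /=; ring.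
  - by move: sN; rewrite !size_cat /=; lia.
  - by move: dj xy; rewrite !nD_cat !nD_cons /=; case: x.1; case: y.1 => //=; lia.
case: l tl lN => [|x l] tl lN.
  by case: k => // k _; rewrite /= mxtrace0.
have [x0|x0] := eqVneq x.2 0.
  move=> dk; rewrite /= big_ord_recl big1 ?addr0 => [|i _]; last first.
    by rewrite /lop x0 expr0n /= mul0r scale0r mul0r.
  rewrite /lop x0 expr0 fact0 divr1 scale1r subn0.
  have tl' : tot l = 0 by rewrite tot_cons x0 add0r in tl.
  rewrite (word_loop _ _ 0 tl'); case: x tl lN x0 dk => [[] u] /= tl lN _ dk.
    rewrite op_I0 -mulmxE mul_scalar_mx mxtraceZ IHN ?mulr0 //.
    by move: dk; rewrite nD_cons.
  by rewrite op_D0 mul1r IHN //; move: dk; rewrite nD_cons /=; lia.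
have [K] := ubnP k; elim: K => // K IHK in k *; rewrite ltnS => kK dk.
have tlx : tot l + tot [:: x] = 0 by rewrite -tot_cat cats1 -{}tl tot_cons /tot -cats1 big_cat big_seq1 addrC.
pose W j := \tr (word (x :: l) j 0).
have rot : W k.+1 = \sum_(L < k.+2)
    binz F ((nD (x :: l))%:Z - k.+1%:Z + L%:Z) L * x.2 ^+ L * W (k.+1 - L)%N.
  have := trace_rotation k.+1 tlx.
  rewrite cats1 -(move_last x l [::]) //; last by rewrite /=; lia.
  by rewrite cat0s /W => ->; rewrite addnC -nD_cat /tot big_seq1.
move: rot; rewrite big_ord_recl big_ord_recl binz0 expr0 !mul1r subn0.
(* In a term with L at least 2, either the degree is still above [nD] and the induction on the
   degree applies, or the upper argument of the binomial coefficient lies between 0 and L - 1. *)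
rewrite big1 => [|i _]; last first.
  rewrite /= /bump /= !add1n; have ik := ltn_ord i.
  have [small|big] := leqP (k.+1 - i.+2) (nD (x :: l)).
    have -> : (nD (x :: l))%:Z - k.+1%:Z + i.+2%:Z =
        ((nD (x :: l)) + i.+2 - k.+1)%N%:Z by lia.
    by rewrite binz_small ?mul0r //; lia.
  by rewrite /W IHK ?mulr0 //; lia.
rewrite addr0 /bump /= ?addn0 ?add1n ?subSS subn0 expr1 binz1 => /esym/eqP.
rewrite addrC -subr_eq0 addrK !mulf_eq0 (negPf x0) orbF intr_eq0 => /orP[|/eqP//].
by move=> /eqP; rewrite /bump; lia.
Qed.

End Words.

(** * Matrices all of whose positive powers have trace 0 *)

Section TraceNilpotent.
Variables (F : numFieldType) (d : nat).
Implicit Types A e : 'M[F]_d.+1.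

(** For a rank factorization e = C R, idempotence gives R C = 1, so the trace of [e] is its rank,
    and the characteristic is 0. *)
Lemma idempotent_trace0 e : e *m e = e -> \tr e = 0 -> e = 0.
Proof.
have key r (C : 'M[F]_(d.+1, r)) (R : 'M[F]_(r, d.+1)) Cl Rr :
    Cl *m C = 1%:M -> R *m Rr = 1%:M -> (C *m R) *m (C *m R) = C *m R ->
    \tr (C *m R) = 0 -> r = 0%N.
  move=> ClC RRr ee; have RC : R *m C = 1%:M.
    have := congr1 (fun M => Cl *m M *m Rr) ee.
    by rewrite /= !mulmxA ClC !mul1mx -!mulmxA RRr mulmx1.
  by rewrite mxtrace_mulC RC mxtrace1 => /eqP; rewrite pnatr_eq0 => /eqP.
move=> ee tre; apply/eqP; rewrite -mxrank_eq0; apply/eqP.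
have [Cl ClC] := row_fullP (col_base_full e).
have [Rr RRr] := row_freeP (row_base_free e).
by apply: key ClC RRr _ _; rewrite mulmx_base.
Qed.

(** A Bezout relation between the power of X - 1 in the characteristic polynomial and the
    complementary factor times X gives a polynomial [q], divisible by X, such that q(A) / b is
    idempotent and fixes [v]. Divisibility by X makes its trace 0, so it is 0. *)
Lemma trace_powers_eigen1 A (v : 'cV[F]_d.+1) :
  (forall j, \tr (A ^+ j.+1) = 0) -> A *m v = v -> v = 0.
Proof.
move=> trA Av; apply/eqP; apply: contraT => v0.
have hv (q : {poly F}) : horner_mx A q *m v = q.[1] *: v.
  elim/poly_ind: q => [|q b IHq].
    by rewrite raddf0 mul0mx horner0 scale0r.
  rewrite rmorphD rmorphM /= horner_mx_X horner_mx_C mulmxDl -mulmxE -mulmxA Av IHq.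
  by rewrite mul_scalar_mx hornerMXaddC mulr1 scalerDl.
have trq (q : {poly F}) : \tr (horner_mx A (q * 'X)) = 0.
  have E : q * 'X = \sum_(i < size q) q`_i *: 'X^(i.+1).
    rewrite -{1}[q]coefK poly_def mulr_suml; apply: eq_bigr => i _.
    by rewrite -scalerAl -exprSr.
  rewrite E !raddf_sum big1 //= => i _.
  by rewrite linearZ /= rmorphXn /= horner_mx_X mxtraceZ trA mulr0.
have [m [g g1 chiE]] := multiplicity_XsubC (char_poly A) 1.
rewrite monic_neq0 ?char_poly_monic //= in g1.
have m_gt0 : (0 < m)%N.
  case: m chiE => // chiE.
  have := hv (char_poly A); rewrite Cayley_Hamilton mul0mx => /esym/eqP.
  rewrite scaler_eq0 (negPf v0) orbF chiE expr0 mulr1 => g0.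
  by rewrite rootE g0 in g1.
have cop : coprimep (('X - 1%:P) ^+ m) (g * 'X).
  rewrite coprimep_expl // coprimep_sym coprimep_XsubC rootM negb_or g1 /=.
  by rewrite rootX oner_eq0.
have [[u w] /= /eqp_size] := Bezout_coprimepP _ _ cop.
rewrite size_poly1 => /eqP/size_poly1P[b b0 uw].
pose q := w * g * 'X; have qE : q = b%:P - u * ('X - 1%:P) ^+ m.
  by rewrite -uw addrC addKr /q mulrA.
have q1 : q.[1] = b.
  by rewrite qE !hornerE subrr expr0n eqn0Ngt m_gt0 mulr0 subr0.
have QQ : horner_mx A q *m horner_mx A q = b *: horner_mx A q.
  rewrite mulmxE -rmorphM /= {2}qE mulrBr.
  have -> : q * (u * ('X - 1%:P) ^+ m) = w * u * 'X * char_poly A.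
    by rewrite chiE /q; ring.
  rewrite rmorphB /= [X in _ - X]rmorphM /= Cayley_Hamilton mulr0 subr0.
  by rewrite mulrC -[b%:P * q]/(_ * _) mul_polyC linearZ.
have Q0 : b^-1 *: horner_mx A q = 0.
  apply: idempotent_trace0.
    by rewrite -scalemxAl -scalemxAr QQ [b^-1 *: (b *: _)]scalerA mulVf // scale1r.
  by rewrite mxtraceZ trq mulr0.
have := hv q; rewrite q1 -[X in X *m v]scale1r -(mulfV b0) -scalerA Q0 scaler0 mul0mx.
by move/esym/eqP; rewrite scaler_eq0 (negPf b0) (negPf v0).
Qed.
End TraceNilpotent.

Lemma poly_fun_eq0 (F : numFieldType) n (f : nat -> F) :
  (forall a, \sum_(j < n) a ^+ j * f j = 0) -> forall j, (j < n)%N -> f j = 0.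
Proof.
move=> f0 j jn; pose q := \poly_(j < n) f j.
suff q0 : q = 0 by have := congr1 (fun p : {poly F} => p`_j) q0; rewrite coef_poly jn coef0.
apply: (@roots_geq_poly_eq0 _ q [seq i%:R | i <- iota 0 n]).
- apply/allP => _ /mapP[i _ ->]; apply/rootP; rewrite horner_poly.
  by rewrite -[RHS](f0 i%:R); apply: eq_bigr => k _; rewrite mulrC.
- by rewrite map_inj_uniq ?iota_uniq //; apply: mulrIn; apply: oner_neq0.
- by rewrite size_map size_iota; apply: size_poly.
Qed.

Ltac mxring := apply/matrixP => ? ?; rewrite ?op_D0 !mxE;
  try (case: eqP => _); rewrite /= ?mulr1n ?mulr0n; first [ring | by field | field].

(** * Products of words of parameter sum 0, and their first parts in coordinates *)

Section Blocks.
Variables (F : numFieldType) (d : nat) (c w : F) (P : opsys d c w).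
Local Notation letter := (bool * F)%type.
Implicit Types (l : seq letter) (bs : seq (nat * seq letter)).
Local Notation word := (word P).

Definition scale_word (a : F) l : seq letter := [seq (x.1, a * x.2) | x <- l].

Lemma tot_scale a l : tot (scale_word a l) = a * tot l.
Proof. by rewrite /tot big_map mulr_sumr. Qed.

Lemma nD_scale a l : nD (scale_word a l) = nD l.
Proof. by rewrite /nD big_map. Qed.

Lemma word_scale a l k s : word (scale_word a l) k s = a ^+ k *: word l k s.
Proof.
elim: l k s => [|x l IH] k s /=.
  by case: k => [|k]; rewrite ?expr0 ?scale1r ?scaler0.
rewrite scaler_sumr; apply: eq_bigr => e _; rewrite IH /lop /= exprMn.
rewrite -!scalerAl -!scalerAr !scalerA; congr (_ *: _).
have le_ek : (e <= k)%N by rewrite -ltnS.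
have -> : a ^+ k = a ^+ e * a ^+ (k - e) by rewrite -exprD subnKC.
ring.
Qed.

Lemma word_cat_loop l1 l2 k : tot l2 = 0 ->
  word (l1 ++ l2) k 0 = \sum_(a < k.+1) word l1 a 0 * word l2 (k - a) 0.
Proof.
move=> l20; rewrite word_cat; apply: eq_bigr => a _; congr (_ * _).
exact: word_loop.
Qed.

Definition bprod bs := \prod_(b <- bs) word b.2 b.1 0.
Definition bdeg bs := \sum_(b <- bs) b.1.
Definition bnD bs := \sum_(b <- bs) nD b.2.

Lemma bprod_rcons bs b : bprod (rcons bs b) = bprod bs * word b.2 b.1 0.
Proof. by rewrite /bprod -cats1 big_cat big_seq1. Qed.
Lemma bdeg_rcons bs b : bdeg (rcons bs b) = (bdeg bs + b.1)%N.
Proof. by rewrite /bdeg -cats1 big_cat big_seq1. Qed.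
Lemma bnD_rcons bs b : bnD (rcons bs b) = (bnD bs + nD b.2)%N.
Proof. by rewrite /bnD -cats1 big_cat big_seq1. Qed.

(* Multiplying the parameters of a block by [a] multiplies its degree [j] part by
   a^j, so a trace formula for all [a] can be read off degree by degree. *)
Lemma trace_blocks bs l k : all (fun b => tot b.2 == 0) bs -> tot l = 0 ->
  (bnD bs + nD l < bdeg bs + k)%N -> \tr (bprod bs * word l k 0) = 0.
Proof.
elim/last_ind: bs l k => [|bs b IH] l k.
  by rewrite /bnD /bdeg /bprod !big_nil mul1r => _; apply: trace_loop.
rewrite all_rcons bnD_rcons bdeg_rcons bprod_rcons => /andP[/eqP b0 bs0] l0 lt.
pose f j := \tr (bprod bs * (word b.2 j 0 * word l (b.1 + k - j) 0)).
have := @poly_fun_eq0 F (b.1 + k).+1 f.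
move=> /(_ _ b.1); rewrite /f addKn mulrA; apply; last by rewrite ltnS leq_addr.
move=> a; transitivity (\tr (bprod bs * word (scale_word a b.2 ++ l) (b.1 + k) 0)).
  rewrite word_cat_loop // mulr_sumr raddf_sum; apply: eq_bigr => j _.
  by rewrite word_scale -scalerAl -scalerAr /= mxtraceZ.
apply: IH => //; first by rewrite tot_cat tot_scale b0 l0 mulr0 addr0.
by rewrite nD_cat nD_scale !addnA.
Qed.

(* The algebra generated by the parts, of degree at least the number of
   D-letters, of words of parameter sum 0. *)
Inductive good : 'M[F]_d.+1 -> Prop :=
| good1 : good 1
| goodP a A B : good A -> good B -> good (a *: A + B)
| good_cons l k A : tot l = 0 -> (nD l <= k)%N -> good A -> good (word l k 0 * A).

Lemma good_mul A B : good A -> good B -> good (A * B).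
Proof.
move=> gA gB; elim: gA => [|a A1 A2 _ g1 _ g2|l k A1 l0 lk _ g1].
- by rewrite mul1r.
- by rewrite mulrDl -scalerAl; apply: goodP.
- by rewrite -mulrA; apply: good_cons.
Qed.

Lemma good_word l k : tot l = 0 -> (nD l <= k)%N -> good (word l k 0).
Proof. by move=> l0 lk; rewrite -[word _ _ _]mulr1; apply: good_cons => //; apply: good1. Qed.

(** The blocks [bs] accumulate the factors of [A]: each has degree at least its number of D-letters,
    so the strict inequality persists. *)
Lemma trace_good A : good A -> forall bs, all (fun b => tot b.2 == 0) bs ->
  (bnD bs < bdeg bs)%N -> \tr (bprod bs * A) = 0.
Proof.
elim=> [|a A1 A2 _ t1 _ t2|l k A1 l0 lk _ t1] bs bs0 lt.
- have := @trace_blocks bs [::] 0 bs0; rewrite /= mulr1n; apply.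
    by rewrite /tot big_nil.
  by rewrite /nD big_nil !addn0.
- by rewrite mulrDr -scalerAr mxtraceD mxtraceZ t1 // t2 // mulr0 addr0.
- have := t1 (rcons bs (k, l)).
  rewrite bprod_rcons bnD_rcons bdeg_rcons mulrA; apply.
    by rewrite all_rcons l0 eqxx.
  by rewrite /=; lia.
Qed.

(** The three operators are D_1 d, D_2 d^2 and I_1 d on the weight space of position 0. They suffice
    because D_1, D_2 and I_1 generate all the D_i and I_j of higher index, those of lower index
    being scalar here. *)
Definition irr_ops := forall U : 'cV[F]_d.+1 -> Prop,
  (forall a u v, U u -> U v -> U (a *: u + v)) ->
  (exists2 u, u <> 0 & U u) ->
  (forall u, U u -> U (P false 2 0 *m u)) ->
  (forall u, U u -> U (P false 3 0 *m u)) ->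
  (forall u, U u -> U (P true 1 0 *m u)) -> forall u, U u.

(** The recurrence [op_shift] is solved from position 0; so are the next ones. The scalars come from
    the known D_{-1}, D_0 and I_0. *)
Lemma op_D2 s : P false 2 s = P false 2 0 + (s%:~R * (s%:~R - 1) + 2 * w * s%:~R)%:M.
Proof.
move: s; apply: (@int_shift_ind _ 0) => [|s].
  by mxring.
rewrite op_shift /= op_D1 intrD; split=> [->|/(canRL (addrK _)) ->]; mxring.
Qed.

Lemma op_D3 s : P false 3 s = P false 3 0 + (3 * s%:~R) *: P false 2 0 +
  (s%:~R * (s%:~R - 1) * (s%:~R - 2) + 3 * w * s%:~R * (s%:~R - 1))%:M.
Proof.
move: s; apply: (@int_shift_ind _ 0) => [|s]; first by mxring.
rewrite op_shift /= (op_D2 s) intrD; split=> [->|/(canRL (addrK _)) ->]; mxring.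
Qed.

Lemma op_D4 s : P false 4 s = P false 4 0 + (4 * s%:~R) *: P false 3 0 +
  (6 * s%:~R * (s%:~R - 1)) *: P false 2 0 +
  (s%:~R * (s%:~R - 1) * (s%:~R - 2) * (s%:~R - 3) +
   4 * w * s%:~R * (s%:~R - 1) * (s%:~R - 2))%:M.
Proof.
move: s; apply: (@int_shift_ind _ 0) => [|s]; first by mxring.
rewrite op_shift /= (op_D3 s) intrD; split=> [->|/(canRL (addrK _)) ->]; mxring.
Qed.

Lemma op_I1 s : P true 1 s = P true 1 0 + (c * s%:~R)%:M.
Proof.
move: s; apply: (@int_shift_ind _ 0) => [|s]; first by mxring.
rewrite op_shift /= op_I0 intrD; split=> [->|/(canRL (addrK _)) ->]; mxring.
Qed.

Lemma op_I2 s : P true 2 s =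
  P true 2 0 + (2 * s%:~R) *: P true 1 0 + (c * s%:~R * (s%:~R - 1))%:M.
Proof.
move: s; apply: (@int_shift_ind _ 0) => [|s]; first by mxring.
rewrite op_shift /= (op_I1 s) intrD; split=> [->|/(canRL (addrK _)) ->]; mxring.
Qed.

Lemma word2 x y k s : word [:: x; y] k s =
  \sum_(e < k.+1) lop P x e s * lop P y (k - e) (s - wt x.1 e).
Proof. by apply: eq_bigr => e _; rewrite -[lop P y _ _]word1. Qed.

(** The shortest words of parameter sum 0 whose weight 0 parts involve D_1 d, I_1 d and D_2 d^2
    respectively. *)
Definition DD : seq letter := [:: (false, 1); (false, -1)].
Definition ID : seq letter := [:: (true, 1); (false, -1)].
Definition DDD : seq letter := [:: (false, 1); (false, 1); (false, -2)].

Lemma tot_DD : tot DD = 0.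
Proof. by rewrite /tot !big_cons big_nil /=; ring. Qed.
Lemma tot_ID : tot ID = 0.
Proof. by rewrite /tot !big_cons big_nil /=; ring. Qed.
Lemma tot_DDD : tot DDD = 0.
Proof. by rewrite /tot !big_cons big_nil /=; ring. Qed.
Lemma nD_DD : nD DD = 2%N. Proof. by rewrite /nD !big_cons big_nil. Qed.
Lemma nD_ID : nD ID = 1%N. Proof. by rewrite /nD !big_cons big_nil. Qed.
Lemma nD_DDD : nD DDD = 3%N. Proof. by rewrite /nD !big_cons big_nil. Qed.

Lemma scalar_mulE (a : F) (A : 'M[F]_d.+1) : a%:M * A = a *: A.
Proof. exact: mul_scalar_mx. Qed.
Lemma mul_scalarE (a : F) (A : 'M[F]_d.+1) : A * a%:M = a *: A.
Proof. exact: mul_mx_scalar. Qed.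

Lemma mulmDr (A B C : 'M[F]_d.+1) : A * (B + C) = A * B + A * C.
Proof. exact: mulrDr. Qed.

Lemma word_pair kap k : word [:: (kap, 1); (false, -1)] k 0 =
  \sum_(e < k.+1) ((-1) ^+ (k - e)%N / (e`! * (k - e)`!)%:R) *:
     (P kap e 0 * P false (k - e)%N (- wt kap e)).
Proof.
rewrite word2; apply: eq_bigr => e _; rewrite /lop /= expr1n sub0r -scalerAl -scalerAr.
rewrite scalerA natrM; congr (_ *: _).
by have := @factr_neq0 F e; have := @factr_neq0 F (k - e) => h1 h2; field; rewrite h1 h2.
Qed.

(** This is the Casimir element D_1 D_{-1} - D_0 (D_0 - 1) of the subalgebra sl_2. *)
Lemma word_DD2 : word DD 2 0 = P false 2 0 + (w - w ^+ 2)%:M.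
Proof.
rewrite /DD word_pair !big_ord_recl big_ord0 /= /bump /wt /= !addn0 !add1n !subSS !subn0.
rewrite !fact0 !factS !fact0 !op_D0 !op_D1 mul1r mulr1 mul_scalarE.
rewrite (op_D2 (- (0 - 1))); mxring.
Qed.

Let A1 := P false 2 0.
Let A2 := P false 3 0.
Let R1 := P true 1 0.

Lemma word_DD4 : word DD 4 0 = 12^-1 *: (P false 4 0 + 3 *: (A1 * A1)
   + (6 - 6 * w) *: A1 + (6 - 4 * w) *: A2).
Proof.
rewrite /DD word_pair !big_ord_recl big_ord0 /= /bump /wt /= !addn0 !add1n !subSS !subn0.
rewrite !fact0 !factS !fact0 !op_D0 !op_D1 mul1r mulr1 scalar_mulE mul_scalarE.
rewrite (op_D2 (- (2%:Z - 1))) (op_D4 (- (0 - 1))) subrr oppr0 mulmDr mul_scalarE -/A1 -/A2.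
set AA := A1 * A1; mxring.
Qed.

(** This is I_1 D_{-1} - c D_0, which will turn out to be the scalar - c lam. *)
Lemma word_ID1 : word ID 1 0 = R1 - (c * w)%:M.
Proof.
rewrite /ID word_pair !big_ord_recl big_ord0 /= /bump /wt /= !addn0 !subSS !subn0.
rewrite !fact0 !factS !fact0 !op_D0 !op_D1 !op_I0 scalar_mulE mulr1 -/R1; mxring.
Qed.

Lemma word_ID2 : word ID 2 0 =
  2^-1 *: (P true 2 0 + c *: A1 + (2 - 2 * w) *: R1).
Proof.
rewrite /ID word_pair !big_ord_recl big_ord0 /= /bump /wt /= !addn0 !add1n !subSS !subn0.
rewrite !fact0 !factS !fact0 !op_D0 !op_D1 !op_I0 scalar_mulE mulr1 mul_scalarE oppr0.
rewrite -/R1 -/A1; mxring.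
Qed.

Lemma word_ID3 : word ID 3 0 =
  6^-1 *: (P true 3 0 + (6 - 3 * w) *: P true 2 0 + 3 *: (R1 * A1) + (6 - 6 * w) *: R1 - c *: A2).
Proof.
rewrite /ID word_pair !big_ord_recl big_ord0 /= /bump /wt /= !addn0 !add1n !subSS !subn0.
rewrite !fact0 !factS !fact0 !op_D0 !op_D1 !op_I0 scalar_mulE mulr1 mul_scalarE oppr0.
rewrite (op_D2 (- (1%:Z - 0))) mulmDr mul_scalarE -/R1 -/A1 -/A2.
set RA := R1 * A1; mxring.
Qed.

(** The brackets [D_1, D_2] = D_3, [D_1, I_1] = I_2 and [D_2, I_1] = I_3 eliminate the higher
    operators from the parts above. The terms of lower order arise from returning the right factors
    to position 0. *)
Lemma rel_D4 : P false 4 0 = A1 * A2 - A2 * A1 - 3 *: (A1 * A1)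
   + (6 * w - 6) *: A1 + (4 * w - 6) *: A2.
Proof.
have -> : P false 4 0 = P false 2 0 * P false 3 (0 - wt false 2) -
    P false 3 0 * P false 2 (0 - wt false 3).
  by rewrite op_rel /= -[LHS]scale1r; congr (_ *: _); ring.
rewrite /wt /= (op_D3 (0 - (2%:Z - 1))) (op_D2 (0 - (3%:Z - 1))).
rewrite !mulmDr !mul_scalarE -scalerAr -/A1 -/A2.
set AA := A1 * A1; set AB := A1 * A2; set BA := A2 * A1; mxring.
Qed.

Lemma rel_I2 : P true 2 0 = A1 * R1 - R1 * A1 - c *: A1 + (2 * w - 2) *: R1.
Proof.
have -> : P true 2 0 = P false 2 0 * P true 1 (0 - wt false 2) -
    P true 1 0 * P false 2 (0 - wt true 1).
  by rewrite op_rel /= -[LHS]scale1r; congr (_ *: _); ring.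
rewrite /wt /= (op_I1 (0 - (2%:Z - 1))) (op_D2 (0 - (1%:Z - 0))).
rewrite !mulmDr !mul_scalarE -/A1 -/A2 -/R1.
set AA := A1 * R1; set BA := R1 * A1; mxring.
Qed.

Lemma rel_I3 : P true 3 0 = A2 * R1 - R1 * A2 + 3 *: (R1 * A1) - (2 * c) *: A2
  + (6 - 6 * w) *: R1.
Proof.
have -> : P true 3 0 = P false 3 0 * P true 1 (0 - wt false 3) -
    P true 1 0 * P false 3 (0 - wt true 1).
  by rewrite op_rel /= -[LHS]scale1r; congr (_ *: _); ring.
rewrite /wt /= (op_I1 (0 - (3%:Z - 1))) (op_D3 (0 - (1%:Z - 0))).
rewrite !mulmDr !mul_scalarE -scalerAr -/A1 -/A2 -/R1.
set AA := A2 * R1; set BA := R1 * A2; set RA := R1 * A1; mxring.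
Qed.

Lemma rel_I1I2 : R1 * P true 2 0 - P true 2 0 * R1 - 2 *: (R1 * R1) + (2 * c) *: P true 2 0 + (2 * c) *: R1 = 0.
Proof.
have rel := op_rel P true 1 true 2 0.
rewrite /= !mul0r subrr scale0r in rel; rewrite -[RHS]rel.
rewrite /wt /= (op_I2 (0 - (1%:Z - 0))) (op_I1 (0 - (2%:Z - 0))).
rewrite !mulmDr !mul_scalarE -scalerAr -/A1 -/A2 -/R1.
set AA := R1 * P true 2 0; set BA := P true 2 0 * R1; set RA := R1 * R1; mxring.
Qed.

Lemma word_DDD3 : word DDD 3 0 =
  - A2 + (3 * w - 6) *: A1 + (6 * w ^+ 2 - 4 * w - 2 * w ^+ 3)%:M.
Proof.
pose x : bool * F := (false, 1); pose z : bool * F := (false, -2).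
have -> : word DDD 3 0 =
    \sum_(e < 4) lop P x e 0 * word [:: x; z] (3 - e) (0 - wt false e) by [].
have := word2 x z; set W := word [:: x; z] => WE.
rewrite !big_ord_recl big_ord0 /= /bump /= !addn0 !add1n !subSS !subn0 !WE.
rewrite !big_ord_recl !big_ord0 /= /lop /= /bump /= !addn0 !add1n !subSS !subn0.
rewrite !fact0 !factS !fact0 !expr1n ?expr0 /wt.
have -> : 0 - (0%:Z - 1) = 1 by [].
have -> : 0 - (1%:Z - 1) = 0 by [].
have -> : 0 - (2%:Z - 1) = -1 by [].
have -> : 0 - (3%:Z - 1) = -2 by [].
rewrite -[nat_of_bool (~~ false)]/1%N.
rewrite (op_D3 1) (op_D3 (1 - -1)) !(op_D2 1) !op_D0 !op_D1.
have mE (a b : F) (A B : 'M[F]_d.+1) : (a *: A) * (b *: B) = (a * b) *: (A * B).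
  by rewrite -scalerAl -scalerAr scalerA.
rewrite !(mE, addr0, mul1r, mulr1, scalar_mulE, mul_scalarE) -/A1 -/A2.
rewrite -!scalerAl !(mul1r, scalar_mulE, mul_scalarE).
rewrite mulmDr -!scalerAr !mul_scalarE; mxring.
Qed.

End Blocks.
Arguments DD {F}.
Arguments ID {F}.
Arguments DDD {F}.
Arguments tot_DD {F}.
Arguments tot_ID {F}.
Arguments tot_DDD {F}.
Arguments nD_DD {F}.
Arguments nD_ID {F}.
Arguments nD_DDD {F}.

(** * Irreducible systems of operators are scalar *)

Section Irreducible.
Variables (F : numClosedFieldType) (d : nat) (c w : F) (P : opsys d c w).
Hypothesis irrP : irr_ops P.
Local Notation word := (word P).
Let A1 := P false 2 0.
Let A2 := P false 3 0.
Let R1 := P true 1 0.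

Lemma good_scalar (a : F) : good P a%:M.
Proof.
have g0 : good P 0.
  by have := goodP (-1) (good1 P) (good1 P); rewrite scaleN1r addNr.
by have := goodP a (good1 P) g0; rewrite addr0 -scalemx1.
Qed.

Lemma goodD A B : good P A -> good P B -> good P (A + B).
Proof. by move=> gA gB; have := goodP 1 gA gB; rewrite scale1r. Qed.

Lemma good_A1 : good P A1.
Proof.
have -> : A1 = word DD 2 0 + (- (w - w ^+ 2))%:M.
  by rewrite word_DD2 raddfN /= addrK.
by apply: goodD (good_scalar _); apply: good_word; rewrite ?tot_DD ?nD_DD.
Qed.

Lemma good_R1 : good P R1.
Proof.
have -> : R1 = word ID 1 0 + (c * w)%:M by rewrite word_ID1 subrK.
by apply: goodD (good_scalar _); apply: good_word; rewrite ?tot_ID ?nD_ID.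
Qed.

Lemma good_A2 : good P A2.
Proof.
have -> : A2 = (-1) *: word DDD 3 0 + ((3 * w - 6) *: A1 +
    (6 * w ^+ 2 - 4 * w - 2 * w ^+ 3)%:M).
  by rewrite word_DDD3 -/A1 -/A2; mxring.
apply: goodP; first by apply: good_word; rewrite ?tot_DDD ?nD_DDD.
exact: goodP good_A1 (good_scalar _).
Qed.

(* If such a [Z] has Z v != 0, irreducibility gives A in the algebra [good] with
   v = A Z v; then Z A has the eigenvalue 1, while its powers have trace 0. *)
Lemma supercritical_word0 l k : tot l = 0 -> (nD l < k)%N -> word l k 0 = 0.
Proof.
move=> l0 lk; set Z := word l k 0; apply/eqP; apply: contraT => Z0.
have [v Zv] : exists v : 'cV_d.+1, Z *m v != 0.
  apply/not_existsP => H; move/eqP: Z0; apply; apply/matrixP => i j.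
  have /negP := H (delta_mx j 0); rewrite negbK => /eqP/colP/(_ i).
  by rewrite -colE !mxE.
have [A gA Av] : exists2 A, good P A & v = A *m (Z *m v).
  apply: (irrP (U := fun u => exists2 A, good P A & u = A *m (Z *m v))).
  - move=> a _ _ [A gA ->] [B gB ->]; exists (a *: A + B); first exact: goodP.
    by rewrite mulmxDl scalemxAl.
  - exists (Z *m v); first exact/eqP.
    by exists 1; [exact: good1|rewrite mul1mx].
  - move=> _ [A gA ->]; exists (A1 * A); first exact: good_mul good_A1 gA.
    by rewrite -mulmxE mulmxA.
  - move=> _ [A gA ->]; exists (A2 * A); first exact: good_mul good_A2 gA.
    by rewrite -mulmxE mulmxA.
  - move=> _ [A gA ->]; exists (R1 * A); first exact: good_mul good_R1 gA.
    by rewrite -mulmxE mulmxA.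
suff Zv0 : Z *m v = 0 by rewrite Zv0 eqxx in Zv.
apply: (@trace_powers_eigen1 _ _ (Z * A)); last by rewrite -mulmxE -mulmxA -Av.
move=> j; have gZ : good P Z by apply: good_word => //; apply: ltnW.
have gj : good P (A * (Z * A) ^+ j).
  elim: j => [|j IH]; first by rewrite expr0 mulr1.
  by rewrite exprSr mulrA; apply: good_mul => //; apply: good_mul.
rewrite exprS -mulrA; have := trace_good gj (bs := [:: (k, l)]).
rewrite /bprod /bdeg /bnD !big_seq1 /=; apply => //.
by rewrite l0 eqxx.
Qed.

(** Degree 4 is the first to say anything: the degree 3 part of E(t) E(-t) is 0 in any case, since t
    -> -t changes its sign while exchanging the two letters leaves it unchanged. *)
Lemma commA1A2 : A1 * A2 = A2 * A1.
Proof.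
have := supercritical_word0 (l := DD) (k := 4) tot_DD; rewrite nD_DD => /(_ isT).
rewrite word_DD4 rel_D4 => H; apply/eqP; rewrite -subr_eq0; apply/eqP.
rewrite -[RHS](scaler0 _ 12) -{}H -/A1 -/A2.
set AA := A1 * A1; set AB := A1 * A2; set BA := A2 * A1; mxring.
Qed.

Lemma commA1R1 : A1 * R1 = R1 * A1.
Proof.
have := supercritical_word0 (l := ID) (k := 2) tot_ID; rewrite nD_ID => /(_ isT).
rewrite word_ID2 rel_I2 => H; apply/eqP; rewrite -subr_eq0; apply/eqP.
rewrite -[RHS](scaler0 _ 2) -{}H -/A1 -/A2 -/R1.
set AA := A1 * R1; set AB := R1 * A1; mxring.
Qed.

(** This is [I_1, I_2] = 0, with I_2 expressed through D_1 and I_1. For c != 0 it determines [A1]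
    from [R1]. *)
Lemma quadR1 : R1 * R1 = (c * (2 * w - 1)) *: R1 - c ^+ 2 *: A1.
Proof.
have := rel_I1I2 P; rewrite rel_I2 -/A1 -/R1 commA1R1 subrr sub0r.
rewrite mulmDr (mulrDl _ _ R1) (mulrN R1) (mulNr _ R1) -!scalerAl -!scalerAr commA1R1.
set RA := R1 * A1; set RR := R1 * R1 => H.
apply/eqP; rewrite -subr_eq0; apply/eqP.
rewrite -[RHS](scaler0 _ (- 2^-1)) -{}H; mxring.
Qed.

(** The vanishing part gives the commutator but not yet its vanishing; the cases c = 0 and c != 0
    need different arguments from here. *)
Lemma commR1A2 : R1 * A2 - A2 * R1 = 6 *: (R1 * A1) - (3 * c) *: A2 + (6 * w * (1 - w)) *: R1
   - (3 * c * (2 - w)) *: A1.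
Proof.
have := supercritical_word0 (l := ID) (k := 3) tot_ID; rewrite nD_ID => /(_ isT).
rewrite word_ID3 rel_I3 rel_I2 -/A1 -/R1 -/A2 commA1R1 subrr sub0r => H.
apply/eqP; rewrite -subr_eq0; apply/eqP.
rewrite -[RHS](scaler0 _ (- 6)) -{}H.
set RA := R1 * A1; set RB := R1 * A2; set BR := A2 * R1; mxring.
Qed.

Lemma scalar_of_commuting (A : 'M[F]_d.+1) :
  A * A1 = A1 * A -> A * A2 = A2 * A -> A * R1 = R1 * A ->
  exists a : F, A = a%:M.
Proof.
move=> h1 h2 h3; have [a] := eigenvalue_closed A^T (ltn0Sn d).
move=> /eigenvalueP[v vA v0]; exists a.
have stab (B : 'M[F]_d.+1) u : A * B = B * A -> A *m u = a *: u ->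
    A *m (B *m u) = a *: (B *m u).
  by move=> AB Au; rewrite mulmxA mulmxE AB -mulmxE -mulmxA Au scalemxAr.
have all : forall u : 'cV_d.+1, A *m u = a *: u.
  apply: irrP.
  - by move=> b u u' Au Au'; rewrite mulmxDr -scalemxAr Au Au' scalerDr !scalerA mulrC.
  - exists v^T; first by apply/eqP; rewrite -trmx0 (inj_eq trmx_inj).
    by apply: trmx_inj; rewrite trmx_mul trmxK vA linearZ /= trmxK.
  - by move=> u; apply: stab.
  - by move=> u; apply: stab.
  - by move=> u; apply: stab.
apply/matrixP => i j; have /colP/(_ i) := all (delta_mx j 0).
by rewrite -colE !mxE eqxx andbT => ->; rewrite mulr_natr.
Qed.

Lemma scalarA1 : exists a : F, A1 = a%:M.
Proof. by apply: scalar_of_commuting; rewrite ?commA1A2 ?commA1R1. Qed.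

(** Here [R1] has square 0, and its commutator with [A2] is a multiple of [R1], so its kernel is a
    nonzero stable subspace. *)
Lemma R1_eq0 : c = 0 -> R1 = 0.
Proof.
move=> c0; have [a aE] := scalarA1.
have RR : R1 * R1 = 0 by rewrite quadR1 c0 expr0n mul0r !scale0r subrr.
have c3 : 3 * c = 0 by rewrite c0 mulr0.
have RA : R1 * A2 = A2 * R1 + (6 * a + 6 * w * (1 - w)) *: R1.
  apply/eqP; rewrite -subr_eq0 opprD addrA commR1A2 aE mul_scalarE c3 mul0r !scale0r; apply/eqP; mxring.
have all : forall u : 'cV_d.+1, R1 *m u = 0.
  apply: irrP.
  - by move=> b u u' Ru Ru'; rewrite mulmxDr -scalemxAr Ru Ru' scaler0 addr0.
  - have [->|R0] := eqVneq R1 0.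
      exists (delta_mx 0 0); last by rewrite mul0mx.
      by move/matrixP/(_ 0 0); rewrite !mxE /= => /eqP; rewrite oner_eq0.
    have [v Rv] : exists v : 'cV_d.+1, R1 *m v <> 0.
      apply/not_existsP => H; move/eqP: R0; apply; apply/matrixP => i j.
      have := H (delta_mx j 0); rewrite -colE => /contrapT/colP/(_ i).
      by rewrite !mxE.
    by exists (R1 *m v); rewrite // mulmxA mulmxE RR mul0mx.
  - by move=> u Ru; rewrite -/A1 aE mul_scalar_mx -scalemxAr Ru scaler0.
  - by move=> u Ru; rewrite -/A2 mulmxA mulmxE RA mulmxDl -mulmxE -mulmxA -scalemxAl Ru mulmx0 scaler0 addr0.
  - by move=> u Ru; rewrite Ru mulmx0.
apply/matrixP => i j; have /colP/(_ i) := all (delta_mx j 0).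
by rewrite -colE !mxE.
Qed.

(* The difference B of the two sides satisfies [R1, B] = -3 c B, hence is
   singular, and its kernel is stable. *)
Lemma A2_of_R1 a : c != 0 -> A1 = a%:M ->
  A2 = (2 * (a + w - w ^+ 2) / c) *: R1 - ((2 - w) * a)%:M.
Proof.
move=> c0 aE; set k := 2 * _ / c.
pose B := A2 - k *: R1 + ((2 - w) * a)%:M.
suff B0 : B = 0.
  by apply/eqP; rewrite -subr_eq0; apply/eqP; rewrite -[RHS]B0 /B; mxring.
have RB : R1 * B = B * R1 - (3 * c) *: B.
  have := commR1A2; rewrite aE mul_scalarE => H.
  rewrite /B !mulmDr (mulrDl _ _ R1) (mulrDl _ _ R1) mulrN mulNr -scalerAl -scalerAr.
  rewrite mul_scalarE scalar_mulE.
  apply/eqP; rewrite -subr_eq0; apply/eqP; rewrite -[RHS](subrr (R1 * A2 - A2 * R1)) {2}H.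
  apply/matrixP => i j; rewrite !mxE.
  by case: eqP => _; rewrite ?mulr1n ?mulr0n /k; field.
have AB : A2 = B + k *: R1 - ((2 - w) * a)%:M by rewrite /B; mxring.
clearbody B.
have all : forall u : 'cV_d.+1, B *m u = 0.
  apply: irrP.
  - by move=> b u u' Bu Bu'; rewrite mulmxDr -scalemxAr Bu Bu' scaler0 addr0.
  - have /det0P[v v0 vB] : \det B^T == 0.
      rewrite -[_ == 0]negbK -unitfE -unitmxE unitmx_tr; apply/negP => uB.
      have : \tr (invmx B * (R1 * B)) = \tr R1.
        by rewrite -!mulmxE mxtrace_mulC mulmxK.
      rewrite RB mulmDr mulrN mulrA -!mulmxE mulVmx // mul1mx -scalemxAr mulVmx //.
      rewrite raddfB /= mxtraceZ mxtrace1 => /eqP.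
      rewrite -subr_eq0 addrAC subrr add0r oppr_eq0 !mulf_eq0 (negPf c0) !pnatr_eq0.
      by [].
    exists v^T; first by apply/eqP; rewrite -trmx0 (inj_eq trmx_inj).
    by apply: trmx_inj; rewrite trmx_mul trmxK vB trmx0.
  - by move=> u Bu; rewrite -/A1 aE mul_scalar_mx -scalemxAr Bu scaler0.
  - move=> u Bu; rewrite -/A2 AB mulmxBl mulmxDl Bu add0r mul_scalar_mx -scalemxAl.
    rewrite mulmxBr -!scalemxAr Bu scaler0 subr0 mulmxA mulmxE.
    have -> : B * R1 = R1 * B + (3 * c) *: B by rewrite RB subrK.
    by rewrite mulmxDl -mulmxE -mulmxA Bu mulmx0 -scalemxAl Bu scaler0 addr0 scaler0.
  - move=> u Bu; rewrite mulmxA mulmxE.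
    have -> : B * R1 = R1 * B + (3 * c) *: B by rewrite RB subrK.
    by rewrite mulmxDl -mulmxE -mulmxA Bu mulmx0 -scalemxAl Bu scaler0 addr0.
apply/matrixP => i j; have /colP/(_ i) := all (delta_mx j 0).
by rewrite -colE !mxE.
Qed.

Lemma ops_scalar : exists a b r : F, [/\ A1 = a%:M, A2 = b%:M & R1 = r%:M].
Proof.
have [a aE] := scalarA1; have [c0|c0] := eqVneq c 0.
  have R0 := R1_eq0 c0.
  have [b bE] : exists b : F, A2 = b%:M.
    by apply: scalar_of_commuting; rewrite ?commA1A2 // R0 mulr0 mul0r.
  by exists a, b, 0; split=> //; rewrite R0 raddf0.
have A2E := A2_of_R1 c0 aE.
have [r rE] : exists r : F, R1 = r%:M.
  apply: scalar_of_commuting; rewrite ?commA1R1 // A2E.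
  by rewrite mulmDr (mulrDl _ _ R1) mulrN mulNr -scalerAl -scalerAr scalar_mulE mul_scalarE.
exists a, ((2 * (a + w - w ^+ 2) / c) * r - (2 - w) * a), r; split=> //.
by rewrite A2E rE; mxring.
Qed.

(* Compares the two brackets [D_2, D_3] and [D_1, D_4] giving D_5. *)
Lemma ops_sextic a b : A1 = a%:M -> A2 = b%:M ->
  let a' := a - w * (w - 1) in let b' := b - 3 * w * a' - w * (w - 1) * (w - 2) in
  -8 * (b' ^+ 2 + 6 * a' * b' + 8 * a' ^+ 2 + 4 * a' ^+ 3) = 0.
Proof.
move=> aE bE /=; have two0 : 2 != 0 :> F by rewrite pnatr_eq0.
pose p2 (s : F) := a + s * (s - 1) + 2 * w * s.
pose p3 (s : F) := b + 3 * s * a + s * (s - 1) * (s - 2) + 3 * w * s * (s - 1).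
pose p40 := - 3 * a ^+ 2 + (6 * w - 6) * a + (4 * w - 6) * b.
pose p4 (s : F) := p40 + 4 * s * b + 6 * s * (s - 1) * a +
   (s * (s - 1) * (s - 2) * (s - 3) + 4 * w * s * (s - 1) * (s - 2)).
pose p50 := (a * p4 (-1) - p40 * p2 (-3)) / 2.
have P2 s : P false 2 s = (p2 s%:~R)%:M.
  by rewrite op_D2 -/A1 aE /p2; mxring.
have P3 s : P false 3 s = (p3 s%:~R)%:M.
  by rewrite op_D3 -/A1 -/A2 aE bE /p3; mxring.
have P40 : P false 4 0 = p40%:M.
  rewrite rel_D4 -/A1 -/A2 aE bE !scalar_mulE /p40; mxring.
have P4 s : P false 4 s = (p4 s%:~R)%:M.
  by rewrite op_D4 -/A1 -/A2 aE bE P40 /p4; mxring.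
have P50 : P false 5 0 = p50%:M.
  have := op_rel P false 2 false 4 0; rewrite !P4 !P2 !scalar_mulE => /(congr1 ( *:%R 2^-1)).
  rewrite scalerA (_ : 2^-1 * _ = 1) ?scale1r => [<-|]; last by rewrite /=; field.
  by rewrite /wt /= /p50 /p4 /p2; mxring.
have P51 : P false 5 (-1) = (p50 - 5 * p4 (-1))%:M.
  by have := op_shift P false 5 (-1); rewrite P50 P4 => /(canLR (addrK _)) <-; mxring.
have w2 : 0 - wt false 2 = -1 by []. have w3 : 0 - wt false 3 = -2 by [].
have w4 : 0 - wt false 4 = -3 by []. have w5 : 0 - wt false 5 = -4 by [].
have := op_rel P false 3 false 4 0; rewrite w3 w4 !P3 !P4 !scalar_mulE.
rewrite (_ : _ *: P (false || false) _ _ = P false 6 0); last first.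
  by rewrite /= -[RHS]scale1r; congr (_ *: _); ring.
move=> r34; have := op_rel P false 2 false 5 0.
rewrite w2 w5 P51 P50 !P2 !scalar_mulE -r34 => /matrixP/(_ 0 0).
rewrite !mxE /= !mulr1n => /eqP; rewrite -subr_eq0 => /eqP H.
rewrite -[RHS](mulr0 (- 3^-1)) -H /p50 /p4 /p40 /p3 /p2; by field.
Qed.

Lemma ops_parameters : exists lam : F,
  [/\ c = 0 -> lam != 1, A1 = ((w - lam) * (w - 1 + lam))%:M,
      A2 = ((w - lam) * (w - lam - 1) * (w - 2 + 2 * lam))%:M &
      R1 = (c * (w - lam))%:M].
Proof.
have [a [b [r [aE bE rE]]]] := ops_scalar; have [c0|c0] := eqVneq c 0; last first.
  (* For c != 0 the parameter is read off from I_1 d = c (D_0 - lam). *)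
  exists (w - r / c); split.
  - by move=> c0'; rewrite c0' eqxx in c0.
  - rewrite aE; congr _%:M; have := quadR1; rewrite rE aE scalar_mulE => /matrixP/(_ 0 0).
    rewrite !mxE /= !mulr1n => H.
    have -> : a = (c * (2 * w - 1) * r - r * r) / c ^+ 2 by rewrite H; field.
    by field.
  - rewrite (A2_of_R1 c0 aE) rE; have := quadR1; rewrite rE aE scalar_mulE => /matrixP/(_ 0 0).
    rewrite !mxE /= !mulr1n => H.
    have -> : a = (c * (2 * w - 1) * r - r * r) / c ^+ 2 by rewrite H; field.
    rewrite scale_scalar_mx -raddfB /=; congr _%:M; field.
    by exact: c0.
  - by rewrite rE; congr _%:M; field.
have R0 := R1_eq0 c0.
have rel := ops_sextic aE bE.
(* These quantities do not depend on the weight: [a'] is the value of [word DD 2 0], and [b'] that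
   of [- word DDD 3 0] minus 6 a'. *)
pose a' := a - w * (w - 1); pose b' := b - 3 * w * a' - w * (w - 1) * (w - 2).
have aa : a = a' + w * (w - 1) by rewrite /a' subrK.
have bb : b = b' + 3 * w * a' + w * (w - 1) * (w - 2) by rewrite /b'; ring.
have {}rel : b' ^+ 2 + 6 * a' * b' + 8 * a' ^+ 2 + 4 * a' ^+ 3 = 0.
  by rewrite -[RHS](mulr0 (- 8^-1)) -rel aa bb; field.
(* The relation is the cubic curve (b' + 2 a') (b' + 4 a') = - 4 a'^3. It is singular at the origin,
   hence parametrized by the slope b' / a'. *)
have [a'0|a'0] := eqVneq a' 0.
  have b'0 : b' = 0.
    move: rel; rewrite a'0 => /eqP; rewrite !expr0n /= !(mulr0, mul0r, addr0).
    by rewrite expf_eq0 => /andP[_ /eqP].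
  (* At the singular point lam = 0 and lam = 1 give the same scalars; the choice of 0 secures lam !=
     1. *)
  exists 0; split; first by rewrite eq_sym oner_neq0.
  - by rewrite aE aa a'0; congr _%:M; ring.
  - by rewrite bE bb a'0 b'0; congr _%:M; ring.
  - by rewrite R0 c0 mul0r raddf0.
(* The slope is normalized so that a' = lam - lam^2. *)
pose lam := - b' / (2 * a') - 1.
have two0 : 2 != 0 :> F by rewrite pnatr_eq0.
have la : a' = lam - lam ^+ 2.
  apply/eqP; rewrite -subr_eq0; apply/eqP.
  rewrite -[RHS](mulr0 ((4 * a' ^+ 2)^-1)) -rel /lam; field.
  by rewrite a'0.
have lb : b' = - 2 * a' * (lam + 1) by rewrite /lam; field; rewrite a'0.
exists lam; split.
- by move=> _; apply: contraNneq a'0 => l1; rewrite la l1 expr1n subrr.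
- by rewrite aE aa la; congr _%:M; ring.
- by rewrite bE bb lb la; congr _%:M; ring.
- by rewrite R0 c0 mul0r raddf0.
Qed.

End Irreducible.

(** * Modules on which D_{-1} is injective *)

Section LactTheory.
Variables (F : fieldType) (L : lieAlgType F) (M : lieModule L).
Implicit Types (a b : L) (m : M).

Lemma lactDr a m m' : lact a (m + m') = lact a m + lact a m'.
Proof. by have := lact_linearr a 1 m m'; rewrite !scale1r. Qed.
Lemma lact0r a : lact a (0 : M) = 0.
Proof. by apply: (addIr (lact a (0 : M))); rewrite -lactDr !add0r. Qed.
Lemma lactZr a k m : lact a (k *: m) = k *: lact a m.
Proof. by have := lact_linearr a k m 0; rewrite lact0r !addr0. Qed.
Lemma lactNr a m : lact a (- m) = - lact a m.
Proof. by rewrite -scaleN1r lactZr scaleN1r. Qed.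
Lemma lact_sumr a I (r : seq I) (P : pred I) (f : I -> M) :
  lact a (\sum_(i <- r | P i) f i) = \sum_(i <- r | P i) lact a (f i).
Proof. by apply: (big_morph (lact a)); [exact: lactDr|exact: lact0r]. Qed.
Lemma lactDl a b m : lact (a + b) m = lact a m + lact b m.
Proof. by have := lact_linearl m 1 a b; rewrite !scale1r. Qed.
Lemma lact0l m : lact (0 : L) m = 0.
Proof. by apply: (addIr (lact (0 : L) m)); rewrite -lactDl !add0r. Qed.
Lemma lactZl a k m : lact (k *: a) m = k *: lact a m.
Proof. by have := lact_linearl m k a 0; rewrite lact0l !addr0. Qed.
End LactTheory.

Lemma eigen_indep (F : fieldType) (V : lmodType F) (f : V -> V) (I : eqType)
    (ev : I -> F) (s : seq I) (u : I -> V) :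
  linear f -> uniq s -> {in s &, injective ev} -> (forall i, f (u i) = ev i *: u i) ->
  \sum_(i <- s) u i = 0 -> forall i, i \in s -> u i = 0.
Proof.
move=> lf; elim: s u => // a s IH u /= /andP[as_ us] evI fu sum0.
have fD x y : f (x + y) = f x + f y by have := lf 1 x y; rewrite !scale1r.
have f0 : f 0 = 0 by apply: (addIr (f 0)); rewrite -fD !add0r.
have fZ k x : f (k *: x) = k *: f x by have := lf k x 0; rewrite f0 !addr0.
have IHs : forall i, i \in s -> (ev i - ev a) *: u i = 0.
  apply: (IH (fun i => (ev i - ev a) *: u i)) => //.
  - by move=> i j si sj; apply: evI; rewrite inE ?si ?sj orbT.
  - by move=> i; rewrite fZ fu !scalerA mulrC.
  have := congr1 (fun x => f x - ev a *: x) sum0.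
  rewrite /= f0 scaler0 subrr (big_morph f fD f0) scaler_sumr -sumrB big_cons fu.
  rewrite subrr add0r => E; rewrite -[RHS]E.
  by apply: eq_bigr => i _; rewrite fu scalerBl.
have us0 i : i \in s -> u i = 0.
  move=> si; have := IHs i si => /eqP; rewrite scaler_eq0 => /orP[|/eqP//].
  rewrite subr_eq0 => /eqP /evI ia.
  by rewrite -ia ?inE ?si ?eqxx ?orbT // in as_; rewrite si in as_.
move=> i; rewrite inE => /orP[/eqP->|]; last exact: us0.
by move: sum0; rewrite big_cons big_seq big1 ?addr0.
Qed.

Section AModule.
Variables (F : numClosedFieldType) (M : lieModule (Alie F)).
Implicit Types (m : M).

Definition gen (kap : bool) (e : nat) : Alie F := if kap then AI F e else AD F e.

Lemma lact_gen_comm kap e kap' f m :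
  lact (gen kap e) (lact (gen kap' f) m) - lact (gen kap' f) (lact (gen kap e) m) =
  ((~~ kap)%:R * f%:R - (~~ kap')%:R * e%:R) *: lact (gen (kap || kap') (e + f).-1) m.
Proof.
rewrite -lact_bracket; case: kap kap' => [] [] /=.
- by rewrite lieb_AI lact0l !mul0r subrr scale0r.
- by rewrite lieb_anti lieb_AD_AI -scaleN1r !lactZl scalerA mulN1r mul0r mul1r sub0r addnC.
- by rewrite lieb_AD_AI lactZl mul1r mul0r subr0.
- by rewrite lieb_AD lactZl !mul1r.
Qed.

Local Notation T := (lact (AD F 0)).

Lemma T_gen kap e m :
  T (lact (gen kap e) m) = lact (gen kap e) (T m) + e%:R *: lact (gen kap e.-1) m.
Proof.
have /(canRL (subrK _)) := lact_gen_comm false 0 kap e m.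
by rewrite /= mul1r mulr0 subr0 add0n addrC.
Qed.

Definition wtv (s : F) m := lact (AD F 1) m = s *: m.

Lemma wtv_gen kap e s m : wtv s m -> wtv (s + (wt kap e)%:~R) (lact (gen kap e) m).
Proof.
rewrite /wtv => sm; have /(canRL (subrK _)) := lact_gen_comm false 1 kap e m.
rewrite /= -[AD F 1]/(gen false 1) => ->; rewrite -[gen false 1]/(AD F 1) sm lactZr.
rewrite -scalerDl addrC /wt rmorphB /=; congr (_ *: _).
by case: kap => /=; ring.
Qed.

Lemma wtvD s k m m' : wtv s m -> wtv s m' -> wtv s (k *: m + m').
Proof. by rewrite /wtv lactDr lactZr => -> ->; rewrite scalerDr !scalerA mulrC. Qed.
Lemma wtv0 s : wtv s 0.
Proof. by rewrite /wtv lact0r scaler0. Qed.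
Lemma wtvZ s k m : wtv s m -> wtv s (k *: m).
Proof. by move=> sm; rewrite -[_ *: _]addr0; apply: wtvD => //; apply: wtv0. Qed.
Lemma wtv_sum s I (r : seq I) (P : pred I) (f : I -> M) :
  (forall i, P i -> wtv s (f i)) -> wtv s (\sum_(i <- r | P i) f i).
Proof.
move=> sf; apply: big_ind => //; first exact: wtv0.
by move=> x y sx sy; rewrite -[x]scale1r; apply: wtvD.
Qed.
Lemma wtv_T s m : wtv s m -> wtv (s - 1) (T m).
Proof. exact: wtv_gen false 0 s m. Qed.

Lemma wtv_indep (I : eqType) (ev : I -> F) (r : seq I) (u : I -> M) :
  uniq r -> {in r &, injective ev} -> (forall i, wtv (ev i) (u i)) ->
  \sum_(i <- r) u i = 0 -> forall i, i \in r -> u i = 0.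
Proof. by apply: eigen_indep; apply: lact_linearr. Qed.

Variable c : F.
Hypothesis cc : central_charge M c.

Lemma weight_dec : weight_module (Alie_cartan F) M -> forall m,
  exists (r : seq F) (u : F -> M),
    [/\ uniq r, forall i, wtv i (u i) & m = \sum_(i <- r) u i].
Proof.
move=> [dec _] m; have [st [u [wu ->]]] := dec m.
pose hd (t : 2.-tuple F) := tnth t ord0.
exists (undup [seq hd t | t <- st]), (fun a => \sum_(t <- st | hd t == a) u t); split.
- exact: undup_uniq.
- by move=> a; apply: wtv_sum => t /eqP <-; apply: (wu t ord0).
- rewrite (exchange_big_dep xpredT) //=; apply: eq_big_seq => t tst.
  rewrite -big_filter; under eq_filter => a do rewrite eq_sym.
  rewrite filter_pred1_uniq ?undup_uniq ?big_seq1 // mem_undup.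
  exact: map_f.
Qed.

Definition indep n (v : 'I_n -> M) :=
  forall k : 'I_n -> F, \sum_i k i *: v i = 0 -> forall i, k i = 0.

Lemma indep_span_leq n p (v : 'I_n -> M) (w : 'I_p -> M) : indep v ->
  (forall i, exists k : 'I_p -> F, v i = \sum_j k j *: w j) -> (n <= p)%N.
Proof.
move=> iv vw; have [A vA] := fin_all_exists vw; pose B := \matrix_(i, j) A i j.
rewrite leqNgt; apply/negP => pn.
have : kermx B != 0.
  rewrite -mxrank_eq0 mxrank_ker -lt0n subn_gt0.
  exact: leq_ltn_trans (rank_leq_col _) pn.
case/rowV0Pn => x /sub_kermxP xB /eqP[]; apply/rowP => i; rewrite !mxE.
apply: (iv (fun i => x 0 i)); under eq_bigr => j _ do rewrite vA scaler_sumr.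
rewrite exchange_big /= big1 // => k _; under eq_bigr => j _ do rewrite scalerA.
rewrite -scaler_suml; have /rowP/(_ k) := xB; rewrite !mxE => E.
suff -> : \sum_(i < n) x 0 i * A i k = 0 by rewrite scale0r.
by rewrite -[RHS]E; apply: eq_bigr => j _; rewrite mxE.
Qed.

Lemma weight_bounded : bounded_module (Alie_cartan F) M -> exists N : nat,
  forall s n (v : 'I_n -> M), indep v -> (forall i, wtv s (v i)) -> (n <= N)%N.
Proof.
move=> [_ [N [_ dimN]]]; exists N => s n v iv wv.
have [p pN [w [_ spanw]]] := dimN [tuple s; c].
apply: leq_trans (ltnW pN); apply: (indep_span_leq (w := w) iv) => i.
have : weight_space (Alie_cartan F) [tuple s; c] (v i).
  by move=> j; case: (unliftP ord0 j) => [j'|] ->; [rewrite ord1; apply: cc|apply: wv].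
rewrite spanw => -[st ->]; exists (fun j => \sum_(x <- st | x.2 == j) x.1).
under [RHS]eq_bigr => j _ do rewrite scaler_suml.
rewrite (exchange_big_dep xpredT) //=; apply: eq_bigr => x _.
by rewrite (big_pred1 x.2) // => j; rewrite eq_sym.
Qed.

Lemma maximal_weight : bounded_module (Alie_cartan F) M -> (exists m : M, m <> 0) ->
  exists d s (v : 'I_d.+1 -> M), [/\ indep v, forall i, wtv s (v i) &
    forall s' n (v' : 'I_n -> M), indep v' -> (forall i, wtv s' (v' i)) -> (n <= d.+1)%N].
Proof.
move=> bM [m m0]; have [N Nb] := weight_bounded bM.
pose Q n := `[< exists s (v : 'I_n -> M), indep v /\ forall i, wtv s (v i) >].
have Q1 : Q 1%N.
  have [r [u [ur wu mE]]] := weight_dec bM.1 m.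
  have [a ua] : exists a, u a <> 0.
    by apply/not_existsP => H; apply: m0; rewrite mE big1 // => i _; apply: contrapT; apply: H.
  apply/asboolP; exists a, (fun=> u a); split=> // k; rewrite big_ord1 => /eqP.
  by rewrite scaler_eq0 => /orP[/eqP k0 i|/eqP//]; rewrite ord1.
have QN n : Q n -> (n <= N)%N by move=> /asboolP[s [v [iv wv]]]; apply: Nb iv wv.
have [d0 /asboolP[s [v [iv wv]]] dmax] := ex_maxnP (ex_intro Q _ Q1) QN.
case: d0 v iv wv dmax => [|d] v iv wv dmax; first by have := dmax _ Q1.
exists d, s, v; split=> // s' n v' iv' wv'; apply: dmax.
by apply/asboolP; exists s', v'.
Qed.

Hypothesis T_inj : forall m, T m = 0 -> m = 0.
Variables (d : nat) (s0 : F) (v : 'I_d.+1 -> M).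
Hypothesis (indv : indep v) (wtvv : forall i, wtv s0 (v i)).
Hypothesis maxv : forall s' n (v' : 'I_n -> M), indep v' ->
  (forall i, wtv s' (v' i)) -> (n <= d.+1)%N.

(* The identification of the weight space s0 - l with that of weight s0. *)
Definition low (l : nat) (x : 'cV[F]_d.+1) : M := iter l T (\sum_i x i 0 *: v i).

Arguments low : simpl never.

Lemma low_lin l a x y : low l (a *: x + y) = a *: low l x + low l y.
Proof.
elim: l => [|l IH]; last by rewrite /low !iterS -!/(low _ _) IH lactDr lactZr.
rewrite /low /= scaler_sumr -big_split; apply: eq_bigr => i _.
by rewrite !mxE scalerDl scalerA.
Qed.

Lemma low0 l : low l 0 = 0.
Proof.
by have := low_lin l (-1) 0 0; rewrite scaler0 addr0 scaleN1r addNr.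
Qed.

Lemma lowS l x : T (low l x) = low l.+1 x. Proof. by []. Qed.

Lemma iter_low n l x : iter n T (low l x) = low (n + l) x.
Proof. by rewrite /low -iterD. Qed.

Lemma wtv_low l x : wtv (s0 - l%:R) (low l x).
Proof.
elim: l => [|l IH]; last by rewrite -natr1 opprD addrA; apply: wtv_T.
by rewrite subr0; apply: wtv_sum => i _; apply: wtvZ.
Qed.

Lemma low_inj0 l x : low l x = 0 -> x = 0.
Proof.
elim: l => [|l IH]; last by move/T_inj.
move=> /indv x0; apply/colP => i; rewrite x0 !mxE //.
Qed.

Lemma low_inj l : injective (low l).
Proof.
move=> x y xy; apply/eqP; rewrite -subr_eq0; apply/eqP; apply: (@low_inj0 l).
by rewrite addrC -scaleN1r low_lin xy scaleN1r addNr.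
Qed.

Lemma low_sum l (x : 'cV[F]_d.+1) : low l x = \sum_i x i 0 *: low l (delta_mx i 0).
Proof.
have E : x = \sum_i x i 0 *: delta_mx i 0.
  apply/colP => i; rewrite summxE (bigD1 i) //= !mxE !eqxx mulr1 big1 ?addr0 // => j ji.
  by rewrite !mxE eq_sym (negPf ji) mulr0.
have lD y z : low l (y + z) = low l y + low l z.
  by have := low_lin l 1 y z; rewrite !scale1r.
rewrite {1}E (big_morph (low l) lD (low0 l)); apply: eq_bigr => i _.
by have := low_lin l (x i 0) (delta_mx i 0) 0; rewrite low0 !addr0.
Qed.

(** As d is injective, [low l] already provides d + 1 independent vectors of this weight, the
    maximal number. *)
Lemma low_surj l m : wtv (s0 - l%:R) m -> exists x, m = low l x.
Proof.
move=> wm; apply: contrapT => nox.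
pose v' (i : 'I_d.+2) := if unlift ord0 i is Some j then low l (delta_mx j 0) else m.
have := @maxv (s0 - l%:R) d.+2 v'; rewrite ltnn; case/(_ _ _)/notF => [|i]; last first.
  by rewrite /v'; case: unlift => [j|//]; apply: wtv_low.
move=> k; rewrite big_ord_recl /v' unlift_none.
under eq_bigr => i _ do rewrite liftK.
pose y : 'cV[F]_d.+1 := \col_j k (fintype.lift ord0 j).
have -> : \sum_(i < d.+1) k (fintype.lift ord0 i) *: low l (delta_mx i 0) = low l y.
  by rewrite low_sum; apply: eq_bigr => i _; rewrite mxE.
have [k0|k0] := eqVneq (k ord0) 0.
  rewrite k0 scale0r add0r => /low_inj0 y0 i.
  case: (unliftP ord0 i) => [j|] -> //.
  by have /colP/(_ j) := y0; rewrite !mxE.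
move=> /eqP; rewrite addr_eq0 => /eqP E; case: nox; exists (- (k ord0)^-1 *: y + 0).
by rewrite low_lin low0 addr0 scaleNr -scalerN -E scalerA mulVf // scale1r.
Qed.

(** The common target is the weight s0 - 1 and not s0, so that D_{-1} also starts at a level of
    index at least 0. *)
Lemma base_ops : exists Q : bool * nat -> 'M[F]_d.+1, forall kap e x,
  lact (gen kap e) (low (e + kap) x) = low 1 (Q (kap, e) *m x).
Proof.
have H (p : bool * nat) : exists A : 'M[F]_d.+1, forall x,
    lact (gen p.1 p.2) (low (p.2 + p.1) x) = low 1 (A *m x).
  have col j : exists y, lact (gen p.1 p.2) (low (p.2 + p.1) (delta_mx j 0)) = low 1 y.
    apply: low_surj; have := wtv_gen p.1 p.2 (wtv_low (p.2 + p.1) (delta_mx j 0)).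
    congr (wtv _ _); rewrite /wt natrD rmorphB /=; case: p.1; rewrite /=; ring.
  have [y yE] := fin_all_exists col; exists (\matrix_(i, j) y j i 0) => x.
  rewrite low_sum lact_sumr [RHS]low_sum.
  under eq_bigr => j _ do rewrite lactZr yE low_sum scaler_sumr.
  rewrite exchange_big /=; apply: eq_bigr => i _.
  rewrite mxE scaler_suml; apply: eq_bigr => j _.
  by rewrite scalerA mxE mulrC.
by have [Q QE] := choice H; exists Q => kap e x; apply: (QE (kap, e)).
Qed.

Variable Q : bool * nat -> 'M[F]_d.+1.
Hypothesis QE : forall kap e x,
  lact (gen kap e) (low (e + kap) x) = low 1 (Q (kap, e) *m x).

(* Newton's interpolation formula in the position [s], from the iterated brackets
   with D_{-1} at s = 0. *)
Definition Pop (kap : bool) (e : nat) (s : int) : 'M[F]_d.+1 :=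
  \sum_(j < e.+1) (binz F s j * (e ^_ j)%:R) *: Q (kap, (e - j)%N).

Lemma Pop_shift kap e s : Pop kap e (s + 1) = Pop kap e s + e%:R *: Pop kap e.-1 s.
Proof.
rewrite /Pop; case: e => [|e]; first by rewrite !big_ord1 !binz0 scale0r addr0.
rewrite big_ord_recl [X in _ = X + _]big_ord_recl !binz0 -addrA; congr (_ + _).
rewrite scaler_sumr -big_split; apply: eq_bigr => j _.
rewrite /= /bump /= ?add1n subSS binzS ffactSS natrM scalerA -scalerDl; congr (_ *: _).
by ring.
Qed.

Lemma Pop0 kap e : Pop kap e 0 = Q (kap, e).
Proof.
rewrite /Pop big_ord_recl binz0 mul1r ffactn0 scale1r subn0 big1 ?addr0 // => j _.
by rewrite (@binz_small _ 0) // mul0r scale0r.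
Qed.

Lemma mulmx_low l (A B : 'M[F]_d.+1) (k : F) x :
  low l ((A + k *: B) *m x) = low l (A *m x) + k *: low l (B *m x).
Proof. by rewrite mulmxDl -scalemxAl addrC low_lin addrC. Qed.

(** Applying d to the formula at level [l] gives the one at level l + 1, plus the same formula for e
    - 1, which is known by the inner induction. *)
Lemma Pop_low kap e (l : nat) x :
  lact (gen kap e) (low (l + e + kap) x) = low l.+1 (Pop kap e (- l%:Z) *m x).
Proof.
elim: l e => [|l IH] e; first by rewrite oppr0 Pop0 QE.
elim: e => [|e IHe].
  have /(congr1 T) := IH 0%N; rewrite lowS T_gen scale0r addr0 => E.
  have := Pop_shift kap 0 (- l.+1%:Z); rewrite scale0r addr0.
  by rewrite (_ : - l.+1%:Z + 1 = - l%:Z); [move=> <-|lia].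
have /(congr1 T) := IH e.+1; rewrite lowS T_gen.
have := Pop_shift kap e.+1 (- l.+1%:Z).
rewrite (_ : - l.+1%:Z + 1 = - l%:Z); last by lia.
move=> ->; rewrite mulmx_low lowS /= => E.
apply: (addIr (e.+1%:R *: low l.+2 (Pop kap e (- l.+1%:Z) *m x))).
by rewrite -E -IHe !addSn !addnS.
Qed.

Lemma Pop_D0 s : Pop false 0 s = 1.
Proof.
rewrite /Pop big_ord1 binz0 mul1r ffactn0 scale1r subn0.
apply/matrixP => i j; have := QE false 0 (delta_mx j 0); rewrite addn0 /=.
rewrite lowS => /low_inj/colP/(_ i); rewrite -colE !mxE => <-.
by rewrite andbT.
Qed.

Lemma Pop_I0 s : Pop true 0 s = c%:M.
Proof.
rewrite /Pop big_ord1 binz0 mul1r ffactn0 scale1r subn0.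
apply/matrixP => i j; have := QE true 0 (delta_mx j 0); rewrite /= cc.
have -> : c *: low 1 (delta_mx j 0) = low 1 (c *: delta_mx j 0 + 0).
  by rewrite low_lin low0 addr0.
move=> /low_inj/colP/(_ i); rewrite -colE !mxE => <-.
by rewrite addr0 andbT mulr_natr.
Qed.

Lemma Pop_D1 s : Pop false 1 s = (s0 - 1 + s%:~R)%:M.
Proof.
have Q1 : Q (false, 1%N) = (s0 - 1)%:M.
  apply/matrixP => i j; have := QE false 1 (delta_mx j 0); rewrite /= addn0.
  have wl := wtv_low 1 (delta_mx j 0); rewrite -[AD F 1]/(AD F 1) wl.
  have -> : (s0 - 1%:R) *: low 1 (delta_mx j 0) = low 1 ((s0 - 1) *: delta_mx j 0 + 0).
    by rewrite low_lin low0 addr0.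
  move=> /low_inj/colP/(_ i); rewrite -colE !mxE => <-.
  by rewrite addr0 andbT mulr_natr.
have Q0 := Pop_D0 0; rewrite Pop0 in Q0.
rewrite /Pop !big_ord_recl big_ord0 /= /bump /= !addn0 Q1 Q0 binz0 binz1 mul1r ffactn0.
by rewrite scale1r ffactn1 mulr1 addr0 scalemx1 -raddfD.
Qed.

(** The defect [G e f] changes from s to s + 1 only by multiples of [G e.-1 f] and [G e f.-1]. By
    induction on e + f these are 0, so [G e f] is constant in the position, and one position where
    the module gives the relation suffices. *)
Lemma Pop_rel kap e kap' f s :
    Pop kap e s * Pop kap' f (s - wt kap e) -
    Pop kap' f s * Pop kap e (s - wt kap' f) =
    ((~~ kap)%:R * f%:R - (~~ kap')%:R * e%:R) *: Pop (kap || kap') (e + f).-1 s.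
Proof.
pose G e f s := Pop kap e s * Pop kap' f (s - wt kap e) -
    Pop kap' f s * Pop kap e (s - wt kap' f) -
    ((~~ kap)%:R * f%:R - (~~ kap')%:R * e%:R) *: Pop (kap || kap') (e + f).-1 s.
suff G0 : forall e f s, G e f s = 0 by apply/eqP; rewrite -subr_eq0; apply/eqP/G0.
pose X k1 e k2 f s := Pop k1 e s * Pop k2 f (s - wt k1 e).
have XS : forall k1 k2 e f s, X k1 e k2 f (s + 1) =
    X k1 e k2 f s + e%:R *: X k1 e.-1 k2 f s + f%:R *: X k1 e k2 f.-1 s.
  move=> k1 k2 e1 f1 u; rewrite /X (_ : u + 1 - wt k1 e1 = u - wt k1 e1 + 1); last by lia.
  rewrite Pop_shift mulrDl -scalerAl [RHS]addrAC; congr (_ + _).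
    by rewrite Pop_shift mulrDr -scalerAr.
  case: e1 => [|e1]; first by rewrite !scale0r.
  by congr (_ *: (_ * Pop _ _ _)); rewrite /wt -addn1 PoszD /=; lia.
have GS : forall e f s, G e f (s + 1) = G e f s + e%:R *: G e.-1 f s + f%:R *: G e f.-1 s.
  move=> {}e {}f {}s; rewrite /G -!/(X _ _ _ _ _) !XS.
  set a : F := (~~ kap)%:R; set b : F := (~~ kap')%:R.
  pose R n := Pop (kap || kap') n s.
  have -> : (a * f%:R - b * e%:R) *: Pop (kap || kap') (e + f).-1 (s + 1) =
     (a * f%:R - b * e%:R) *: R (e + f).-1 +
     (e%:R * (a * f%:R - b * e.-1%:R)) *: R (e.-1 + f).-1 +
     (f%:R * (a * f.-1%:R - b * e%:R)) *: R (e + f.-1).-1.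
    rewrite Pop_shift scalerDr -addrA -/(R _); congr (_ + _); rewrite scalerA -/(R _).
    case: e => [|e]; case: f => [|f] /=.
    - by rewrite !mulr0 subrr !mul0r !scale0r addr0.
    - by rewrite !add0n mul0r scale0r add0r; congr (_ *: _); ring.
    - by rewrite !addn0 mul0r scale0r addr0 /=; congr (_ *: _); ring.
    - rewrite ?addSn ?addnS /= -scalerDl; congr (_ *: _).
      by rewrite -!natr1 natrD; ring.
  rewrite !scalerBr !scalerA -/(R _) -/(R (e.-1 + f).-1) -/(R (e + f.-1).-1).
  move: (_ *: R (e + f).-1) (_ *: R (e.-1 + f).-1) (_ *: R (e + f.-1).-1) => r1 r2 r3.
  move: (X kap e kap' f s) (X kap' f kap e s) (_ *: X kap e.-1 kap' f s) => x1 x2 x3.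
  move: (_ *: X kap e kap' f.-1 s) (_ *: X kap' f.-1 kap e s) (_ *: X kap' f kap e.-1 s) => x4 x5 x6.
  mxring.
(* At position -1 the intermediate and final weight spaces of every product lie among those reached
   by [Pop_low]; position 0 would exclude D_{-1} as left factor. *)
have Gbase : forall e f, G e f (-1) = 0.
  move=> {}e {}f; apply/matrixP => i j.
  have op2 k1 k2 e1 f1 x : lact (gen k1 e1) (lact (gen k2 f1) (low (e1 + k1 + f1 + k2) x)) =
      low 2 (X k1 e1 k2 f1 (-1) *m x).
    rewrite Pop_low; have := Pop_low k1 e1 1 (Pop k2 f1 (- (e1 + k1)%N%:Z) *m x).
    rewrite add1n addSn => ->; rewrite mulmxA mulmxE; congr (low 2 (_ * Pop _ _ _ *m _)).
    by rewrite /wt; case: k1 => /=; lia.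
  have := lact_gen_comm kap e kap' f (low (e + kap + f + kap') (delta_mx j 0)).
  rewrite op2 (_ : e + kap + f + kap' = f + kap' + e + kap)%N; last by lia.
  rewrite op2 -scaleN1r addrC => E.
  have {}E : low 2 ((X kap e kap' f (-1) - X kap' f kap e (-1)) *m delta_mx j 0) =
     ((~~ kap)%:R * f%:R - (~~ kap')%:R * e%:R) *: low 2 (Pop (kap || kap') (e + f).-1 (-1) *m delta_mx j 0).
    rewrite -scaleN1r mulmx_low addrC E.
    have [/andP[k1 k2]|] := boolP (kap && kap').
      by rewrite k1 k2 /= !mul0r subrr !scale0r.
    have [/eqP|ef kk] := posnP (e + f).
      by rewrite addn_eq0 => /andP[/eqP-> /eqP->]; rewrite !mulr0 subrr !scale0r.
    have := Pop_low (kap || kap') (e + f).-1 1 (delta_mx j 0) => <-.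
    congr (_ *: lact _ (low _ _)); move: kk ef; case: (kap); case: (kap') => //= _; lia.
  have {}E : low 2 (G e f (-1) *m delta_mx j 0) = 0.
    set k0 : F := _ - _ in E.
    have -> : G e f (-1) = (X kap e kap' f (-1) - X kap' f kap e (-1)) +
        (- k0) *: Pop (kap || kap') (e + f).-1 (-1) by rewrite scaleNr.
    by rewrite mulmx_low E scaleNr subrr.
  by have /low_inj0/colP/(_ i) := E; rewrite -colE !mxE.
move=> {e f s} e f; have [n] := ubnP (e + f); elim: n e f => // n IH e f; rewrite ltnS => efn.
apply: (@int_shift_ind _ (-1)) => [|s]; first exact: Gbase.
suff -> : G e f (s + 1) = G e f s by [].
rewrite GS -addrA; have -> : e%:R *: G e.-1 f s = 0.
  case: e efn => [|e] efn; first by rewrite scale0r.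
  by rewrite IH ?scaler0.
have -> : f%:R *: G e f.-1 s = 0.
  case: f efn => [|f] efn; first by rewrite scale0r.
  by rewrite IH ?scaler0 //; rewrite addnS in efn.
by rewrite !addr0.
Qed.

Definition ops : opsys d c (s0 - 1) := OpSys Pop_shift Pop_rel Pop_D0 Pop_D1 Pop_I0.

Lemma low_indep n (x : nat -> 'cV[F]_d.+1) : \sum_(l < n) low l (x l) = 0 ->
  forall l, (l < n)%N -> x l = 0.
Proof.
rewrite -(big_mkord xpredT (fun l => low l (x l))) => sum0 l ln.
apply: (@low_inj0 l); apply: (wtv_indep (ev := fun l : nat => s0 - l%:R) _ _ _ sum0).
- exact: iota_uniq.
- by move=> i j _ _ /addrI/oppr_inj/eqP; rewrite eqr_nat => /eqP.
- by move=> i; apply: wtv_low.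
- by rewrite mem_index_iota.
Qed.

Lemma Alie_ind (K : Alie F -> Prop) : (forall k a b, K a -> K b -> K (k *: a + b)) ->
  K 0 -> (forall kap e, K (gen kap e)) -> forall a, K a.
Proof.
move=> Klin K0 Kgen [p q].
have Ksum (I : Type) (r : seq I) (k : I -> F) (u : I -> Alie F) :
    (forall i, K (u i)) -> K (\sum_(i <- r) k i *: u i).
  by move=> Ku; apply: big_ind => // [x y Kx Ky|i _];
    [rewrite -[x]scale1r; apply: Klin|rewrite -[_ *: _]addr0; apply: Klin].
have -> : (p, q) = \sum_(i < size p) p`_i *: gen false i +
    \sum_(i < size q) q`_i *: gen true i.
  have -> : \sum_(i < size p) p`_i *: gen false i = (p, 0).
    rewrite -[in RHS](coefK p) poly_def; apply: (big_ind2 (fun x y => x = (y, 0))) => //.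
      by move=> x1 x2 y1 y2 -> ->; congr pair; rewrite /= addr0.
    by move=> i _; congr pair; rewrite /= scaler0.
  have -> : \sum_(i < size q) q`_i *: gen true i = (0, q).
    rewrite -[in RHS](coefK q) poly_def; apply: (big_ind2 (fun x y => x = (0, y))) => //.
      by move=> x1 x2 y1 y2 -> ->; congr pair; rewrite /= addr0.
    by move=> i _; congr pair; rewrite /= scaler0.
  by congr pair; rewrite /= ?addr0 ?add0r.
rewrite -[X in X + _]scale1r; apply: Klin; apply: Ksum => i; apply: Kgen.
Qed.

(** Raising operators may leave the weights up to s0, so membership is tested after a power of d:
    the vectors that some power of d sends into the sum of the [low l] of U form a nonzero
    submodule. *)
Lemma low_generates (U : 'cV[F]_d.+1 -> Prop) : simple_module M ->
  (forall a u v, U u -> U v -> U (a *: u + v)) -> (exists2 u, u <> 0 & U u) ->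
  (forall kap e s u, U u -> U (Pop kap e s *m u)) ->
  forall m, exists N n (x : nat -> 'cV[F]_d.+1),
    (forall l, U (x l)) /\ iter N T m = \sum_(l < n) low l (x l).
Proof.
move=> [_ simpM] Ulin [u0 u00 Uu0] sP.
have U0 : U 0 by have := Ulin (-1) _ _ Uu0 Uu0; rewrite scaleN1r addNr.
pose Low k m := exists n (x : nat -> 'cV[F]_d.+1),
  (forall l, U (x l)) /\ m = \sum_(l < n) low (k + l) (x l).
have LowT k m : Low k m -> Low k.+1 (T m).
  by move=> [n [x [Ux ->]]]; exists n, x; split=> //; rewrite lact_sumr.
have LowS k m : Low k.+1 m -> Low k m.
  move=> [n [x [Ux ->]]]; exists n.+1, (fun l => if l is l'.+1 then x l' else 0); split.
    by case.
  by rewrite big_ord_recl low0 add0r; apply: eq_bigr => i _; rewrite /= addnS.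
have LowD k a m m' : Low k m -> Low k m' -> Low k (a *: m + m').
  move=> [n [x [Ux ->]]] [p [y [Uy ->]]].
  pose xx l := if (l < n)%N then x l else 0; pose yy l := if (l < p)%N then y l else 0.
  have E z q (zz := fun l => if (l < q)%N then z l else 0) r : (q <= r)%N ->
      \sum_(l < q) low (k + l) (z l) = \sum_(l < r) low (k + l) (zz l).
    move=> qr; rewrite (big_ord_widen r (fun l => low (k + l) (z l))) // big_mkcond.
    by apply: eq_bigr => i _; rewrite /zz; case: ifP => //; rewrite low0.
  exists (maxn n p), (fun l => a *: xx l + yy l); split.
    by move=> l; apply: Ulin; rewrite /xx /yy; case: ifP.
  rewrite (E x n (maxn n p)) ?leq_maxl // (E y p (maxn n p)) ?leq_maxr //.
  by rewrite scaler_sumr -big_split; apply: eq_bigr => i _; rewrite low_lin.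
pose S m := exists N, Low 0 (iter N T m).
have LowN k N m : Low k m -> Low k (iter N T m).
  by elim: N => // N IH Lm; rewrite iterS; apply/LowS/LowT/IH.
have ST m : S (T m) -> S m by move=> [N]; exists N.+1; rewrite iterSr.
have iterT_lin N a m m' : iter N T (a *: m + m') = a *: iter N T m + iter N T m'.
  by elim: N => // N IH; rewrite !iterS IH lactDr lactZr.
have SD a m m' : S m -> S m' -> S (a *: m + m').
  move=> [N LN] [N' LN']; exists (N + N')%N; rewrite iterT_lin; apply: LowD.
    by rewrite addnC iterD; apply: LowN.
  by rewrite iterD; apply: LowN.
have L0S m : Low 0 m -> S m by exists 0%N.
have LowSS k m : Low k m -> S m.
  by elim: k => [|k IH]; [exact: L0S|move/LowS].
have S0 : S 0.
  by apply: L0S; exists 0%N, (fun=> 0); rewrite big_ord0.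
have Sgen_step kap e m : (forall m', S m' -> S (e%:R *: lact (gen kap e.-1) m')) ->
    S m -> S (lact (gen kap e) m).
  move=> IHe.
  (* By the bracket with d the claim for m' follows from the claim for d m' and from the one for e -
     1; so it may be proved far below, where the operator stays within the levels. *)
  have step m' : S (lact (gen kap e) (T m')) -> S m' -> S (lact (gen kap e) m').
    move=> h1 h2; apply: ST; rewrite T_gen -[lact _ (T m')]scale1r.
    by apply: SD => //; apply: IHe.
  have base j : forall k m', (e + kap <= k + j)%N -> Low k m' -> S (lact (gen kap e) m').
    elim: j => [|j IHj] k m' kj Lk; last first.
      apply: step; last exact: LowSS Lk.
      by apply: (IHj k.+1); [rewrite addSnnS|apply: LowT].
    move: Lk => [n [x [Ux ->]]]; rewrite addn0 in kj.
    apply: (LowSS (k - (e + kap)).+1).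
    exists n, (fun l => Pop kap e (- (k - (e + kap) + l)%N%:Z) *m x l); split.
      by move=> l; apply: sP.
    rewrite lact_sumr; apply: eq_bigr => l _; rewrite addSn -Pop_low.
    by congr (lact _ (low _ _)); lia.
  move=> [N]; elim: N m => [|N IHN] m LN; first exact: (base (e + kap)%N 0%N).
  by apply: step; [apply: IHN; rewrite -iterSr|exists N.+1].
have Sgen kap e m : S m -> S (lact (gen kap e) m).
  elim: e m => [|e IHe] m; apply: Sgen_step => m' Sm'; first by rewrite scale0r.
  by rewrite -[_ *: _]addr0; apply: SD => //; apply: IHe.
have subS : is_submodule S.
  split=> // a u Su; apply: (Alie_ind (K := fun a => S (lact a u))) => [k x y Sx Sy||].
  - by rewrite lact_linearl; apply: SD.
  - by rewrite lact0l.
  - by move=> kap e; apply: Sgen.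
move=> m; suff [N LN] : S m by exists N.
have [S_0|->//] := simpM _ subS; have : S (low 0 u0).
  exists 0%N, 1%N, (fun=> u0); split=> //.
  by rewrite big_ord1.
by rewrite S_0 => /low_inj0.
Qed.

(** A stable subspace is stable under all the operators, since brackets with D_1 and I_1 produce the
    higher ones. It therefore generates M in the sense of [low_generates], and comparing components
    of equal weight in d^N applied to [low 0 x] puts [x] into it. *)
Lemma simple_irr : simple_module M -> irr_ops ops.
Proof.
move=> simpM U Ulin [u0 u00 Uu0] U2 U3 UI.
have U0 : U 0 by have := Ulin (-1) _ _ Uu0 Uu0; rewrite scaleN1r addNr.
pose st (A : 'M[F]_d.+1) := forall u, U u -> U (A *m u).
have stZ a A : st A -> st (a *: A).
  by move=> sA u Uu; rewrite -scalemxAl -[_ *: _]addr0; apply: Ulin => //; apply: sA.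
have stD A B : st A -> st B -> st (A + B).
  move=> sA sB u Uu; rewrite mulmxDl -[A *m u]scale1r; apply: Ulin; [exact: sA|exact: sB].
have stM A B : st A -> st B -> st (A * B).
  by move=> sA sB u Uu; rewrite -mulmxE -mulmxA; apply/sA/sB.
have stS a : st a%:M.
  by move=> u Uu; rewrite mul_scalar_mx -[_ *: _]addr0; apply: Ulin.
have stP kap e : (forall e', (e' <= e)%N -> st (Q (kap, e'))) -> forall s, st (Pop kap e s).
  move=> sQ s; apply: big_ind => [|A B|i _]; first by have := stS 0; rewrite raddf0.
    exact: stD.
  by apply/stZ/sQ; apply: leq_subr.
have stB A B : st A -> st B -> st (A - B).
  by move=> sA sB; rewrite -scaleN1r; apply: stD => //; apply: stZ.
have sQD e : st (Q (false, e)).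
  have [n] := ubnP e; elim: n e => // n IH [|[|[|[|e]]]] en; rewrite -Pop0.
  - by rewrite Pop_D0; apply: stS.
  - by rewrite Pop_D1; apply: stS.
  - exact: U2.
  - exact: U3.
  - have E : Pop false e.+4 0 = e.+1%:R^-1 *: (Pop false 2 0 * Pop false e.+3 (0 - wt false 2) -
        Pop false e.+3 0 * Pop false 2 (0 - wt false e.+3)).
      rewrite Pop_rel /= scalerA !mul1r -natrB //.
      by rewrite mulVf ?scale1r // pnatr_eq0.
    rewrite E; apply/stZ/stB; apply: stM; apply: stP => e' e'e; apply: IH;
      by move: en e'e; rewrite !ltnS; lia.
have sQI e : st (Q (true, e)).
  have [n] := ubnP e; elim: n e => // n IH [|[|e]] en; rewrite -Pop0.
  - by rewrite Pop_I0; apply: stS.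
  - exact: UI.
  - have E : Pop true e.+2 0 = Pop false e.+2 0 * Pop true 1 (0 - wt false e.+2) -
        Pop true 1 0 * Pop false e.+2 (0 - wt true 1).
      by rewrite Pop_rel /= addn1 /= mul0r subr0 mul1r scale1r.
    rewrite E; apply/stB; apply: stM; apply: stP => e' e'e; try exact: sQD;
      by apply: IH; move: en e'e; rewrite !ltnS; lia.
have sP kap e s : st (Pop kap e s) by apply: stP => e' _; case: kap; [exact: sQI|exact: sQD].
have Ugen := low_generates simpM Ulin (ex_intro2 _ _ u0 u00 Uu0) sP.
move=> x; have [N [n [y [Uy]]]] := Ugen (low 0 x).
rewrite iter_low addn0 => E.
pose z l := (if l == N then x else 0) - (if (l < n)%N then y l else 0).
have z0 : \sum_(l < maxn n N.+1) low l (z l) = 0.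
  under eq_bigr => l _ do rewrite /z -scaleN1r addrC low_lin addrC scaleN1r.
  have Nm : (N < maxn n N.+1)%N by rewrite leq_max ltnSn orbT.
  rewrite sumrB (bigD1 (Ordinal Nm)) //= eqxx big1 ?addr0 => [|l lN]; last first.
    by move: lN; rewrite -val_eqE /= => /negPf->; rewrite low0.
  rewrite E (big_ord_widen (maxn n N.+1) (fun l => low (0 + l) (y l))) ?leq_maxl //.
  rewrite big_mkcond; apply/eqP; rewrite subr_eq0; apply/eqP.
  by apply: eq_bigr => l _; case: ifP; rewrite ?low0.
have := low_indep z0 (l := N); rewrite leq_max ltnSn orbT => /(_ isT).
rewrite /z eqxx => /eqP; rewrite subr_eq0 => /eqP ->.
by case: ifP.
Qed.

(** Weights above s0 are not described by the matrices; enough powers of d bring any weight vector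
    down to where they are. *)
Lemma wtv_reach m s : simple_module M -> wtv s m -> m <> 0 ->
  exists N (l : nat) x, s = s0 + N%:R - l.+3%:R /\ iter N T m = low l.+3 x.
Proof.
move=> simpM wm m0.
have [||//|N [n [x [_ mE]]]] := low_generates (U := fun=> True) simpM _ _ _ m => //.
  exists (delta_mx 0 0) => //.
  by move/matrixP/(_ 0 0); rewrite !mxE /= => /eqP; rewrite oner_eq0.
have wN : forall K, wtv (s - K%:R) (iter K T m).
  elim=> [|K IH]; first by rewrite subr0.
  by rewrite -natr1 opprD addrA; apply: wtv_T.
have mN K : iter K T m <> 0 by elim: K => // K IH; move/T_inj.
have [l [ln lw]] : exists l, (l < n)%N /\ s - N%:R = s0 - l%:R.
  apply: contrapT => H; apply: (mN N); rewrite mE big1 // => l _.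
  pose y l := (s0 - l%:R - (s - N%:R)) *: x l.
  have := low_indep (n := n) (x := y) _ (ltn_ord l); rewrite /y => y0.
  have /eqP : (s0 - l%:R - (s - N%:R)) *: x l = 0.
    apply: y0; have := wN N; rewrite /wtv mE lact_sumr scaler_sumr => /eqP.
    rewrite -subr_eq0 -sumrB => /eqP E; rewrite -[RHS]E; apply: eq_bigr => k _.
    have := low_lin k (s0 - k%:R - (s - N%:R)) (x k) 0; rewrite low0 !addr0 => ->.
    by rewrite (wtv_low k (x k)) -scalerBl.
  rewrite scaler_eq0 => /orP[|/eqP->]; last by rewrite low0.
  rewrite subr_eq0 => /eqP sl; case: H; exists l; split=> //.
have wN3 := wN (N + 3)%N.
have [|x' x'E] := @low_surj l.+3 (iter (N + 3) T m).
  move: wN3; congr (wtv _ _); rewrite natrD opprD addrA lw -[l.+3]addn3 natrD; ring.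
exists (N + 3)%N, l, x'; split=> //.
rewrite natrD -[l.+3]addn3 natrD; apply: (addIr (- N%:R)); rewrite lw; ring.
Qed.

(** The laws hold below s0 by [ops_parameters]. A law for d m implies the law for m after applying
    d, by the bracket with d, and d is injective. *)
Lemma module_laws : simple_module M -> exists lam : F,
  [/\ c = 0 -> lam != 1,
    forall s m, wtv s m -> lact (AD F 2) (T m) = ((s - lam) * (s - 1 + lam)) *: m,
    forall s m, wtv s m -> lact (AD F 3) (T (T m)) =
      ((s - lam) * (s - lam - 1) * (s - 2 + 2 * lam)) *: m &
    forall s m, wtv s m -> lact (AI F 1) (T m) = (c * (s - lam)) *: m].
Proof.
move=> simpM; have irr := simple_irr simpM.
have [lam [lam1 E2 E3 EI]] := ops_parameters irr.
have scal (a : F) (x : 'cV[F]_d.+1) l : low l (a%:M *m x) = a *: low l x.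
  by rewrite mul_scalar_mx; have := low_lin l a x 0; rewrite low0 !addr0.
have mm (l : nat) : s0 - l.+1%:R = s0 - 1 + (- l%:Z)%:~R.
  by rewrite -natr1 rmorphN /= -pmulrn; ring.
pose law (X : M -> M) (p : F -> F) := forall s m, wtv s m -> X m = p s *: m.
have induct (X : M -> M) (p : F -> F) : X 0 = 0 ->
    (forall l x, X (low l.+1 x) = p (s0 - l.+1%:R) *: low l.+1 x) ->
    (forall s m, wtv s m -> X (T m) = p (s - 1) *: T m -> T (X m) = p s *: T m) ->
    law X p.
  move=> X0 Xlow XT s m wm; have [->|/eqP m0] := eqVneq m 0; first by rewrite X0 scaler0.
  have [N [l [x [sE mE]]]] := wtv_reach simpM wm m0.
  elim: N s m wm m0 sE mE => [|N IH] s m wm m0 sE mE.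
    by move: mE; rewrite /= sE addr0 => ->.
  apply/eqP; rewrite -subr_eq0; apply/eqP/T_inj; rewrite lactDr -scaleNr lactZr.
  rewrite (XT _ _ wm) ?scaleNr ?subrr //; apply: IH.
  - exact: wtv_T.
  - by move/T_inj.
  - by rewrite sE -natr1; ring.
  - by rewrite -mE iterSr.
have law2 : law (fun m => lact (AD F 2) (T m)) (fun s => (s - lam) * (s - 1 + lam)).
  apply: induct.
  - by rewrite !lact0r.
  - move=> l x; have := Pop_low false 2 l x; rewrite -[Pop _ _ _]/(ops false 2 _) op_D2.
    rewrite E2 -raddfD /= scal lowS addn0 addn2 /= => ->; congr (_ *: _).
    by rewrite mm; ring.
  - move=> s m wm H; have := T_gen false 2 (T m); rewrite /= => ->.
    by rewrite H (wtv_T wm) scalerA -scalerDl; congr (_ *: _); ring.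
have law3 : law (fun m => lact (AD F 3) (T (T m)))
    (fun s => (s - lam) * (s - lam - 1) * (s - 2 + 2 * lam)).
  apply: induct.
  - by rewrite !lact0r.
  - move=> l x; have := Pop_low false 3 l x; rewrite -[Pop _ _ _]/(ops false 3 _) op_D3.
    rewrite E2 E3 scale_scalar_mx -!raddfD /= scal !lowS addn0 addn3 /= => ->; congr (_ *: _).
    by rewrite mm; ring.
  - move=> s m wm H; have := T_gen false 3 (T (T m)); rewrite /= => ->.
    rewrite H (law2 _ _ (wtv_T wm)) scalerA -scalerDl.
    by congr (_ *: _); ring.
exists lam; split=> //; apply: induct.
- by rewrite !lact0r.
- move=> l x; have := Pop_low true 1 l x; rewrite -[Pop _ _ _]/(ops true 1 _) op_I1.
  rewrite EI -raddfD /= scal lowS !addn1 /= => ->; congr (_ *: _).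
  by rewrite mm; ring.
- move=> s m wm H; have := T_gen true 1 (T m); rewrite /= => ->.
  by rewrite H cc scale1r -scalerDl; congr (_ *: _); ring.
Qed.
End AModule.
Arguments gen {F}.

(** * Homomorphisms into simple modules *)

Section Iso.
Variables (F : fieldType) (L : lieAlgType F).
Implicit Types M N : lieModule L.

Lemma lieIso_of_inverse M N (f : N -> M) (g : M -> N) : linear f ->
  (forall a x, f (lact a x) = lact a (f x)) -> cancel f g -> cancel g f -> lieIso M N.
Proof.
move=> lf fa fg gf.
have lg : linear g.
  by move=> k x y; apply: (can_inj fg); rewrite lf !gf.
pose G : {linear M -> N} := HB.pack g (GRing.isLinear.Build _ _ _ _ g lg).
exists G; split; first by exists f.
by move=> a m; apply: (can_inj fg); rewrite fa !gf.
Qed.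

Lemma lieIso_sym M N : lieIso M N -> lieIso N M.
Proof.
move=> [f [[g fg gf] fa]].
exact: (@lieIso_of_inverse N M f g (linearP f) fa fg gf).
Qed.

Lemma simple_hom_iso M N (f : N -> M) : simple_module M -> linear f ->
  (forall a x, f (lact a x) = lact a (f x)) -> (forall x, f x = 0 -> x = 0) ->
  (exists x, f x <> 0) -> lieIso M N.
Proof.
move=> [_ simpM] lf fa f0 [x0 fx0].
have surj m : exists x, f x = m.
  have [|S0|ST] := simpM [set m | exists x, f x = m]%classic.
  - split.
    + by exists 0; have := lf (-1) 0 0; rewrite scaler0 addr0 scaleN1r addNr.
    + by move=> k _ _ [x <-] [y <-]; exists (k *: x + y); apply: lf.
    + by move=> a _ [x <-]; exists (lact a x); apply: fa.
  - have : [set m | exists x, f x = m]%classic (f x0) by exists x0.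
    by rewrite S0.
  - have : [set: M]%classic m by [].
    by rewrite -ST.
have [g gf] := choice surj.
apply: (@lieIso_of_inverse M N f g lf fa) => // x.
apply/eqP; rewrite -subr_eq0; apply/eqP/f0.
by rewrite addrC -scaleN1r lf gf scaleN1r addNr.
Qed.
End Iso.

Section HomGenerators.
Variables (F : numClosedFieldType) (N M : lieModule (Alie F)).

(** [D_1, D_i] is a nonzero multiple of D_{i+1} for i at least 2, and every I_j, also I_0, is
    [D_{j-1}, I_1]. *)
Lemma hom_generators (f : N -> M) : linear f ->
  (forall e x, (e < 4)%N -> f (lact (AD F e) x) = lact (AD F e) (f x)) ->
  (forall x, f (lact (AI F 1) x) = lact (AI F 1) (f x)) ->
  forall a x, f (lact a x) = lact a (f x).
Proof.
move=> lf fD fI; pose K a := forall x, f (lact a x) = lact a (f x).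
have fDD x y : f (x + y) = f x + f y by have := lf 1 x y; rewrite !scale1r.
have f0 : f 0 = 0 by apply: (addIr (f 0)); rewrite -fDD !add0r.
have fZ k x : f (k *: x) = k *: f x by have := lf k x 0; rewrite f0 !addr0.
have KL k a b : K a -> K b -> K (k *: a + b).
  by move=> Ka Kb x; rewrite !lact_linearl lf Ka Kb.
have K0 : K 0 by move=> x; rewrite !lact0l f0.
have KB a b : K a -> K b -> K (lieb a b).
  move=> Ka Kb x; rewrite !lact_bracket addrC -scaleN1r lf Ka Kb Kb Ka.
  by rewrite scaleN1r addrC.
have KD e : K (AD F e).
  have [n] := ubnP e; elim: n e => // n IH [|[|[|[|e]]]] en x; try exact: fD.
  have : K (lieb (AD F 2) (AD F e.+3)) by apply: KB; apply: IH; move: en; rewrite ltnS; lia.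
  rewrite lieb_AD -natrB // => /(_ x); rewrite !lactZl fZ => /scalerI; apply.
  by rewrite pnatr_eq0.
have KI j : K (AI F j).
  have : K (lieb (AD F j) (AI F 1)) by apply: KB => // x; apply: fI.
  by rewrite lieb_AD_AI scale1r addn1.
by move=> a; apply: (Alie_ind (K := K)) => // [] [] e; [apply: KI|apply: KD].
Qed.
End HomGenerators.

(** * Homomorphisms from T(nu, lam, c) given by a family of weight vectors *)

Section Family.
Variables (F : numClosedFieldType) (M : lieModule (Alie F)) (c : F).
Hypothesis cc : central_charge M c.
Local Notation T := (lact (AD F 0)).
Hypothesis T_inj : forall m : M, T m = 0 -> m = 0.
Variable lam : F.
Hypothesis law1 : forall s (m : M), wtv s m ->
  lact (AD F 2) (T m) = ((s - lam) * (s - 1 + lam)) *: m.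
Hypothesis law2 : forall s (m : M), wtv s m ->
  lact (AD F 3) (T (T m)) = ((s - lam) * (s - lam - 1) * (s - 2 + 2 * lam)) *: m.
Hypothesis lawI : forall s (m : M), wtv s m -> lact (AI F 1) (T m) = (c * (s - lam)) *: m.

Lemma T_D1 s (m : M) : wtv s m ->
  T (lact (AD F 2) m) = ((s + 1 - lam) * (s + lam)) *: m.
Proof.
move=> wm; rewrite (T_gen false 2) /= (law1 wm) (wm : lact (AD F 1) m = _).
by rewrite scalerA -scalerDl; congr (_ *: _); ring.
Qed.

Lemma T_D2 s (m : M) : wtv s m ->
  T (T (lact (AD F 3) m)) = ((s + 2 - lam) * (s + 1 - lam) * (s + 2 * lam)) *: m.
Proof.
move=> wm; rewrite (T_gen false 3) lactDr lactZr (T_D1 wm) (T_gen false 3) /= (law2 wm).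
by rewrite (law1 wm) !scalerA -!scalerDl; congr (_ *: _); ring.
Qed.

Lemma T_I1 s (m : M) : wtv s m -> T (lact (AI F 1) m) = (c * (s + 1 - lam)) *: m.
Proof.
move=> wm; rewrite (T_gen true 1) /= (lawI wm) cc.
by rewrite scale1r -scalerDl; congr (_ *: _); ring.
Qed.

(** The factor [s + 1 - lam] is the coefficient of D_{-1} on the basis vector of weight s + 1 in a
    tensor module. Applying D_{-1} to I_1 m, D_1 m or D_{-1} D_2 m gives this factor times another
    one; the alternatives say which of the others is invertible. *)
Lemma T_lift s (m : M) : wtv s m ->
  [\/ c != 0, s + lam != 0 | (s + 2 - lam != 0) && (s + 2 * lam != 0)] ->
  exists m', wtv (s + 1) m' /\ T m' = (s + 1 - lam) *: m.
Proof.
move=> wm [c0|s0|/andP[s1 s2]].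
- exists (c^-1 *: lact (AI F 1) m); split.
    by apply/wtvZ; have := wtv_gen true 1 wm.
  by rewrite lactZr (T_I1 wm) scalerA mulKf.
- exists ((s + lam)^-1 *: lact (AD F 2) m); split.
    by apply/wtvZ; have := wtv_gen false 2 wm.
  by rewrite lactZr (T_D1 wm) scalerA mulrCA mulVf // mulr1.
- exists (((s + 2 - lam) * (s + 2 * lam))^-1 *: T (lact (AD F 3) m)); split.
    apply/wtvZ; have := wtv_T (wtv_gen false 3 wm); congr (wtv _ _).
    by rewrite /wt rmorphB /=; ring.
  by rewrite lactZr (T_D2 wm) scalerA; congr (_ *: _); field; rewrite s1 s2.
Qed.

Variables (nu : F) (z : int -> M).
Hypothesis wz : forall l, wtv (nu + l%:~R) (z l).
Hypothesis Tz : forall l, T (z l) = (nu + l%:~R - lam) *: z (l - 1).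

(** Only the action of D_{-1} on the family is prescribed. That of D_1, D_2 and I_1 is forced, since
    the laws determine its image under a power of the injective D_{-1}. *)
Lemma family_hom (a : Alie F) (x : {freeg int / F}) :
  fglift z (T_act nu lam c a x) = lact a (fglift z x).
Proof.
have lz := fglift_linear z.
have lz0 : fglift z 0 = 0 by have := lz (-1) 0 0; rewrite scaler0 addr0 scaleN1r addNr.
have gZ k l : fglift z (k *: << l >>) = k *: z l.
  by have := lz k << l >> 0; rewrite lz0 !addr0 fglift1.
have Tz1 l : T (z (l + 1)) = (nu + l%:~R + 1 - lam) *: z l.
  by rewrite Tz addrK rmorphD /= addrA.
have z2 l : lact (AD F 2) (z l) = (nu + l%:~R + lam) *: z (l + 1).
  apply/eqP; rewrite -subr_eq0; apply/eqP/T_inj; rewrite lactDr lactNr lactZr Tz1.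
  by rewrite (T_D1 (wz l)) scalerA -scalerBl -[RHS](scale0r (z l)); congr (_ *: _); ring.
have z3 l : lact (AD F 3) (z l) = (nu + l%:~R + 2 * lam) *: z (l + 2).
  apply/eqP; rewrite -subr_eq0; apply/eqP/T_inj/T_inj.
  rewrite lactDr lactNr lactZr lactDr lactNr lactZr (T_D2 (wz l)).
  rewrite (_ : l + 2 = l + 1 + 1); last by lia.
  rewrite Tz1 lactZr Tz1 !scalerA -scalerBl -[RHS](scale0r (z l)); congr (_ *: _).
  by rewrite rmorphD /=; ring.
have zI l : lact (AI F 1) (z l) = c *: z (l + 1).
  apply/eqP; rewrite -subr_eq0; apply/eqP/T_inj; rewrite lactDr lactNr lactZr Tz1.
  by rewrite (T_I1 (wz l)) scalerA -scalerBl -[RHS](scale0r (z l)); congr (_ *: _); ring.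
pose N := T_module nu lam c.
apply: (@hom_generators F N M (fglift z)) => //.
- move=> e {}x e4; move: x; apply: freeg_linext.
  + by move=> k x y; rewrite lact_linearr lz.
  + by move=> k x y; rewrite lz lact_linearr.
  move=> l; rewrite /= T_act_D gZ fglift1; case: e e4 => [|[|[|[|//]]]] _.
  + by rewrite Tz; congr (_ *: z _); [ring|lia].
  + by rewrite wz; congr (_ *: z _); [ring|lia].
  + by rewrite z2; congr (_ *: z _); [ring|lia].
  + by rewrite z3; congr (_ *: z _); [ring|lia].
- apply: freeg_linext.
  + by move=> k x' y; rewrite lact_linearr lz.
  + by move=> k x' y; rewrite lz lact_linearr.
  by move=> l; rewrite /= T_act_I gZ fglift1 zI.
Qed.

Lemma family_kernel (x : {freeg int / F}) : fglift z x = 0 ->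
  forall l, z l <> 0 -> coeff l x = 0.
Proof.
rewrite fgliftE => sum0 l zl.
have [lx|lx] := boolP (l \in dom x); last exact: coeff_outdom.
have inj : {in dom x &, injective (fun l : int => nu + l%:~R)}.
  by move=> i j _ _ /addrI/eqP; rewrite eqr_int => /eqP.
have wts i : wtv (nu + i%:~R) (coeff i x *: z i) by apply: wtvZ.
have /eqP := wtv_indep (uniq_dom x) inj wts sum0 lx.
by rewrite scaler_eq0 => /orP[/eqP|/eqP].
Qed.

End Family.

(** * Identification with T(nu, lam, c) or L(lam - 1, c, -) *)

Section SimpleNonlocal.
Variables (F : numClosedFieldType) (M : lieModule (Alie F)) (c : F).
Hypothesis cc : central_charge M c.
Hypothesis simpM : simple_module M.
Local Notation T := (lact (AD F 0)).
Hypothesis T_inj : forall m : M, T m = 0 -> m = 0.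
Variable lam : F.
Hypothesis lam1 : c = 0 -> lam != 1.
Hypothesis law1 : forall s (m : M), wtv s m ->
  lact (AD F 2) (T m) = ((s - lam) * (s - 1 + lam)) *: m.
Hypothesis law2 : forall s (m : M), wtv s m ->
  lact (AD F 3) (T (T m)) = ((s - lam) * (s - lam - 1) * (s - 2 + 2 * lam)) *: m.
Hypothesis lawI : forall s (m : M), wtv s m -> lact (AI F 1) (T m) = (c * (s - lam)) *: m.

Lemma T_lift_dense nu (v : M) (k : nat) : ~ is_integer (lam - nu) -> wtv (nu + k%:R) v ->
  exists v', wtv (nu + k.+1%:R) v' /\ T v' = (nu + k.+1%:R - lam) *: v.
Proof.
move=> nonint wv; have [|v' [wv' Tv']] := T_lift cc law1 law2 lawI wv.
  have [c0|c0] := eqVneq c 0; last by constructor 1.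
  have [s0|s0] := eqVneq (nu + k%:R + lam) 0; last by constructor 2.
  constructor 3; apply/andP; split.
    apply/negP => /eqP E; apply: nonint; exists (k.+2%:Z).
    rewrite -pmulrn -addn2 natrD; apply/eqP; rewrite -subr_eq0; apply/eqP.
    by rewrite -[RHS]oppr0 -E; ring.
  (* If s + lam and s + 2 lam both vanish, then lam = 0 and nu = - k, so lam - nu would be an
     integer. *)
  apply/negP => /eqP E; have l0 : lam = 0 by rewrite -[RHS]E -[LHS]add0r -s0; ring.
  apply: nonint; exists (k%:Z); rewrite -pmulrn l0.
  by rewrite l0 addr0 in s0; rewrite -s0; ring.
by exists v'; rewrite -natr1 addrA.
Qed.

Lemma dense_family nu (v : M) : ~ is_integer (lam - nu) -> wtv nu v -> v <> 0 ->
  exists z : int -> M, [/\ forall l, wtv (nu + l%:~R) (z l),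
    forall l, T (z l) = (nu + l%:~R - lam) *: z (l - 1) & forall l, z l <> 0].
Proof.
move=> nonint wv v0.
have nz (l : int) : nu + l%:~R - lam != 0.
  apply/negP => /eqP E; apply: nonint; exists l.
  by apply/eqP; rewrite -subr_eq0; apply/eqP; rewrite -[RHS]oppr0 -E; ring.
have [up upP] : exists up : nat * M -> M, forall p, wtv (nu + p.1%:R) p.2 ->
    wtv (nu + p.1.+1%:R) (up p) /\ T (up p) = (nu + p.1.+1%:R - lam) *: p.2.
  have H (p : nat * M) : exists y, wtv (nu + p.1%:R) p.2 ->
      wtv (nu + p.1.+1%:R) y /\ T y = (nu + p.1.+1%:R - lam) *: p.2.
    have [wp|wp] := pselect (wtv (nu + p.1%:R) p.2); last by exists 0.
    by have [y yP] := T_lift_dense nonint wp; exists y.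
  by have [up upP] := choice H; exists up.
pose zp := fix zp (k : nat) := if k is k'.+1 then up (k', zp k') else v.
pose zd := fix zd (k : nat) :=
  if k is k'.+1 then (nu - k'%:R - lam)^-1 *: T (zd k') else v.
have wzp k : wtv (nu + k%:R) (zp k).
  by elim: k => [|k IH]; [rewrite addr0|have [] := upP (k, zp k) IH].
have Tzp k : T (zp k.+1) = (nu + k.+1%:R - lam) *: zp k.
  by have [] := upP (k, zp k) (wzp k).
have wzd k : wtv (nu - k%:R) (zd k).
  elim: k => [|k IH]; first by rewrite subr0.
  by apply/wtvZ; rewrite -natr1 opprD addrA; apply: wtv_T.
have nzd (k : nat) : nu - k%:R - lam != 0.
  by have := nz (- k%:Z); rewrite rmorphN /= -pmulrn.
have Tzd k : T (zd k) = (nu - k%:R - lam) *: zd k.+1.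
  by rewrite /= scalerA mulfV // scale1r.
have zp0 k : zp k <> 0.
  elim: k => // k IH E; have := Tzp k; rewrite E lact0r => /esym/eqP.
  by rewrite scaler_eq0 pmulrn (negPf (nz _)) => /eqP.
have zd0 k : zd k <> 0.
  elim: k => // k IH E; have := Tzd k; rewrite E scaler0 => /T_inj; exact: IH.
exists (fun l => match l with Posz k => zp k | Negz k => zd k.+1 end); split.
- by case=> k; [exact: wzp|rewrite NegzE rmorphN /= -pmulrn; exact: wzd].
- case=> [[|k]|k].
  + by rewrite (_ : 0%Z - 1 = Negz 0) // (Tzd 0%N) subr0 addr0.
  + by rewrite Tzp (_ : k.+1%:Z - 1 = k%:Z); last by lia.
  + by rewrite (_ : Negz k - 1 = Negz k.+1) ?Tzd // !NegzE; lia.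
- by case.
Qed.

Lemma iso_dense nu (v : M) : ~ is_integer (lam - nu) -> wtv nu v -> v <> 0 ->
  lieIso M (T_module nu lam c).
Proof.
move=> nonint wv v0; have [z [wz Tz z0]] := dense_family nonint wv v0.
apply: (@simple_hom_iso _ _ M (T_module nu lam c) (fglift z)) => //.
- exact: fglift_linear.
- exact: (family_hom cc T_inj law1 law2 lawI wz Tz).
- move=> x gx; apply/eqP/freeg_eqP => l; rewrite coeff0.
  exact: (family_kernel wz gx (z0 l)).
- by exists << 0 >>; rewrite fglift1; apply: z0.
Qed.

Lemma T_lift_minus (v : M) (k : nat) : wtv (lam - 1 - k.+1%:R) v ->
  exists v', wtv (lam - 1 - k%:R) v' /\ T v' = (- k.+1%:R) *: v.
Proof.
move=> wv; have [|v' [wv' Tv']] := T_lift cc law1 law2 lawI wv.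
  have [c0|c0] := eqVneq c 0; last by constructor 1.
  have [s0|s0] := eqVneq (lam - 1 - k.+1%:R + lam) 0; last by constructor 2.
  constructor 3; apply/andP; split.
    (* At k = 0 the lift through D_2 is never available and the one through D_1 fails only for lam =
       1, which is why that value was excluded when c = 0. *)
    case: k wv s0 => [|k] wv s0.
      have l1 := lam1 c0; apply: contraNneq l1 => _.
      rewrite -subr_eq0 -(mulrI_eq0 (lam - 1) (x := 2)); last first.
        by apply/lregP; rewrite pnatr_eq0.
      by apply/eqP; rewrite -[RHS]s0; ring.
    have -> : lam - 1 - k.+2%:R + 2 - lam = - k.+1%:R by rewrite -[k.+2%:R]natr1; ring.
    by rewrite oppr_eq0 pnatr_eq0.
  have -> : lam - 1 - k.+1%:R + 2 * lam = lam by rewrite -[RHS]add0r -s0; ring.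
  apply/negP => /eqP l0; move: s0; rewrite l0 => /eqP.
  have -> : 0 - 1 - k.+1%:R + 0 = - k.+2%:R :> F by rewrite -[k.+2%:R]natr1; ring.
  by rewrite oppr_eq0 pnatr_eq0.
exists v'; split; first by move: wv'; congr (wtv _ _); rewrite -natr1; ring.
by rewrite Tv'; congr (_ *: _); ring.
Qed.

(** The weight lam - 1 is the top of T(lam, lam, c, -). It is reached from above by D_{-1}, and from
    below by lifts, whose coefficients - (k + 1) are nonzero. *)
Lemma top_vector nu (v : M) : is_integer (lam - nu) -> wtv nu v -> v <> 0 ->
  exists u : M, wtv (lam - 1) u /\ u <> 0.
Proof.
move=> [n nE] wv v0.
have up k : forall u : M, wtv (lam - 1 - k%:R) u -> u <> 0 -> exists u' : M, wtv (lam - 1) u' /\ u' <> 0.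
  elim: k => [|k IH] u wu u0; first by exists u; rewrite subr0 in wu.
  have [u' [wu' Tu']] := T_lift_minus wu; apply: (IH u') => // u'0.
  move/eqP: Tu'; rewrite u'0 lact0r eq_sym scaler_eq0 oppr_eq0 pnatr_eq0 => /eqP.
  exact: u0.
have down k : wtv (nu - k%:R) (iter k T v) /\ iter k T v <> 0.
  elim: k => [|k [IH1 IH2]]; first by rewrite subr0.
  by split; [rewrite -natr1 opprD addrA; apply: wtv_T|move/T_inj].
have [n1|n1] : (exists k : nat, n = k.+1%:Z) \/ exists k : nat, n = 1 - k%:Z.
    case: n {nE} => [[|k]|k]; [right|left|right].
    - by exists 1%N.
    - by exists k.
    - by exists k.+2; rewrite NegzE; lia.
- have [k kE] := n1; apply: (up k v) => //; move: wv; congr (wtv _ _).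
  have -> : nu = lam - n%:~R by rewrite -nE; ring.
  by rewrite kE -pmulrn -natr1; ring.
- have [k kE] := n1; exists (iter k T v); have [wk k0] := down k; split=> //.
  move: wk; congr (wtv _ _); have -> : nu = lam - n%:~R by rewrite -nE; ring.
  by rewrite kE rmorphB /= -pmulrn; ring.
Qed.

Lemma iso_minus nu (v : M) : is_integer (lam - nu) -> wtv nu v -> v <> 0 ->
  lieIso M (T_minus lam c).
Proof.
move=> intl wv v0; have [u [wu u0]] := top_vector intl wv v0.
pose zm := fix zm (k : nat) := if k is k'.+1 then (- k'.+1%:R)^-1 *: T (zm k') else u.
have wzm k : wtv (lam - k.+1%:R) (zm k).
  elim: k => // k IH; apply/wtvZ; have := wtv_T IH; congr (wtv _ _).
  by rewrite -[k.+2%:R]natr1; ring.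
have Tzm k : T (zm k) = (- k.+1%:R) *: zm k.+1.
  by rewrite /= scalerA mulfV ?scale1r // oppr_eq0 pnatr_eq0.
have zm0 k : zm k <> 0.
  by elim: k => // k IH E; have := Tzm k; rewrite E scaler0 => /T_inj.
(* Extending by 0 is compatible with D_{-1} because its coefficient at l = 0 vanishes; the resulting
   map kills T(lam, lam, c, +) and descends to the quotient. *)
pose z (l : int) := match l with Posz _ => 0 | Negz k => zm k end.
have wz l : wtv (lam + l%:~R) (z l).
  by case: l => k /=; [exact: wtv0|rewrite NegzE rmorphN /= -pmulrn].
have Tz l : T (z l) = (lam + l%:~R - lam) *: z (l - 1).
  case: l => [[|k]|k].
  - by rewrite /= lact0r addr0 subrr scale0r.
  - by rewrite (_ : k.+1%:Z - 1 = k%:Z) /= ?lact0r ?scaler0 //; lia.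
  - rewrite [z _]/= Tzm (_ : Negz k - 1 = Negz k.+1); last by rewrite !NegzE; lia.
    by congr (_ *: _); rewrite NegzE rmorphN /= -pmulrn; ring.
have gh := family_hom cc T_inj law1 law2 lawI wz Tz.
have lz := fglift_linear z.
have gplus x : T_plus_set (lambda := lam) (c := c) x -> fglift z x = 0.
  move=> [s ->]; rewrite linear_sumZ // big1 // => p _.
  by rewrite fglift1 scaler0.
have gB (x y : {freeg int / F}) : fglift z (x - y) = fglift z x - fglift z y.
  by have E := lz (-1) y x; rewrite !scaleN1r in E; rewrite [x - y]addrC E addrC.
pose f (q : T_minus lam c) := fglift z (repr q).
have fE (x : T_module lam lam c) : f (to_quot (T_plus_sub lam c) x) = fglift z x.
  apply/eqP; rewrite -subr_eq0 -gB; apply/eqP/gplus.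
  exact: (repr_to_quot (T_plus_sub lam c) x).
apply: (@simple_hom_iso _ _ M (T_minus lam c) f) => //.
- move=> k x y; rewrite -[x]to_quot_repr -[y]to_quot_repr -to_quot_linear !fE.
  exact: lz.
- move=> a x; rewrite -[x]to_quot_repr fE /= quot_actE fE; exact: gh.
- move=> x; rewrite -[x]to_quot_repr fE => gx.
  have q0 : to_quot (T_plus_sub lam c) 0 = 0.
    by have := to_quotB (T_plus_sub lam c) 0 0; rewrite !subrr.
  rewrite -[RHS]q0; apply/(to_quotP (T_plus_sub lam c)); rewrite subr0.
  set y := repr x in gx *.
  have cy k : coeff (Negz k) y = 0 by apply: (family_kernel wz gx); apply: zm0.
  exists [seq (coeff l y, `|l|%N) | l <- dom y]; rewrite big_map {1}(freeg_sumZ y).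
  apply: eq_big_seq => l ly /=; case: l ly => k ly //.
  by rewrite mem_dom cy eqxx in ly.
- exists (to_quot (T_plus_sub lam c) << Negz 0 >>); rewrite fE fglift1; exact: (zm0 0%N).
Qed.

End SimpleNonlocal.

Lemma T_plus_coeff (F : fieldType) (lam c : F) (x : {freeg int / F}) k :
  @T_plus_set F lam c x -> coeff (Negz k) x = 0.
Proof.
move=> [s ->]; elim: s => [|p s IH]; first by rewrite big_nil coeff0.
by rewrite big_cons coeffD IH coeffZ coeffU /= !mulr0 addr0.
Qed.

(** * Modules with a vector killed by D_{-1} *)

Section LowestWeight.
Variables (F : numClosedFieldType) (M : lieModule (Alie F)) (c : F).
Hypothesis cc : central_charge M c.
Hypothesis simpM : simple_module M.
Local Notation T := (lact (AD F 0)).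

(** The weight k part of what the D_i and I_i with i > 0 generate from [v]; the index
    [j.+1 + ~~ kap] makes the weight j + 1 for both kinds. *)
Inductive raised (v : M) : nat -> M -> Prop :=
| raised_start : raised v 0 v
| raised_zero k : raised v k 0
| raised_lin k a x y : raised v k x -> raised v k y -> raised v k (a *: x + y)
| raised_gen kap j k m : raised v k m ->
    raised v (k + j.+1) (lact (gen kap (j.+1 + ~~ kap)) m).

Lemma raised_wtv v lam k m : wtv lam v -> raised v k m -> wtv (lam + k%:R) m.
Proof.
move=> wv; elim=> {k m} [|k|k a x y _ wx _ wy|kap j k m _ wm].
- by rewrite addr0.
- exact: wtv0.
- exact: wtvD.
- have := wtv_gen kap (j.+1 + ~~ kap) wm; congr (wtv _ _).
  by rewrite /wt PoszD addrK -pmulrn natrD addrA.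
Qed.

Lemma raised_T v lam k m : wtv lam v -> T v = 0 -> raised v k m ->
  if k is k'.+1 then raised v k' (T m) else T m = 0.
Proof.
move=> wv Tv; elim=> {k m} [|k|k a x y _ wx _ wy|kap j k m rm IH] //.
- by rewrite lact0r; case: k => // k; apply: raised_zero.
- rewrite lact_linearr; case: k wx wy => [->->|k wx wy]; first by rewrite scaler0 addr0.
  exact: raised_lin.
- rewrite addnS T_gen addSn /= addrC; apply: raised_lin.
    (* Bracketing an operator of weight 1 with D_{-1} gives a multiple of D_0 or I_0, which are
       scalar on a weight vector. *)
    case: j => [|j]; last by rewrite ?addSn; apply: raised_gen.
    rewrite add0n addn0; have wm := raised_wtv wv rm.
    case: kap => /=; first by rewrite cc -[_ *: _]addr0; apply: raised_lin => //; apply: raised_zero.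
    by rewrite wm -[_ *: _]addr0; apply: raised_lin => //; apply: raised_zero.
  case: k IH rm => [->|k IH] _; first by rewrite lact0r; apply: raised_zero.
  by rewrite addSnnS -addSn; apply: raised_gen.
Qed.

(** Since D_{-1} preserves the span of the raised vectors and D_0, I_0 are scalar on each part, this
    span is already a submodule. *)
Lemma raised_all v lam : wtv lam v -> T v = 0 -> v <> 0 -> forall m, exists n (u : nat -> M),
  (forall k, raised v k (u k)) /\ m = \sum_(k < n) u k.
Proof.
move=> wv Tv v0; pose S m := exists n (u : nat -> M),
  (forall k, raised v k (u k)) /\ m = \sum_(k < n) u k.
have S1 k m : raised v k m -> S m.
  move=> rm; exists k.+1, (fun l => if l == k then m else 0); split.
    by move=> l; case: eqP => [->//|_]; apply: raised_zero.
  rewrite big_ord_recr /= eqxx big1 ?add0r // => i _.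
  by rewrite ltn_eqF.
have SL a x y : S x -> S y -> S (a *: x + y).
  move=> [n [u [ru ->]]] [p [w [rw ->]]].
  pose cut q (z : nat -> M) l := if (l < q)%N then z l else 0.
  have E (z : nat -> M) q r : (q <= r)%N -> \sum_(l < q) z l = \sum_(l < r) cut q z l.
    by move=> qr; rewrite (big_ord_widen r) // big_mkcond.
  exists (maxn n p), (fun l => a *: cut n u l + cut p w l); split.
    by move=> l; rewrite /cut; apply: raised_lin; case: ifP => // _; apply: raised_zero.
  by rewrite (E u n _ (leq_maxl n p)) (E w p _ (leq_maxr n p)) scaler_sumr -big_split.
have S0 : S 0 by apply: (S1 0%N); apply: raised_zero.
have Sgen kap e k m : raised v k m -> S (lact (gen kap e) m).
  move=> rm; have wm := raised_wtv wv rm; case: kap e => [] [|e].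
  - by rewrite /= cc -[_ *: _]addr0; apply: SL => //; apply: S1 rm.
  - by have := raised_gen true e rm; rewrite addn0; apply: S1.
  - by have := raised_T wv Tv rm; case: k {rm wm} => [/= ->//|k]; apply: S1.
  - case: e => [|e]; last by have := raised_gen false e rm; rewrite addn1; apply: S1.
    by rewrite /= wm -[_ *: _]addr0; apply: SL => //; apply: S1 rm.
have subS : is_submodule S.
  split=> // a x [n [u [ru ->]]]; rewrite lact_sumr.
  apply: big_ind => // [y z Sy Sz|k _]; first by rewrite -[y]scale1r; apply: SL.
  apply: (Alie_ind (K := fun a => S (lact a (u k)))) => [b p q Sp Sq||kap e].
  - by rewrite lact_linearl; apply: SL.
  - by rewrite lact0l.
  - exact: Sgen (ru k).
move=> m; have [S_0|ST] := simpM.2 _ subS; last first.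
  by have : [set: M]%classic m by []; rewrite -ST.
have : S v by apply: S1; apply: raised_start.
by rewrite S_0.
Qed.

Variables (v : M) (lam : F).
Hypothesis (wv : wtv lam v) (Tv : T v = 0) (v0 : v <> 0).

(** Otherwise [m] would itself be a lowest vector generating M, and M would have no weight as low as
    that of [v]. *)
Lemma T_inj_above k (m : M) : wtv (lam + k.+1%:R) m -> T m = 0 -> m = 0.
Proof.
move=> wm Tm; apply: contrapT => m0.
have [n [u [ru vE]]] := raised_all wm Tm m0 v.
pose y (j : nat) := if j is j'.+1 then - u j' else v.
pose ev (j : nat) : F := if j is j'.+1 then lam + (k.+1 + j')%:R else lam.
apply: v0; apply: (wtv_indep (ev := ev) (r := iota 0 n.+1) (u := y) _ _ _ _ (i := 0%N)) => //.
- exact: iota_uniq.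
- move=> [|i] [|j] _ _ //=.
  + by rewrite -[LHS]addr0 => /addrI/eqP; rewrite eq_sym pnatr_eq0.
  + by rewrite -[RHS]addr0 => /addrI/eqP; rewrite pnatr_eq0.
  + by move=> /addrI/eqP; rewrite eqr_nat eqn_add2l => /eqP->.
- case=> [|j] //=; rewrite -scaleN1r; apply: wtvZ.
  by have := raised_wtv wm (ru j); rewrite natrD addrA.
- have -> : iota 0 n.+1 = index_iota 0 n.+1 by rewrite /index_iota subn0.
  by rewrite big_nat_recl // big_mkord /= sumrN -vE subrr.
Qed.

Lemma T_inj2 k (x y : M) : wtv (lam + k.+1%:R) x -> wtv (lam + k.+1%:R) y -> T x = T y -> x = y.
Proof.
move=> wx wy Txy; apply/eqP; rewrite -subr_eq0; apply/eqP; apply: (@T_inj_above k).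
  by rewrite [x - y]addrC -scaleN1r; apply: wtvD.
by rewrite lactDr lactNr Txy subrr.
Qed.

Lemma lowest_trivial : c = 0 -> lam = 0 -> lieIso M (triv_module (Alie F)).
Proof.
move=> c0 l0.
have gv kap e : lact (gen kap e) v = 0.
  case: kap; elim: e => [|e IH] //.
  - by rewrite /= cc c0 scale0r.
  - apply: (@T_inj_above e); last by rewrite (T_gen true e.+1) Tv lact0r add0r IH scaler0.
    by have := wtv_gen true e.+1 wv; rewrite /wt subr0 -pmulrn.
  - case: e IH => [|e] IH; first by rewrite /= wv l0 scale0r.
    apply: (@T_inj_above e); last by rewrite (T_gen false e.+2) Tv lact0r add0r IH scaler0.
    by have := wtv_gen false e.+2 wv; congr (wtv (_ + _) _).
have av a : lact a v = 0.
  apply: (Alie_ind (K := fun a => lact a v = 0)) => // [k x y xv yv|].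
    by rewrite lact_linearl xv yv scaler0 addr0.
  exact: lact0l.
apply: (@simple_hom_iso _ _ M (triv_module (Alie F)) (fun k : F^o => k *: v)) => //.
- by move=> k x y; rewrite scalerDl scalerA.
- by move=> a x; rewrite /= /triv_act scale0r lactZr av scaler0.
- by move=> x /eqP; rewrite scaler_eq0 => /orP[/eqP//|/eqP].
- by exists 1; rewrite scale1r.
Qed.

(** The brackets of D_{-1} with I_k and with D_k have coefficients k and k + 1, so rescaled
    multiples of I_k v, or of D_k v, obey the rule of the basis of L(lam, c, +). The starting
    scalars are I_0 = c and D_0 = lam. *)
Lemma lowest_family : c != 0 \/ lam != 0 -> exists z : nat -> M, [/\ z 0%N <> 0,
  forall k, wtv (lam + k%:R) (z k) & forall k, T (z k) = k%:R *: z k.-1].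
Proof.
case=> [c0|l0].
  exists (fun k => c^-1 *: lact (AI F k) v); split.
  - by rewrite cc scalerA mulVf // scale1r.
  - by move=> k; apply: wtvZ; have := wtv_gen true k wv; rewrite /wt subr0 -pmulrn.
  - by move=> k; rewrite lactZr (T_gen true k) Tv lact0r add0r scalerA mulrC -scalerA.
exists (fun k => (k.+1%:R * lam)^-1 *: lact (AD F k.+1) v); split.
- by rewrite wv mul1r scalerA mulVf // scale1r.
- move=> k; apply: wtvZ; have := wtv_gen false k.+1 wv; congr (wtv _ _).
  by rewrite /wt rmorphB /= -!pmulrn -natr1; ring.
- move=> k; rewrite lactZr (T_gen false k.+1) Tv lact0r add0r.
  case: k => [|k]; first by rewrite /= Tv !scaler0 scale0r.
  rewrite scalerA [RHS]scalerA /=; congr (_ *: _).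
  have k1 : k.+1%:R != 0 :> F by rewrite pnatr_eq0.
  have k2 : k.+2%:R != 0 :> F by rewrite pnatr_eq0.
  by rewrite !invfM mulrAC mulVf // mulrA mulfV.
Qed.

(** No trace argument is needed: D_{-1} is injective above the lowest weight, so the action of D_1,
    D_2 and I_1 on the family follows by induction on k. *)
Lemma iso_plus : c != 0 \/ lam != 0 -> lieIso M (L_plus lam c).
Proof.
move=> /lowest_family[z [z00 wz Tz]].
have z0 k : z k <> 0.
  elim: k => // k IH E; have := Tz k.+1; rewrite E lact0r => /esym/eqP.
  by rewrite scaler_eq0 pnatr_eq0 => /eqP.
have wgen kap e j k l : (k + e = l + j)%N -> (j = ~~ kap) -> wtv (lam + l%:R) (lact (gen kap e) (z k)).
  move=> kel jE; have := wtv_gen kap e (wz k); congr (wtv _ _).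
  rewrite /wt rmorphB /= -!pmulrn -jE -addrA; congr (_ + _).
  by rewrite addrA -natrD kel natrD addrK.
have zD1 k : lact (AD F 2) (z k) = (k%:R + 2 * lam) *: z k.+1.
  elim: k => [|k IH].
    apply: (@T_inj2 0); first by apply: (wgen false 2 1).
      exact: wtvZ.
    rewrite (T_gen false 2) (Tz 0%N) scale0r lact0r add0r lactZr Tz /= wz !scalerA.
    by congr (_ *: _); ring.
  apply: (@T_inj2 k.+1); first by apply: (wgen false 2%N 1%N); lia.
    exact: wtvZ.
  rewrite (T_gen false 2) (Tz k.+1) lactZr IH [in RHS]lactZr Tz /= wz !scalerA -scalerDl.
  by congr (_ *: _); rewrite -[k.+2%:R]natr1 -natr1; ring.
have zD2 k : lact (AD F 3) (z k) = (k%:R + 3 * lam) *: z k.+2.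
  elim: k => [|k IH].
    apply: (@T_inj2 1); first by apply: (wgen false 3 1).
      exact: wtvZ.
    rewrite (T_gen false 3) (Tz 0%N) scale0r lact0r add0r lactZr Tz /= zD1 !scalerA.
    by congr (_ *: _); ring.
  apply: (@T_inj2 k.+2); first by apply: (wgen false 3%N 1%N); lia.
    exact: wtvZ.
  rewrite (T_gen false 3) (Tz k.+1) lactZr IH [in RHS]lactZr Tz /= zD1 !scalerA -scalerDl.
  by congr (_ *: _); rewrite -[k.+3%:R]natr1 -[k.+2%:R]natr1 -natr1; ring.
have zI k : lact (AI F 1) (z k) = c *: z k.+1.
  elim: k => [|k IH].
    apply: (@T_inj2 0); first by apply: (wgen true 1 0).
      exact: wtvZ.
    rewrite (T_gen true 1) (Tz 0%N) scale0r lact0r add0r lactZr Tz /= cc !scalerA.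
    by congr (_ *: _); ring.
  apply: (@T_inj2 k.+1); first by apply: (wgen true 1%N 0%N); lia.
    exact: wtvZ.
  rewrite (T_gen true 1) (Tz k.+1) lactZr IH [in RHS]lactZr Tz /= cc !scalerA -scalerDl.
  by congr (_ *: _); rewrite -[k.+2%:R]natr1 -natr1; ring.
pose zz (l : int) : M := if l is Posz k then z k else 0.
have lz := fglift_linear zz.
have lz0 : fglift zz 0 = 0 by have := lz (-1) 0 0; rewrite scaler0 addr0 scaleN1r addNr.
have gZ k l : fglift zz (k *: << l >>) = k *: zz l.
  by have := lz k << l >> 0; rewrite lz0 !addr0 fglift1.
pose f (x : L_plus lam c) := fglift zz (val x).
have span (x : L_plus lam c) : exists s : seq (F * nat), val x = \sum_(p <- s) p.1 *: << p.2%:Z >>.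
  by have /asboolP := valP x.
have wzz l : wtv (lam + l%:~R) (zz l) by case: l => [k|k] /=; [exact: wz|exact: wtv0].
have hom1 a : (forall k : nat, fglift zz (T_act lam lam c a << k%:Z >>) = lact a (z k)) ->
    forall x, f (lact a x) = lact a (f x).
  move=> H x; rewrite /f /=; have [s ->] := span x.
  rewrite (linear_sumZ _ _ _ (T_act_linearr lam lam c a)) !(linear_sumZ _ _ _ lz).
  rewrite lact_sumr; apply: eq_bigr => p _; rewrite H fglift1.
  by rewrite lactZr.
apply: (@simple_hom_iso _ _ M (L_plus lam c) f) => //.
- by move=> k x y; rewrite /f linearP lz.
- apply: hom_generators; first by move=> k x y; rewrite /f linearP lz.
    move=> e x e4; apply: hom1 => k; rewrite T_act_D gZ; case: e e4 => [|[|[|[|//]]]] _.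
    + rewrite Tz; case: k => [|k].
        by rewrite (_ : 0%Z + 0%Z - 1 = Negz 0) //= scaler0 scale0r.
      rewrite (_ : k.+1%:Z + 0%Z - 1 = k%:Z); last by lia.
      by congr (_ *: _); rewrite -pmulrn; ring.
    + rewrite wz (_ : k%:Z + 1%Z - 1 = k%:Z); last by lia.
      by congr (_ *: _); rewrite -pmulrn; ring.
    + rewrite zD1 (_ : k%:Z + 2%Z - 1 = k.+1%:Z); last by lia.
      by congr (_ *: _); rewrite -pmulrn; ring.
    + rewrite zD2 (_ : k%:Z + 3%Z - 1 = k.+2%:Z); last by lia.
      by congr (_ *: _); rewrite -pmulrn; ring.
  by apply: hom1 => k; rewrite T_act_I gZ zI (_ : k%:Z + 1%Z = k.+1%:Z) //; lia.
- move=> x fx; apply: val_inj; apply/eqP/freeg_eqP => l; rewrite coeff0.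
  case: l => [k|k]; first exact: (family_kernel wzz (fx : fglift zz (val x) = 0) (z0 k : zz (Posz k) <> 0)).
  exact: (@T_plus_coeff F lam c _ k (span x)).
- have S0 : (<< 0 >> : T_module lam lam c) \in smpred (T_plus_sub lam c).
    by apply/asboolP; exists [:: (1, 0%N)]; rewrite big_seq1 scale1r.
  exists (exist (fun m => m \in smpred (T_plus_sub lam c)) _ S0).
  by rewrite /f /= fglift1; apply: z0.
Qed.
End LowestWeight.

(** * Classification of the simple bounded modules *)

Theorem simple_bounded_classification (F : numClosedFieldType) (M : lieModule (Alie F)) (c : F) :
  simple_module M -> bounded_module (Alie_cartan F) M -> central_charge M c ->
  (exists nu lam, ~ is_integer (lam - nu) /\ lieIso M (T_module nu lam c)) \/
  (exists lam, (c = 0 -> lam <> 0) /\ lieIso M (L_plus lam c)) \/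
  (exists lam, (c = 0 -> lam <> 0) /\ lieIso M (L_minus lam c)) \/
  (c = 0 /\ lieIso M (triv_module (Alie F))).
Proof.
move=> simpM bM cc; have [T_inj|] := pselect (forall m : M, lact (AD F 0) m = 0 -> m = 0).
  have [d [s0 [v [iv wv maxv]]]] := maximal_weight cc bM simpM.1.
  have [Q QE] := base_ops T_inj iv wv maxv.
  have [lam [lam1 law1 law2 lawI]] := module_laws cc T_inj iv wv maxv QE simpM.
  have v0 : v ord0 <> 0.
    move=> v0; have := iv (fun i => (i == ord0)%:R) _ ord0; rewrite eqxx => H.
    have /eqP : 1 = 0 :> F.
      apply: H; rewrite (bigD1 ord0) //= v0 scaler0 add0r big1 // => i /negPf->.
      by rewrite scale0r.
    by rewrite oner_eq0.
  have [intl|nint] := pselect (is_integer (lam - s0)).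
    (* L(lam - 1, c, -) is T(lam, lam, c, -), so for c = 0 the condition on the parameter is exactly
       lam != 1. *)
    right; right; left; exists (lam - 1); split.
      by move=> c0 /eqP; rewrite subr_eq0 (negPf (lam1 c0)).
    rewrite /L_minus subrK.
    exact: (iso_minus cc simpM T_inj lam1 law1 law2 lawI intl (wv ord0) v0).
  left; exists s0, lam; split=> //.
  exact: (iso_dense cc simpM T_inj lam1 law1 law2 lawI nint (wv ord0) v0).
move=> /existsNP[m /not_implyP[Tm m0]].
have [r [u [ur wu mE]]] := weight_dec bM.1 m.
(* The kernel of D_{-1} is graded: the images of the components have distinct weights and sum to
   0. *)
have Tu i : i \in r -> lact (AD F 0) (u i) = 0.
  apply: (wtv_indep (ev := fun a => a - 1) (u := fun i => lact (AD F 0) (u i)) ur).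
  - by move=> i' j _ _ /addIr.
  - by move=> j; apply: wtv_T.
  - by rewrite -[RHS]Tm mE lact_sumr.
have [lam [lr ul]] : exists lam, lam \in r /\ u lam <> 0.
  apply: contrapT => H; apply: m0; rewrite mE big_seq big1 // => i ir.
  by apply: contrapT => ui; apply: H; exists i.
have [c0|c0] := eqVneq c 0; last first.
  right; left; exists lam; split; first by move=> c0'; rewrite c0' eqxx in c0.
  by apply: (iso_plus cc simpM (wu lam) (Tu lam lr) ul); left.
have [l0|l0] := eqVneq lam 0.
  by right; right; right; split=> //; apply: (lowest_trivial cc simpM (wu lam) (Tu lam lr) ul).
right; left; exists lam; split; first by move=> _; apply/eqP.
by apply: (iso_plus cc simpM (wu lam) (Tu lam lr) ul); right.
Qed.

Lemma lieIso_refl (F : fieldType) (L : lieAlgType F) (M : lieModule L) : lieIso M M.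
Proof. exact: (@lieIso_of_inverse F L M M id id). Qed.

(** * Restriction to W_1 *)

Section Restriction.
Variables (F : numClosedFieldType) (M : lieModule (Alie F)).

Lemma lieIso_res_W1 (N : lieModule (Alie F)) : lieIso M N -> lieIso (res_W1 M) (res_W1 N).
Proof.
move=> [f [bf fa]]; exists (f : {linear res_W1 M -> res_W1 N}); split=> // a m.
exact: fa.
Qed.

Lemma lieIso_res_triv : lieIso M (triv_module (Alie F)) ->
  lieIso (res_W1 M) (triv_module (W1 F)).
Proof.
move=> [f [bf fa]].
exists (f : {linear res_W1 M -> triv_module (W1 F)}); split=> // a m.
exact: fa.
Qed.

Lemma lieIso_act0 (N : lieModule (Alie F)) (a : Alie F) : lieIso M N ->
  (forall x : N, lact a x = 0) -> forall m : M, lact a m = 0.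
Proof.
move=> [f [bf fa]] a0 m; apply: (bij_inj bf).
by rewrite fa a0 linear0.
Qed.

Lemma simple_res_W1 : (forall k (m : M), lact (AI F k) m = 0) ->
  simple_module M -> simple_module (res_W1 M).
Proof.
move=> I0 [nz simpM]; split=> // S [S0 SD SA]; apply: simpM; split=> // a u Su.
suff -> : lact a u = lact (W1_incl a.1) u by apply: SA.
apply: (Alie_ind (K := fun a => lact a u = lact (W1_incl a.1) u)) => //.
- move=> k x y xE yE; rewrite lact_linearl xE yE -lact_linearl; congr lact.
  by rewrite linearP.
- by case=> e //=; rewrite I0 (_ : W1_incl 0 = 0) ?lact0l // linear0.
Qed.

Variable c : F.
Hypothesis cc : central_charge M c.

Lemma W1_weight_spaceE (t : 1.-tuple F) :
  @weight_space _ _ _ (W1_cartan F) (res_W1 M) t =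
  @weight_space _ _ _ (Alie_cartan F) M [tuple thead t; c].
Proof.
apply/seteqP; split => m /= wm i.
  case: i => -[|[|//]] /= i2; last exact: cc.
  exact: (wm ord0).
by rewrite ord1; exact: (wm ord0).
Qed.

Lemma W1_weight_wtv (t : 1.-tuple F) (m : M) :
  weight_space (W1_cartan F) (M := res_W1 M) t m <-> wtv (thead t) m.
Proof.
split; first by move=> /(_ ord0).
by move=> wm i; rewrite ord1.
Qed.

Lemma bounded_res_W1 : bounded_module (Alie_cartan F) M ->
  bounded_module (W1_cartan F) (res_W1 M).
Proof.
move=> [wM [N [N0 dimM]]]; split; last first.
  by exists N; split=> // t; rewrite W1_weight_spaceE; apply: dimM.
split=> [m|s u us wu sum0].
  have [r [u [ur wu mE]]] := weight_dec wM m.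
  exists [seq [tuple a] | a <- r], (fun t => u (thead t)); split.
    by move=> t; apply/W1_weight_wtv; apply: wu.
  by rewrite mE big_map; apply: eq_bigr.
apply: (wtv_indep (M := M) (ev := fun t : 1.-tuple F => thead t) us) => //.
- move=> t t' _ _ tt; apply: eq_from_tnth => i; rewrite ord1; exact: tt.
- by move=> t; apply/W1_weight_wtv; apply: wu.
Qed.
End Restriction.

(** * Isomorphism invariants *)

Section Invariants.
Variable F : numClosedFieldType.
Implicit Types (nu lam c : F).
Implicit Types M N : lieModule (Alie F).

Lemma T_module_charge nu lam c : central_charge (T_module nu lam c) c.
Proof.
apply: freeg_linext => [k x y|k x y|l]; first by rewrite lact_linearr.
  by rewrite scalerDr !scalerA mulrC.
by rewrite /= T_act_I addr0.
Qed.

(* I_1 D_{-1} = c (D_0 - lam), from which lam can be recovered when c != 0. *)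
Definition jet_law M c lam := forall m : M,
  lact (AI F 1) (lact (AD F 0) m) = c *: (lact (AD F 1) m - lam *: m).

Lemma T_module_jet nu lam c : jet_law (T_module nu lam c) c lam.
Proof.
apply: freeg_linext => [||l].
- by move=> k x y; rewrite !lact_linearr.
- move=> k x y; rewrite lact_linearr (scalerDr lam) [lam *: (k *: x)]scalerA.
  rewrite (mulrC lam) -scalerA opprD addrACA -scalerBr scalerDr !scalerA.
  by rewrite (mulrC c).
rewrite /= !T_act_D T_actZ T_act_I.
have -> : l + 0%Z - 1 + 1%Z = l by ring.
have -> : l + 1%Z - 1 = l by ring.
by rewrite -scalerBl !scalerA; congr (_ *: _); ring.
Qed.

Lemma T_module_D0 nu lam c (x : T_module nu lam c) l :
  coeff l (lact (AD F 1) x : {freeg int / F}) = (nu + l%:~R) * coeff l (x : {freeg int / F}).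
Proof.
move: x; apply: (freeg_linext (V := F^o)) => [k x y|k x y|l'].
- by rewrite lact_linearr coeffD coeffZ.
- by rewrite coeffD coeffZ mulrDr mulrCA.
rewrite /= T_act_D coeffZ !coeffU (_ : l' + 1%Z - 1 = l'); last by lia.
by case: eqP => [->|_]; rewrite ?mulr0 // !mulr1; ring.
Qed.

Lemma T_module_I1 nu lam c (x : T_module nu lam c) l :
  coeff (l + 1) (lact (AI F 1) x : {freeg int / F}) = c * coeff l (x : {freeg int / F}).
Proof.
move: x; apply: (freeg_linext (V := F^o)) => [k x y|k x y|l'].
- by rewrite lact_linearr coeffD coeffZ.
- by rewrite coeffD coeffZ mulrDr mulrCA.
by rewrite /= T_act_I coeffZ !coeffU (inj_eq (addIr _)).
Qed.

Lemma T_module_I1_inj nu lam c (x : T_module nu lam c) : c <> 0 ->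
  lact (AI F 1) x = 0 -> x = 0.
Proof.
move=> c0 x0; apply/eqP/freeg_eqP => l; rewrite coeff0.
have := T_module_I1 x l; rewrite x0 coeff0 => /esym/eqP.
by rewrite mulf_eq0 => /orP[/eqP//|/eqP].
Qed.

Lemma sub_charge M (S : submodule M) c : central_charge M c -> central_charge (sub_module S) c.
Proof. by move=> cc m; apply: val_inj; rewrite linearZ /= cc. Qed.

Lemma quot_charge M (S : submodule M) c : central_charge M c -> central_charge (quot_module S) c.
Proof. by move=> cc m; rewrite -[m]to_quot_repr /= quot_actE cc -quot_scaleE. Qed.

Lemma sub_jet M (S : submodule M) c lam : jet_law M c lam -> jet_law (sub_module S) c lam.
Proof. by move=> jM m; apply: val_inj; rewrite linearZ raddfB linearZ /= jM scalerDr. Qed.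

Lemma quot_jet M (S : submodule M) c lam : jet_law M c lam -> jet_law (quot_module S) c lam.
Proof.
move=> jM m; rewrite -[m]to_quot_repr /= !quot_actE jM -quot_scaleE to_quotB.
by rewrite -quot_scaleE.
Qed.

Definition has_invariants M c lam := [/\ exists m : M, m <> 0, central_charge M c & jet_law M c lam].

(** Once the charges agree, the two jet laws at the image of a nonzero vector differ by c (lam' -
    lam) times it. *)
Lemma invariants_eq M N c lam c' lam' : c <> 0 -> has_invariants M c lam ->
  has_invariants N c' lam' -> lieIso M N -> c' = c /\ lam' = lam.
Proof.
move=> c0 [[m m0] cM jM] [_ cN jN] [f [bf fa]].
have fm0 : f m <> 0 by move=> fm; apply: m0; apply: (bij_inj bf); rewrite fm linear0.
have sc k k' : k *: f m = k' *: f m -> k = k'.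
  move=> /eqP; rewrite -subr_eq0 -scalerBl scaler_eq0 subr_eq0.
  by move=> /orP[/eqP//|/eqP].
have cE : c' = c by apply: sc; rewrite -cN -fa cM linearZ.
split=> //; apply: sc; subst c'.
have fE : f (c *: (lact (AD F 1) m - lam *: m)) = c *: (lact (AD F 1) (f m) - lam *: f m).
  have fZ k x : f (k *: x) = k *: f x by rewrite linearZ.
  have fB x y : f (x - y) = f x - f y by rewrite raddfB.
  by rewrite fZ fB fZ fa.
have := congr1 f (jM m); rewrite fE !fa jN.
by move=> /(scalerI (introN eqP c0))/addrI/oppr_inj.
Qed.

Lemma T_module_invariants nu lam c : has_invariants (T_module nu lam c) c lam.
Proof.
split; [|exact: T_module_charge|exact: T_module_jet].
by exists << 0 >> => /eqP/freeg_eqP/(_ 0); rewrite coeffU coeff0 eqxx mulr1 => /eqP; rewrite oner_eq0.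
Qed.

Lemma lowest_vector lam c : exists v : L_plus lam c, v <> 0 /\ lact (AD F 0) v = 0.
Proof.
have S0 : (<< 0 >> : T_module lam lam c) \in smpred (T_plus_sub lam c).
  by apply/asboolP; exists [:: (1, 0%N)]; rewrite big_seq1 scale1r.
exists (exist (fun m => m \in smpred (T_plus_sub lam c)) _ S0); split.
  move=> /(congr1 val)/= /eqP/freeg_eqP/(_ 0).
  by rewrite coeffU coeff0 eqxx mulr1 => /eqP; rewrite oner_eq0.
apply: val_inj; rewrite /= T_act_D.
by rewrite addr0 sub0r mulN1r subrr scale0r.
Qed.

Lemma highest_vector lam c : exists v : T_minus lam c, v <> 0 /\ lact (AI F 1) v = 0.
Proof.
exists (to_quot (T_plus_sub lam c) << Negz 0 >>); split.
  have -> : (0 : T_minus lam c) = to_quot (T_plus_sub lam c) 0.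
    by rewrite -[X in to_quot _ X](subrr 0) to_quotB subrr.
  move=> /(to_quotP (T_plus_sub lam c)); rewrite subr0 => S0; have := @T_plus_coeff F lam c _ 0 S0.
  by rewrite coeffU eqxx mulr1 => /eqP; rewrite oner_eq0.
have -> : (0 : T_minus lam c) = to_quot (T_plus_sub lam c) 0.
  by rewrite -[X in to_quot _ X](subrr 0) to_quotB subrr.
rewrite /= quot_actE; apply/(to_quotP (T_plus_sub lam c)); rewrite subr0 /= T_act_I.
by exists [:: (c, 0%N)]; rewrite big_seq1.
Qed.

Lemma L_plus_invariants lam c : has_invariants (L_plus lam c) c lam.
Proof.
split; last exact/sub_jet/T_module_jet; last exact/sub_charge/T_module_charge.
by have [v [v0 _]] := lowest_vector lam c; exists v.
Qed.

Lemma L_minus_invariants lam c : has_invariants (L_minus lam c) c (lam + 1).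
Proof.
split; last exact/quot_jet/T_module_jet; last exact/quot_charge/T_module_charge.
by have [v [v0 _]] := highest_vector (lam + 1) c; exists v.
Qed.

Lemma T_module_weight nu lam c s (x : T_module nu lam c) : wtv s x -> x <> 0 ->
  is_integer (s - nu).
Proof.
move=> wx x0; apply: contrapT => nint; apply: x0.
apply/eqP/freeg_eqP => l; rewrite coeff0.
have := T_module_D0 x l; rewrite (wx : lact _ _ = _) coeffZ => /eqP.
rewrite -subr_eq0 -mulrBl mulf_eq0 => /orP[/eqP E|/eqP//].
by case: nint; exists l; apply/eqP; rewrite -subr_eq0 -addrA -opprD E.
Qed.

(** By the jet law a vector killed by D_{-1} has weight lam, whereas all weights lie in nu + Z. *)
Lemma T_module_D_inj nu lam c (x : T_module nu lam c) : c <> 0 ->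
  ~ is_integer (lam - nu) -> lact (AD F 0) x = 0 -> x = 0.
Proof.
move=> /eqP c0 nint Dx; apply: contrapT => x0; apply: nint.
apply: (T_module_weight (x := x)) => //.
have := T_module_jet x; rewrite Dx lact0r => /esym/eqP.
by rewrite scaler_eq0 (negPf c0) subr_eq0 => /eqP.
Qed.

Lemma T_module_iso_weight nu lam c nu' lam' c' :
  lieIso (T_module nu lam c) (T_module nu' lam' c') -> exists n : int, nu' = nu + n%:~R.
Proof.
move=> [f [bf fa]]; pose x : T_module nu lam c := << 0 >>.
have [n nE] : is_integer (nu - nu').
  apply: (@T_module_weight nu' lam' c' nu (f x)).
    rewrite /wtv -fa -linearZ; congr (f _); rewrite /= /x T_act_D.
    by congr (_ *: _); ring.
  move=> fx0; have : x = 0 by apply: (bij_inj bf); rewrite fx0 linear0.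
  move=> /eqP/freeg_eqP/(_ 0); rewrite coeffU coeff0 eqxx mulr1 => /eqP.
  by rewrite oner_eq0.
by exists (- n); rewrite rmorphN /= -nE; ring.
Qed.

Lemma T_module_shift nu lam c (n : int) :
  lieIso (T_module nu lam c) (T_module (nu + n%:~R) lam c).
Proof.
pose sh (n : int) := fglift (fun l : int => << l + n >> : {freeg int / F}).
have shl k : linear (sh k) by exact: fglift_linear.
have sh0 k : sh k 0 = 0.
  by have := shl k (-1) 0 0; rewrite scaler0 addr0 scaleN1r addNr.
have shZ k a l : sh k (a *: << l >>) = a *: << l + k >>.
  by have := shl k a << l >> 0; rewrite sh0 !addr0 => ->; rewrite /sh fglift1.
have shK k k' : k' = - k -> cancel (sh k) (sh k').
  move=> ->; apply: freeg_linext => // [a x y|l]; first by rewrite !shl.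
  by rewrite /sh !fglift1 addrK.
apply: (@lieIso_of_inverse F (Alie F) (T_module nu lam c) (T_module (nu + n%:~R) lam c)
  (sh n) (sh (- n))) => //.
- apply: (hom_generators (N := T_module (nu + n%:~R) lam c) (M := T_module nu lam c)) => //.
  + move=> e x _; move: x; apply: freeg_linext => [a x y|a x y|l].
    * by rewrite lact_linearr shl.
    * by rewrite shl lact_linearr.
    rewrite /= T_act_D shZ /sh fglift1 T_act_D.
    by apply: basisZ_congr; [rewrite rmorphD /=; ring|ring].
  + apply: freeg_linext => [a x y|a x y|l].
    * by rewrite lact_linearr shl.
    * by rewrite shl lact_linearr.
    rewrite /= T_act_I shZ /sh fglift1 T_act_I.
    by apply: basisZ_congr; last ring.
- exact: shK.
- by apply: shK; rewrite opprK.
Qed.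
End Invariants.

Lemma T_module_I_act0 (F : numClosedFieldType) (nu lam : F) k (x : T_module nu lam 0) :
  lact (AI F k) x = 0.
Proof.
move: x; apply: freeg_linext => [a x y|a x y|l]; first by rewrite lact_linearr.
  by rewrite scaler0 addr0.
by rewrite /= T_act_I scale0r.
Qed.

Lemma I_act0 (F : numClosedFieldType) (M : lieModule (Alie F)) :
  simple_module M -> bounded_module (Alie_cartan F) M -> central_charge M 0 ->
  forall k (m : M), lact (AI F k) m = 0.
Proof.
move=> simpM bM cc k.
have [[nu [lam [_ /lieIso_act0]]]|[[lam [_ /lieIso_act0]]|[[lam [_ /lieIso_act0]]|[_ /lieIso_act0]]]] :=
  simple_bounded_classification simpM bM cc; apply=> x //.
- exact: T_module_I_act0.
- by apply: val_inj; exact: (@T_module_I_act0 _ lam lam k (val x)).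
- rewrite -[x]to_quot_repr /= quot_actE.
  rewrite [X in to_quot _ X](@T_module_I_act0 _ (lam + 1) (lam + 1) k (repr x)).
  by rewrite -[X in to_quot _ X](subrr 0) to_quotB subrr.
Qed.

Theorem theorem3p3 (R : realType) :
  (forall (M : lieModule (Alie R[i])) (c : R[i]),
     simple_module M -> bounded_module (Alie_cartan R[i]) M -> central_charge M c ->
     (c = 0 ->
        (forall (k : nat) (m : M), lact (AI R[i] k) m = 0) /\
        simple_module (res_W1 M) /\
        bounded_module (W1_cartan R[i]) (res_W1 M) /\
        ((exists nu lambda : R[i],
            ~ is_integer (lambda - nu) /\ lieIso (res_W1 M) (W1_T nu lambda)) \/
         (exists eta : R[i],
            eta <> 0 /\ lieIso (res_W1 M) (W1_L_plus eta)) \/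
         (exists eta : R[i],
            eta <> 0 /\ lieIso (res_W1 M) (W1_L_minus eta)) \/
         lieIso (res_W1 M) (triv_module (W1 R[i])))) /\
     (c <> 0 ->
        (exists nu lambda : R[i],
           ~ is_integer (lambda - nu) /\ lieIso M (T_module nu lambda c)) \/
        (exists lambda : R[i], lieIso M (L_plus lambda c)) \/
        (exists lambda : R[i], lieIso M (L_minus lambda c)))) /\
  (forall c c' : R[i], c <> 0 -> c' <> 0 ->
     (forall nu lambda nu' lambda' : R[i],
        ~ is_integer (lambda - nu) -> ~ is_integer (lambda' - nu') ->
        (lieIso (T_module nu lambda c) (T_module nu' lambda' c') <->
         [/\ c' = c, lambda' = lambda & exists n : int, nu' = nu + n%:~R])) /\
     (forall lambda lambda' : R[i],
        lieIso (L_plus lambda c) (L_plus lambda' c') <->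
        c' = c /\ lambda' = lambda) /\
     (forall lambda lambda' : R[i],
        lieIso (L_minus lambda c) (L_minus lambda' c') <->
        c' = c /\ lambda' = lambda) /\
     (forall nu lambda lambda' : R[i],
        ~ is_integer (lambda - nu) ->
        ~ lieIso (T_module nu lambda c) (L_plus lambda' c') /\
        ~ lieIso (T_module nu lambda c) (L_minus lambda' c')) /\
     (forall lambda lambda' : R[i],
        ~ lieIso (L_plus lambda c) (L_minus lambda' c'))).
Proof.
split=> [M c simpM bM cc|c c' c0 c'0].
  split=> [c0|c0].
    subst c; have I0 := I_act0 simpM bM cc.
    split=> //; split; first exact: simple_res_W1.
    split; first exact: (bounded_res_W1 cc).
    have [[nu [lam [nint iso]]]|[[lam [l0 iso]]|[[lam [l0 iso]]|[_ iso]]]] :=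
      simple_bounded_classification simpM bM cc.
    - by left; exists nu, lam; split=> //; apply: lieIso_res_W1.
    - by right; left; exists lam; split; [exact: l0|exact: lieIso_res_W1].
    - by right; right; left; exists lam; split; [exact: l0|exact: lieIso_res_W1].
    - by right; right; right; apply: lieIso_res_triv.
  have [[nu [lam [nint iso]]]|[[lam [_ iso]]|[[lam [_ iso]]|[]//]]] :=
    simple_bounded_classification simpM bM cc.
  - by left; exists nu, lam.
  - by right; left; exists lam.
  - by right; right; exists lam.
split=> [nu lam nu' lam' _ _|].
  split=> [iso|[-> -> [n ->]]]; last exact: T_module_shift.
  have [-> ->] := invariants_eq c0 (T_module_invariants _ _ _) (T_module_invariants _ _ _) iso.
  by split=> //; apply: T_module_iso_weight iso.
split=> [lam lam'|].
  split=> [iso|[-> ->]]; last exact: lieIso_refl.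
  exact: invariants_eq c0 (L_plus_invariants _ _) (L_plus_invariants _ _) iso.
split=> [lam lam'|].
  split=> [iso|[-> ->]]; last exact: lieIso_refl.
  have [-> /addIr->//] := invariants_eq c0 (L_minus_invariants _ _) (L_minus_invariants _ _) iso.
split=> [nu lam lam' nint|lam lam' /lieIso_sym[f [bf fa]]].
  split=> /lieIso_sym[f [bf fa]].
    have [v [v0 Dv]] := lowest_vector lam' c'.
    apply/v0/(bij_inj bf); rewrite linear0; apply: (T_module_D_inj c0 nint).
    by rewrite -fa Dv linear0.
  have [v [v0 Iv]] := highest_vector (lam' + 1) c'.
  apply/v0/(bij_inj bf); rewrite linear0; apply: (T_module_I1_inj c0).
  by rewrite -fa Iv linear0.
(* I_1 is injective on L(lam, c, +), which lies inside a tensor module, but kills the top vector of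
   L(lam', c', -). *)
have [v [v0 Iv]] := highest_vector (lam' + 1) c'.
apply/v0/(bij_inj bf); rewrite linear0; apply: val_inj; apply: (T_module_I1_inj c0).
by have := congr1 val (fa (AI _ 1) v); rewrite Iv linear0 /= => <-.
Qed.
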